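(* Let $\pi$ be a pyramid with $k$ boxes in its first row and $l$ in its second row, and let $\sigma=(s_{i,j})$ be a shift matrix compatible with $\pi$. The algebras $W_\pi^0$, $W_\pi^+$ and $W_\pi^-$ are free supercommutative superalgebras on generators $\Omega_0$, $\Omega_+$ and $\Omega_-$, respectively. Multiplication defines vector space isomorphisms $$W_\pi^-\otimes W_\pi^0\otimes W_\pi^+\xrightarrow{\sim}W_\pi,\qquad W_\pi^0\otimes W_\pi^+\xrightarrow{\sim}W_\pi^\sharp,\qquad W_\pi^-\otimes W_\pi^0\xrightarrow{\sim}W_\pi^\flat.$$ Moreover, there are unique surjective homomorphisms $W_\pi^\sharp\twoheadrightarrow W_\pi^0$ and $W_\pi^\flat\twoheadrightarrow W_\pi^0$ sending $e^{(r)}\mapsto0$ for all $r>s_{1,2}$, respectively $f^{(r)}\mapsto0$ for all $r>s_{2,1}$, such that the restriction of these maps to the subalgebra $W_\pi^0$ is the identity.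
   Context: Superalgebras are $\mathbb Z/2$-graded associative algebras over $\mathbb C$; $[x,y]=xy-(-1)^{|x||y|}yx$; supercommutative means all supercommutators vanish. Fix a parity sequence $(|1|,|2|)\in(\mathbb Z/2)^2$ with $|1|\ne|2|$. A pyramid $\pi$ is a collection of boxes in the plane in two connected rows, with $k$ boxes in the first (top) row and $l\ge k$ in the second (bottom) row, each box of the top row lying directly above a box of the bottom row. Columns are numbered $1,\dots,l$ from left to right. Row $i$ has parity $|i|$. Let $m$ (resp. $n$) be the number of boxes in the row of parity $\bar0$ (resp. $\bar1$); label the boxes of the even (resp. odd) row from left to right by $1,\dots,m$ (resp. $m+1,\dots,m+n$). Write $\mathrm{row}(i),\mathrm{col}(i)$ for the row and column of box $i$. A shift matrix is a $2\times2$ matrix $\sigma=(s_{i,j})$ of non-negative integers with $s_{1,1}=s_{2,2}=0$; it is compatible with $\pi$ if either $k>0$ and $\pi$ has $s_{2,1}$ columns of height one on its left side and $s_{1,2}$ on its right side, or $k=0$ and $l=s_{2,1}+s_{1,2}$. Let $\mathfrak g=\mathfrak{gl}_{m|n}(\mathbb C)$, with matrix units $e_{i,j}$ of parity $|\mathrm{row}(i)|+|\mathrm{row}(j)|$, $\bar e_{i,j}=(-1)^{|\mathrm{row}(i)|}e_{i,j}$, $(x|y)=\mathrm{str}(xy)$. Let $e=\sum e_{i,j}$ over all $(i,j)$ such that box $j$ is immediately to the right of box $i$ in the same row; $\chi(x)=(x|e)$. Grade $\mathfrak g$ by $\deg(e_{i,j})=\mathrm{col}(j)-\mathrm{col}(i)$;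 $\mathfrak p=\bigoplus_{r\ge0}\mathfrak g(r)$, $\mathfrak m=\bigoplus_{r<0}\mathfrak g(r)$, $\mathfrak m_\chi=\{x-\chi(x)\mid x\in\mathfrak m\}$. The principal $W$-algebra is $W_\pi=\{u\in U(\mathfrak p)\mid u\,\mathfrak m_\chi\subseteq\mathfrak m_\chi U(\mathfrak g)\}$. Write $i\prec j$ if $\mathrm{col}(i)<\mathrm{col}(j)$, or $\mathrm{col}(i)=\mathrm{col}(j)$ and $\mathrm{row}(i)<\mathrm{row}(j)$. Let $\tilde\rho(e_{j,j})=(-1)^{|\mathrm{row}(j)|}\big(\#\{i\mid i\preceq j,|\mathrm{row}(i)|=\bar1\}-\#\{i\mid i\prec j,|\mathrm{row}(i)|=\bar0\}\big)$ and let $S_{\tilde\rho}$ be the automorphism $e_{i,j}\mapsto e_{i,j}+\delta_{i,j}\tilde\rho(e_{i,i})$ of $U(\mathfrak p)$. For $1\le i,j\le2$, $0\le\varsigma\le2$, $r\ge1$, $$t_{i,j;\varsigma}^{(r)}=S_{\tilde\rho}\Big(\sum_{s=1}^r(-1)^{r-s}\sum(-1)^{\#\{a=1,\dots,s-1\mid\mathrm{row}(j_a)\le\varsigma\}}\bar e_{i_1,j_1}\cdots\bar e_{i_s,j_s}\Big),$$ the inner sum over all $1\le i_1,\dots,i_s,j_1,\dots,j_s\le m+n$ such that: $\mathrm{row}(i_1)=i$, $\mathrm{row}(j_s)=j$; $\mathrm{col}(i_a)\le\mathrm{col}(j_a)$ for $1\le a\le s$; and for $1\le a\le s-1$: $\mathrm{row}(i_{a+1})=\mathrm{row}(j_a)$,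 $\mathrm{col}(i_{a+1})>\mathrm{col}(j_a)$ if $\mathrm{row}(j_a)>\varsigma$, $\mathrm{col}(i_{a+1})\le\mathrm{col}(j_a)$ if $\mathrm{row}(j_a)\le\varsigma$; and $\sum_a\deg(e_{i_a,j_a})=r-s$. Drinfeld generators of $W_\pi$: $d_1^{(r)}=t_{1,1;0}^{(r)}$, $d_2^{(r)}=t_{2,2;1}^{(r)}$ ($r>0$), $e^{(r)}=t_{1,2;1}^{(r)}$ ($r>s_{1,2}$), $f^{(r)}=t_{2,1;1}^{(r)}$ ($r>s_{2,1}$). Established fact fixing the setup: these elements lie in $W_\pi$ and identify $W_\pi$ with the superalgebra (the shifted Yangian $Y_\sigma^l$ of level $l$) generated by even $d_1^{(r)},d_2^{(r)}$ ($r>0$) and odd $e^{(r)}$ ($r>s_{1,2}$), $f^{(r)}$ ($r>s_{2,1}$) subject only to $d_1^{(r)}=0$ for $r>k$ and $$[d_i^{(r)},d_j^{(s)}]=[e^{(r)},e^{(s)}]=[f^{(r)},f^{(s)}]=0,\quad[e^{(r)},f^{(s)}]=(-1)^{|1|}\sum_{a=0}^{r+s-1}\tilde d_1^{(a)}d_2^{(r+s-1-a)},$$ $$[d_i^{(r)},e^{(s)}]=(-1)^{|1|}\sum_{a=0}^{r-1}d_i^{(a)}e^{(r+s-1-a)},\quad[d_i^{(r)},f^{(s)}]=-(-1)^{|1|}\sum_{a=0}^{r-1}f^{(r+s-1-a)}d_i^{(a)},$$ with $d_i^{(0)}=1$ and $\sum_{a=0}^r\tilde d_i^{(a)}d_i^{(r-a)}=\delta_{r,0}$.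 Let $\Omega_0=\{d_1^{(r)},d_2^{(s)}\mid0<r\le k,0<s\le l\}$, $\Omega_+=\{e^{(r)}\mid s_{1,2}<r\le s_{1,2}+k\}$, $\Omega_-=\{f^{(r)}\mid s_{2,1}<r\le s_{2,1}+k\}$. $W_\pi^0,W_\pi^+,W_\pi^-$ are the subalgebras of $W_\pi$ generated by $\Omega_0,\Omega_+,\Omega_-$, respectively; $W_\pi^\sharp$ (resp. $W_\pi^\flat$) is the subalgebra generated by $\Omega_0\cup\Omega_+$ (resp. $\Omega_-\cup\Omega_0$). (All $e^{(r)}$, $r>s_{1,2}$, lie in $W_\pi^\sharp$ and all $f^{(r)}$, $r>s_{2,1}$, lie in $W_\pi^\flat$.) *)

(* Defs.v *)
From HB Require Import structures.
From mathcomp Require Import all_boot all_order all_algebra.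
From mathcomp Require Import boolp classical_sets reals.
From mathcomp Require Export complex.
From mathcomp.multinomials Require Import monalg.

Set Implicit Arguments.
Unset Strict Implicit.
Unset Printing Implicit Defensive.

Import GRing.Theory.
Local Open Scope ring_scope.
Local Open Scope classical_set_scope.
Local Open Scope quotient_scope.

Section Span.
Context {C : fieldType} {V : lmodType C}.

Definition is_submod (P : set V) : Prop :=
  P 0 /\ forall (a : C) (u v : V), P u -> P v -> P (a *: u + v).

Definition lspan (S : set V) : set V := smallest is_submod S.

Lemma lspan_submod (S : set V) : is_submod (lspan S).
Proof.
split=> [P [[P0 _] _]//|a u v Su Sv P PS].
by apply: PS.1.2; [apply: Su | apply: Sv].
Qed.

Lemma sub_lspan (S : set V) : S `<=` lspan S.
Proof. by move=> v Sv P [_]; apply. Qed.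

Lemma lspan_sub (S P : set V) : is_submod P -> S `<=` P -> lspan S `<=` P.
Proof. by move=> HP SP v; apply; split. Qed.

Definition lspan_pred (S : set V) : {pred V} := [pred v | v \in lspan S].

Lemma lspan_predP (S : set V) v : reflect (lspan S v) (v \in lspan_pred S).
Proof. by rewrite inE; apply: (iffP idP); rewrite in_setE. Qed.

Fact lspan_zmod_closed (S : set V) : zmod_closed (lspan_pred S).
Proof.
have [S0 SD] := lspan_submod S.
split=> [|u v /lspan_predP Su /lspan_predP Sv]; apply/lspan_predP => //.
by rewrite addrC -scaleN1r; apply: SD.
Qed.

HB.instance Definition _ (S : set V) :=
  GRing.isZmodClosed.Build V (lspan_pred S) (lspan_zmod_closed S).

Definition lquot (S : set V) : Type := Quotient.quot (lspan_pred S).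

HB.instance Definition _ (S : set V) := GRing.Zmodule.on (lquot S).
HB.instance Definition _ (S : set V) :=
  EqQuotient.on (lquot S).

Definition lpi (S : set V) (v : V) : lquot S := \pi_(lquot S) v.

Lemma lpiE (S : set V) u v : lpi S u = lpi S v <-> lspan S (u - v).
Proof.
rewrite /lpi; split=> [/eqP|Suv]; last apply/eqP.
  by rewrite -Quotient.idealrBE => /lspan_predP.
by rewrite -Quotient.idealrBE; apply/lspan_predP.
Qed.

Lemma lpi_repr (S : set V) (x : lquot S) : lpi S (repr x) = x.
Proof. by rewrite /lpi reprK. Qed.

Lemma lpiD (S : set V) u v : lpi S (u + v) = lpi S u + lpi S v.
Proof. exact: (raddfD (\pi_(lquot S))). Qed.

Definition lquot_scale (S : set V) (a : C) (x : lquot S) : lquot S :=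
  lpi S (a *: repr x).

Lemma lpiZ (S : set V) a v : lquot_scale a (lpi S v) = lpi S (a *: v).
Proof.
apply/lpiE; rewrite -scalerBr -[_ *: _]addr0.
have [S0 SD] := lspan_submod S; apply: SD => //.
by apply/lpiE; rewrite lpi_repr.
Qed.

Fact lquot_scaleA (S : set V) a b (x : lquot S) :
  lquot_scale a (lquot_scale b x) = lquot_scale (a * b) x.
Proof. by rewrite -[x]lpi_repr !lpiZ scalerA. Qed.
Fact lquot_scale1 (S : set V) : left_id 1 (@lquot_scale S).
Proof. by move=> x; rewrite -[x]lpi_repr lpiZ scale1r. Qed.
Fact lquot_scaleDr (S : set V) : right_distributive (@lquot_scale S) +%R.
Proof.
by move=> a x y; rewrite -[x]lpi_repr -[y]lpi_repr -lpiD !lpiZ scalerDr lpiD.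
Qed.
Fact lquot_scaleDl (S : set V) (x : lquot S) :
  {morph (@lquot_scale S)^~ x : a b / a + b}.
Proof. by move=> a b; rewrite -[x]lpi_repr !lpiZ scalerDl lpiD. Qed.

HB.instance Definition _ (S : set V) :=
  GRing.Zmodule_isLmodule.Build C (lquot S)
    (@lquot_scaleA S) (@lquot_scale1 S) (@lquot_scaleDr S) (@lquot_scaleDl S).

Lemma lpi_scale (S : set V) a v : lpi S (a *: v) = a *: lpi S v.
Proof. exact/esym/lpiZ. Qed.

Lemma lpi_is_linear (S : set V) a u v :
  lpi S (a *: u + v) = a *: lpi S u + lpi S v.
Proof. by rewrite lpiD -lpiZ. Qed.

End Span.

Section Tensor.
Context {C : fieldType}.

Section Def.
Variables V W : lmodType C.

Definition pair_basis (v : V) (w : W) : {malg C[(V * W)%type]} :=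
  mkmalgU (v, w) 1.

Inductive tensor_rel : set {malg C[(V * W)%type]} :=
| TensorRelL (a : C) (v v' : V) (w : W) : tensor_rel
    (pair_basis (a *: v + v') w - (a *: pair_basis v w + pair_basis v' w))
| TensorRelR (a : C) (v : V) (w w' : W) : tensor_rel
    (pair_basis v (a *: w + w') - (a *: pair_basis v w + pair_basis v w')).

Definition tensor : Type := lquot tensor_rel.
HB.instance Definition _ := GRing.Lmodule.on tensor.
End Def.

Definition tens (V W : lmodType C) (v : V) (w : W) : tensor V W :=
  lpi (@tensor_rel V W) (pair_basis v w).

End Tensor.

Definition free_alg (C : fieldType) (X : choiceType) : Type :=
  {malg C[{fmonom X}]}.

HB.instance Definition _ (C : fieldType) (X : choiceType) :=
  GRing.Lalgebra.on (free_alg C X).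


Fact free_alg_scaleAr (C : fieldType) (X : choiceType) (a : C)
  (x y : free_alg C X) : a *: (x * y) = x * (a *: y).
Proof.
have central (z : {malg C[{fmonom X}]}) : z * malgC a = malgC a * z.
  rewrite !malgM_def /malgC fgmulgU fgmulUg; apply: eq_bigr => k _.
  by rewrite mulm1 mul1m mulrC.
have sc (z : {malg C[{fmonom X}]}) : a *: z = malgC a * z by rewrite mul_malgC.
by rewrite !sc !mulrA -[X in X * _ = _]central.
Qed.

HB.instance Definition _ (C : fieldType) (X : choiceType) :=
  GRing.Lalgebra_isAlgebra.Build C (free_alg C X) (@free_alg_scaleAr C X).

Definition fgen {C : fieldType} {X : choiceType} (x : X) : free_alg C X :=
  mkmalgU (fmu x) 1.

(* The constant term.  The relations imposed below never have one; this makes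
   the quotient algebra non-trivial, as algType requires. *)
Definition const_coef {C : fieldType} {X : choiceType} (u : free_alg C X) : C :=
  mcoeff mone u.

Lemma const_coefD (C : fieldType) (X : choiceType) :
  {morph @const_coef C X : u v / u + v}.
Proof. exact: (@mcoeffD {fmonom X} C mone). Qed.
Lemma const_coefB (C : fieldType) (X : choiceType) :
  {morph @const_coef C X : u v / u - v}.
Proof. exact: (@mcoeffB {fmonom X} C mone). Qed.
Lemma const_coefZ (C : fieldType) (X : choiceType) (a : C) u :
  @const_coef C X (a *: u) = a * const_coef u.
Proof. exact: (@mcoeffZ {fmonom X} C a u mone). Qed.
Lemma const_coefM (C : fieldType) (X : choiceType) :
  {morph @const_coef C X : u v / u * v}.
Proof. exact: (@mcoeff1g_is_multiplicative {fmonom X} C).1. Qed.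
Lemma const_coef1 (C : fieldType) (X : choiceType) : @const_coef C X 1 = 1.
Proof. exact: (@mcoeff1g_is_multiplicative {fmonom X} C).2. Qed.
Lemma const_coef0 (C : fieldType) (X : choiceType) : @const_coef C X 0 = 0.
Proof. exact: mcoeff0. Qed.
Lemma const_coef_gen (C : fieldType) (X : choiceType) (x : X) :
  @const_coef C X (fgen x) = 0.
Proof.
rewrite /const_coef /fgen mcoeffU; case: eqP => // /(congr1 (@fdeg X)).
by rewrite fdegU fdeg1.
Qed.
Lemma const_coef_sum (C : fieldType) (X : choiceType) (I : Type) (r : seq I)
    (P : pred I) (F : I -> free_alg C X) :
  const_coef (\sum_(i <- r | P i) F i) = \sum_(i <- r | P i) const_coef (F i).
Proof. exact: (big_morph _ (@const_coefD C X) (const_coef0 C X)). Qed.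

Record relations (C : fieldType) (X : choiceType) := Relations {
  rel_set : set (free_alg C X);
  rel_const : forall u, rel_set u -> const_coef u = 0 }.

Section Presented.
Context {C : fieldType} {X : choiceType} (R : relations C X).
Local Notation F := (free_alg C X).

Definition rel_ideal_gen : set F :=
  [set u | exists x r y, rel_set R r /\ u = x * r * y].

Definition presented : Type := lquot rel_ideal_gen.
HB.instance Definition _ := GRing.Lmodule.on presented.

Definition ppi (u : F) : presented := lpi rel_ideal_gen u.
Definition pgen (x : X) : presented := ppi (fgen x).
Definition prepr (x : presented) : F := repr (x : lquot rel_ideal_gen).

Lemma preprK x : ppi (prepr x) = x.
Proof. exact: lpi_repr. Qed.
Lemma ppiE u v : ppi u = ppi v <-> lspan rel_ideal_gen (u - v).
Proof. exact: lpiE. Qed.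

Lemma rel_ideal_mul (u x y : F) :
  lspan rel_ideal_gen u -> lspan rel_ideal_gen (x * u * y).
Proof.
have [I0 ID] := lspan_submod rel_ideal_gen.
pose P := [set v | lspan rel_ideal_gen (x * v * y)].
move=> Iu; suff /(_ _ Iu) : lspan rel_ideal_gen `<=` P by [].
apply: lspan_sub => [|_ [v [r [w [Rr ->]]]]].
  split=> [|a v w Pv Pw]; rewrite /P /mkset; first by rewrite mulr0 mul0r.
  by rewrite mulrDr mulrDl -scalerAr -scalerAl; exact: ID Pv Pw.
by apply: sub_lspan; exists (x * v), r, (w * y); rewrite !mulrA.
Qed.

Definition presented_mul (x y : presented) : presented :=
  ppi (prepr x * prepr y).

Lemma ppiM u v : ppi (u * v) = presented_mul (ppi u) (ppi v).
Proof.
have [I0 ID] := lspan_submod rel_ideal_gen.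
apply/ppiE; set u' := prepr _; set v' := prepr _.
have -> : u * v - u' * v' = 1 *: (1 * (u - u') * v) + u' * (v - v') * 1.
  by rewrite scale1r mul1r mulr1 mulrBl mulrBr addrA subrK.
by apply: ID; apply: rel_ideal_mul; apply/ppiE; rewrite preprK.
Qed.

Lemma ppiD u v : ppi (u + v) = ppi u + ppi v.
Proof. exact: lpiD. Qed.
Lemma ppiZ a u : ppi (a *: u) = a *: ppi u.
Proof. exact: lpi_scale. Qed.

Fact presented_mulA : associative presented_mul.
Proof. by move=> x y z; rewrite -[x]preprK -[y]preprK -[z]preprK -!ppiM mulrA. Qed.
Fact presented_mul1 : left_id (ppi 1) presented_mul.
Proof. by move=> x; rewrite -[x]preprK -ppiM mul1r. Qed.
Fact presented_mulr1 : right_id (ppi 1) presented_mul.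
Proof. by move=> x; rewrite -[x]preprK -ppiM mulr1. Qed.
Fact presented_mulDl : left_distributive presented_mul +%R.
Proof.
move=> x y z; rewrite -[x]preprK -[y]preprK -[z]preprK.
by rewrite -ppiD -!ppiM mulrDl ppiD.
Qed.
Fact presented_mulDr : right_distributive presented_mul +%R.
Proof.
move=> x y z; rewrite -[x]preprK -[y]preprK -[z]preprK.
by rewrite -ppiD -!ppiM mulrDr ppiD.
Qed.
Fact presented_1neq0 : ppi 1 != 0.
Proof.
apply/eqP => e; have : lspan rel_ideal_gen (1 - 0).
  by apply/ppiE; rewrite e -[0 in RHS](scale0r 1) ppiZ scale0r.
rewrite subr0 => /(@lspan_sub _ _ _ [set u | const_coef u = 0]).
rewrite /= const_coef1 => h; have /eqP := oner_eq0 C; apply; apply: h.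
  split=> [|a u v /= u0 v0]; first exact: const_coef0.
  by rewrite const_coefD const_coefZ u0 v0 mulr0 addr0.
move=> _ [x [r [y [Rr ->]]]] /=.
by rewrite !const_coefM (rel_const Rr) mulr0 mul0r.
Qed.

HB.instance Definition _ := GRing.Zmodule_isNzRing.Build presented
  presented_mulA presented_mul1 presented_mulr1
  presented_mulDl presented_mulDr presented_1neq0.

Lemma ppi_mul u v : ppi (u * v) = ppi u * ppi v.
Proof. exact: ppiM. Qed.

Fact presented_scaleAl (a : C) (x y : presented) : a *: (x * y) = a *: x * y.
Proof.
rewrite -[x]preprK -[y]preprK -ppi_mul -!ppiZ -ppi_mul.
by rewrite scalerAl.
Qed.
HB.instance Definition _ := GRing.Lmodule_isLalgebra.Build C presented
  presented_scaleAl.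
Fact presented_scaleAr (a : C) (x y : presented) : a *: (x * y) = x * (a *: y).
Proof.
rewrite -[x]preprK -[y]preprK -ppi_mul -!ppiZ -ppi_mul.
by rewrite scalerAr.
Qed.
HB.instance Definition _ := GRing.Lalgebra_isAlgebra.Build C presented
  presented_scaleAr.

End Presented.

Arguments presented {C X} R.

Section Subalgebra.
Context {C : fieldType} {A : algType C}.

Definition is_subalg (P : set A) : Prop :=
  [/\ is_submod P, P 1 & forall x y, P x -> P y -> P (x * y)].

Record subalgebra := Subalgebra {
  subalg_set : set A;
  subalg_setP : is_subalg subalg_set }.

Fact subalg_genP (S : set A) : is_subalg (smallest is_subalg S).
Proof.
split; first split=> [P [[[P0 _] _ _] _]//|a u v Su Sv P PS].
- by have [[_ PD] _ _] := PS.1; apply: PD; [apply: Su | apply: Sv].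
- by move=> P [[]].
- by move=> u v Su Sv P PS; have [_ _ PM] := PS.1; apply: PM; [apply: Su | apply: Sv].
Qed.

Definition subalg_gen (S : set A) : subalgebra := Subalgebra (subalg_genP S).

Definition subalg_pred (W : subalgebra) : {pred A} :=
  [pred x | x \in subalg_set W].

Lemma subalg_predP (W : subalgebra) x : reflect (subalg_set W x) (x \in subalg_pred W).
Proof. by rewrite inE; apply: (iffP idP); rewrite in_setE. Qed.

Fact subalg_pred_closed (W : subalgebra) : subalg_closed (subalg_pred W).
Proof.
have [[W0 WD] W1 WM] := subalg_setP W.
split=> [|a u v /subalg_predP Wu /subalg_predP Wv
        |u v /subalg_predP Wu /subalg_predP Wv]; apply/subalg_predP => //.
  exact: WD.
exact: WM.
Qed.

HB.instance Definition _ (W : subalgebra) :=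
  GRing.isSubalgClosed.Build C A (subalg_pred W) (subalg_pred_closed W).

Definition subalg_sort (W : subalgebra) : Type := {x : A | x \in subalg_pred W}.

HB.instance Definition _ (W : subalgebra) := SubChoice.on (subalg_sort W).
HB.instance Definition _ (W : subalgebra) :=
  [SubChoice_isSubAlgebra of subalg_sort W by <:].

Definition incl (W : subalgebra) (x : subalg_sort W) : A := \val x.

End Subalgebra.

Arguments subalgebra {C} A.
Coercion subalg_sort : subalgebra >-> Sortclass.

Section Whittaker.
Context {C : fieldType} {A : algType C}.
Variables (P : subalgebra A) (M : set A).

Definition right_ideal : set A := lspan [set y * z | y in M & z in setT].

Definition whittaker_set : set A :=
  [set u | subalg_set P u /\ forall y, M y -> right_ideal (u * y)].

Fact whittaker_subalg : is_subalg whittaker_set.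
Proof.
have [[p0 pD] p1 pM] := subalg_setP P.
have [m0 mD] := lspan_submod [set y * z | y in M & z in setT].
split; first split.
- by split=> // y _; rewrite mul0r.
- move=> a u v [pu Wu] [pv Wv]; split=> [|y my]; first exact: pD.
  by rewrite mulrDl -scalerAl; apply: mD; [apply: Wu | apply: Wv].
- split=> // y my; rewrite mul1r; apply: sub_lspan.
  by exists y => //; exists 1; rewrite ?mulr1.
move=> u v [pu Wu] [pv Wv]; split=> [|y my]; first exact: pM.
pose P' := [set z : A | right_ideal (u * z)].
suff /(_ _ (Wv y my)) : right_ideal `<=` P' by rewrite /P' /mkset mulrA.
apply: lspan_sub => [|_ [z mz [w _ <-]]].
  split=> [|a z w Pz Pw]; rewrite /P' /mkset; first by rewrite mulr0.
  by rewrite mulrDr -scalerAr; exact: mD Pz Pw.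
rewrite /P' /mkset mulrA.
pose Q := [set x : A | right_ideal (x * w)].
suff /(_ _ (Wu z mz)) : right_ideal `<=` Q by [].
apply: lspan_sub => [|_ [x mx [x' _ <-]]].
  split=> [|a x x' Qx Qx']; rewrite /Q /mkset; first by rewrite mul0r.
  by rewrite mulrDl -scalerAl; exact: mD Qx Qx'.
by apply: sub_lspan; exists x => //; exists (x' * w); rewrite ?mulrA.
Qed.

Definition whittaker : subalgebra A := Subalgebra whittaker_subalg.

End Whittaker.

Definition supercomm {A : pzRingType} (p q : bool) (x y : A) : A :=
  x * y - (-1) ^+ (p && q) * (y * x).

Section Grading.
Context {C : fieldType} {A : algType C}.

Inductive homog_prod (G : bool -> set A) : bool -> set A :=
| HomogOne : homog_prod G false 1
| HomogMul p q x y : G p x -> homog_prod G q y ->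
    homog_prod G (p (+) q) (x * y).

(* The Z/2-grading of an algebra generated by homogeneous elements, those of
   parity p being the elements of G p. *)
Definition gen_grading (G : bool -> set A) (p : bool) : set A :=
  lspan (homog_prod G p).

Definition sub_grading (gr : bool -> set A) (W : subalgebra A) (p : bool) :
  set W := [set x : W | gr p (incl x)].

End Grading.

Arguments sub_grading {C A} gr W p _.

Definition presented_grading {C : fieldType} {X : choiceType}
    (R : relations C X) (par : X -> bool) : bool -> set (presented R) :=
  gen_grading (fun p => [set pgen R x | x in [set x | par x = p]]).

Arguments presented_grading {C X} R par.

Definition even_map {A B : Type} (grA : bool -> set A) (grB : bool -> set B)
    (f : A -> B) : Prop :=
  forall p x, grA p x -> grB p (f x).

(* The elements g x lie in W, and x |-> g x induces an isomorphism of
   superalgebras from the superalgebra generated by X, with parities par, subject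
   only to the relations R, onto W. *)
Definition presented_by {C : fieldType} {A : algType C} (gr : bool -> set A)
    (W : subalgebra A) (X : choiceType) (par : X -> bool) (R : relations C X)
    (g : X -> A) : Prop :=
  exists phi : {lrmorphism presented R -> W},
    [/\ even_map (presented_grading R par) (sub_grading gr W) phi,
        bijective phi
      & forall x : X, incl (phi (pgen R x)) = g x].

Section FreeSupercommutative.
Variables (C : fieldType) (X : choiceType) (par : X -> bool).

Inductive supercomm_rel : set (free_alg C X) :=
| SupercommRel x y :
    supercomm_rel (supercomm (par x) (par y) (fgen x) (fgen y)).

Fact supercomm_rel_const u : supercomm_rel u -> const_coef u = 0.
Proof.
by case=> x y; rewrite /supercomm const_coefB !const_coefM !const_coef_gen
  !mulr0 subr0.
Qed.

Definition supercomm_relations : relations C X :=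
  Relations supercomm_rel_const.

End FreeSupercommutative.

Definition free_supercommutative_on {C : fieldType} {A : algType C}
    (gr : bool -> set A) (W : subalgebra A) (X : choiceType) (par : X -> bool)
    (g : X -> A) : Prop :=
  presented_by gr W par (supercomm_relations C par) g.

Section GlSuper.
Context {C : fieldType} {N : nat}.
Variable par : 'I_N -> bool.

Definition mx_homog (p : bool) : set 'M[C]_N :=
  [set x | forall i j, x i j != 0 -> par i (+) par j = p].

Definition str (x : 'M[C]_N) : C := \sum_i (-1) ^+ par i * x i i.

(* The relations of the tensor algebra, followed by those identifying
   supercommutators with the bracket of the Lie superalgebra. *)
Inductive gl_rel : set (free_alg C 'M[C]_N) :=
| GlLinear (a : C) x y : gl_rel (fgen (a *: x + y) - (a *: fgen x + fgen y))
| GlBracket p q x y : mx_homog p x -> mx_homog q y ->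
    gl_rel (supercomm p q (fgen x) (fgen y) - fgen (supercomm p q x y)).

Fact gl_rel_const u : gl_rel u -> const_coef u = 0.
Proof.
case=> [a x y|p q x y _ _]; rewrite /supercomm !const_coefB.
  by rewrite const_coefD const_coefZ !const_coef_gen mulr0 addr0 subr0.
by rewrite !const_coefM !const_coef_gen !mulr0 !subr0.
Qed.

Definition gl_relations : relations C 'M[C]_N := Relations gl_rel_const.

Definition Ugl : Type := presented gl_relations.
HB.instance Definition _ := GRing.Algebra.on Ugl.

Definition iota (x : 'M[C]_N) : Ugl := pgen gl_relations x.

Definition Ugl_grading : bool -> set Ugl :=
  gen_grading (fun p => [set iota x | x in mx_homog p]).

End GlSuper.

(* The rows 1, 2 of the pyramid are the elements 0, 1 of 'I_2.  The first
   pyr_off columns have no box in the top row. *)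
Record pyramid := Pyramid {
  pyr_k : nat;
  pyr_l : nat;
  pyr_off : nat;
  pyr_fits : (pyr_off + pyr_k <= pyr_l)%N }.

Definition is_shift_matrix (s : 'M[nat]_2) : Prop := s 0 0 = 0%N /\ s 1 1 = 0%N.

Definition s12 (s : 'M[nat]_2) : nat := s 0 1.
Definition s21 (s : 'M[nat]_2) : nat := s 1 0.

Definition compatible (s : 'M[nat]_2) (py : pyramid) : Prop :=
  if (0 < pyr_k py)%N then
    pyr_off py = s21 s /\ pyr_l py = (s21 s + pyr_k py + s12 s)%N
  else pyr_l py = (s21 s + s12 s)%N.

Definition row_size (py : pyramid) (r : 'I_2) : nat :=
  if r == 0 then pyr_k py else pyr_l py.

Definition row_off (py : pyramid) (r : 'I_2) : nat :=
  if r == 0 then pyr_off py else 0%N.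

Section PrincipalW.
Variables (C : fieldType) (par : 'I_2 -> bool) (py : pyramid).

Definition even_row : 'I_2 := if par 0 then 1 else 0.
Definition odd_row : 'I_2 := if par 0 then 0 else 1.

Definition pyr_m : nat := row_size py even_row.
Definition pyr_n : nat := row_size py odd_row.
Local Notation N := (pyr_m + pyr_n)%N.

Definition brow (i : 'I_N) : 'I_2 := if (i < pyr_m)%N then even_row else odd_row.

Definition bcol (i : 'I_N) : nat :=
  (row_off py (brow i) + (if i < pyr_m then val i else val i - pyr_m)).+1%N.

Definition bpar (i : 'I_N) : bool := par (brow i).

Definition edeg (i j : 'I_N) : int := (bcol j)%:Z - (bcol i)%:Z.

Local Notation g := 'M[C]_N.
Local Notation U := (@Ugl C N bpar).
Local Notation iota := (@iota C N bpar).

Definition nilp_e : g :=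
  \matrix_(i, j) ((brow i == brow j) && (bcol j == (bcol i).+1))%:R.

Definition chi (x : g) : C := str bpar (x *m nilp_e).

Definition p_sub : set g := [set x | forall i j, x i j != 0 -> 0 <= edeg i j].
Definition m_sub : set g := [set x | forall i j, x i j != 0 -> edeg i j < 0].

(* By the PBW theorem U(p) is the subalgebra of U(g) generated by p. *)
Definition Up : subalgebra U := subalg_gen [set iota x | x in p_sub].

Definition m_chi : set U := [set iota x - (chi x)%:A | x in m_sub].

Definition Wpi : subalgebra U := whittaker Up m_chi.

Definition bprec (i j : 'I_N) : bool :=
  (bcol i < bcol j)%N || ((bcol i == bcol j) && (brow i < brow j)%N).

Definition rho_t (j : 'I_N) : C :=
  (-1) ^+ bpar j * (#|[pred i | ((i == j) || bprec i j) && bpar i]|%:R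
                    - #|[pred i | bprec i j && ~~ bpar i]|%:R).

(* The image under S_rho of (-1)^|row i| e_{i,j}, where x = (i, j).  Since S_rho
   is an algebra automorphism, it is applied factor by factor in t_elt below. *)
Definition S_ebar (x : 'I_N * 'I_N) : U :=
  (-1) ^+ bpar x.1
    *: (iota (delta_mx x.1 x.2) + ((x.1 == x.2)%:R * rho_t x.1)%:A).

(* brow j < sg encodes row(j) <= sg, rows being numbered from 0 in 'I_2. *)
Definition t_step (sg : nat) (x y : 'I_N * 'I_N) : bool :=
  (brow y.1 == brow x.2) &&
  (if (brow x.2 < sg)%N then (bcol y.1 <= bcol x.2)%N
   else (bcol x.2 < bcol y.1)%N).

Definition t_index (i j : 'I_2) (sg r s : nat)
    (w : s.+1.-tuple ('I_N * 'I_N)) : bool :=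
  [&& brow (thead w).1 == i, brow (last (thead w) w).2 == j,
      all (fun x => bcol x.1 <= bcol x.2)%N w, sorted (t_step sg) w
    & \sum_(x <- w) edeg x.1 x.2 == r%:Z - s.+1%:Z].

(* The words w = ((i_1, j_1), ..., (i_{s+1}, j_{s+1})) have s + 1 letters. *)
Definition t_elt (i j : 'I_2) (sg r : nat) : U :=
  \sum_(s < r) (-1) ^+ (r - s.+1) *:
    \sum_(w : s.+1.-tuple ('I_N * 'I_N) | t_index i j sg r w)
      (-1) ^+ count (fun x => brow x.2 < sg)%N (take s w) *:
        \prod_(x <- w) S_ebar x.

End PrincipalW.

Arguments t_elt C par py i j sg r.
Arguments Wpi C par py.

(* ((i, j), r) stands for d_1^(r), e^(r), f^(r), d_2^(r) when (i, j) is
   (0, 0), (0, 1), (1, 0), (1, 1) respectively. *)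
Definition dindex : Type := ('I_2 * 'I_2 * nat)%type.
HB.instance Definition _ := Choice.on dindex.

Definition dparity (par : 'I_2 -> bool) (x : dindex) : bool :=
  par x.1.1 (+) par x.1.2.

(* d_1 = t_{1,1;0}, d_2 = t_{2,2;1}, e = t_{1,2;1}, f = t_{2,1;1} *)
Definition drinfeld (C : fieldType) (par : 'I_2 -> bool) (py : pyramid)
    (x : dindex) : @Ugl C _ (@bpar par py) :=
  t_elt C par py x.1.1 x.1.2 (maxn x.1.1 x.1.2) x.2.

Arguments drinfeld C par py x.

Section ShiftedYangian.
Variables (C : fieldType) (par : 'I_2 -> bool) (s : 'M[nat]_2) (k : nat).

Definition ygen : Type := {x : dindex | (s x.1.1 x.1.2 < x.2)%N}.
HB.instance Definition _ := SubChoice.on ygen.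

Local Notation F := (free_alg C ygen).

Definition yelt (i j : 'I_2) (r : nat) : F :=
  if insub (i, j, r) is Some x then fgen (x : ygen) else 0.

Definition yd (i : 'I_2) (r : nat) : F := if r == 0%N then 1 else yelt i i r.
Definition ye (r : nat) : F := yelt 0 1 r.
Definition yf (r : nat) : F := yelt 1 0 r.

Definition is_dtilde (i : 'I_2) (dt : nat -> F) : Prop :=
  forall r, \sum_(a < r.+1) dt a * yd i (r - a) = (r == 0%N)%:R.

Local Notation sgn1 := ((-1) ^+ par 0 : C).

Inductive yangian_rel : set F :=
| YLevel r : (k < r)%N -> yangian_rel (yd 0 r)
| YDD i j r t : (0 < r)%N -> (0 < t)%N ->
    yangian_rel (supercomm false false (yd i r) (yd j t))
| YEE r t : (s12 s < r)%N -> (s12 s < t)%N ->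
    yangian_rel (supercomm true true (ye r) (ye t))
| YFF r t : (s21 s < r)%N -> (s21 s < t)%N ->
    yangian_rel (supercomm true true (yf r) (yf t))
| YEF dt r t : is_dtilde 0 dt -> (s12 s < r)%N -> (s21 s < t)%N ->
    yangian_rel (supercomm true true (ye r) (yf t)
      - sgn1 *: \sum_(a < r + t) dt a * yd 1 (r + t - 1 - a))
| YDE i r t : (0 < r)%N -> (s12 s < t)%N ->
    yangian_rel (supercomm false true (yd i r) (ye t)
      - sgn1 *: \sum_(a < r) yd i a * ye (r + t - 1 - a))
| YDF i r t : (0 < r)%N -> (s21 s < t)%N ->
    yangian_rel (supercomm false true (yd i r) (yf t)
      + sgn1 *: \sum_(a < r) yf (r + t - 1 - a) * yd i a).

Fact yelt_const i j r : const_coef (yelt i j r) = 0.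
Proof.
by rewrite /yelt; case: insubP => *; rewrite ?const_coef_gen ?const_coef0.
Qed.

Fact yd_const i r : const_coef (yd i r) = (r == 0%N)%:R.
Proof.
by rewrite /yd; case: eqP => _; rewrite ?const_coef1 ?yelt_const.
Qed.

Fact yangian_rel_const u : yangian_rel u -> const_coef u = 0.
Proof.
have sc p q x y : const_coef x = 0 -> const_coef (supercomm p q x y) = 0 :> C.
  move=> x0.
  by rewrite /supercomm const_coefB !const_coefM x0 mul0r !mulr0 subr0.
have d0 i r : (0 < r)%N -> const_coef (yd i r) = 0.
  by move=> r0; rewrite yd_const gtn_eqF.
case=> [r kr|i j r t r0 t0|r t sr st|r t sr st|dt r t dtP sr st|i r t r0 st|i r t r0 st].
- by apply: d0; apply: leq_ltn_trans kr.
- by rewrite sc ?d0.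
- by rewrite sc ?yelt_const.
- by rewrite sc ?yelt_const.
- rewrite const_coefB sc ?yelt_const // const_coefZ sub0r.
  have -> : (r + t)%N = (r + t - 1).+1.
    by rewrite subn1 prednK // ltn_addr //; apply: leq_ltn_trans sr.
  rewrite const_coef_sum; set q := (_ - 1)%N.
  rewrite subn1 /= big_ord_recl big1 => [|a _].
    rewrite addr0 const_coefM yd_const subn0.
    have -> : (q == 0)%N = false.
      have r1 : (0 < r)%N := leq_ltn_trans (leq0n _) sr.
      have t1 : (0 < t)%N := leq_ltn_trans (leq0n _) st.
      by rewrite /q; case: (r) (t) r1 t1 => [|r'] // [|t'] //; rewrite addnS subn1.
    by rewrite mulr0 mulr0 oppr0.
  rewrite const_coefM.
  have -> : const_coef (dt (lift ord0 a)) = 0.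
    have := congr1 (@const_coef C ygen) (dtP (lift ord0 a)).
    rewrite const_coef_sum big_ord_recr /= big1 => [|b _].
      rewrite subnn const_coefM yd_const mulr1 add0r => ->.
      exact: const_coef0.
    by rewrite const_coefM yd_const subn_eq0 leqNgt ltn_ord mulr0.
  by rewrite mul0r.
- rewrite const_coefB sc ?d0 // const_coefZ const_coef_sum big1 ?mulr0 ?subr0 //.
  by move=> a _; rewrite const_coefM yelt_const mulr0.
- rewrite const_coefD sc ?d0 // const_coefZ const_coef_sum big1 ?mulr0 ?addr0 //.
  by move=> a _; rewrite const_coefM yelt_const mul0r.
Qed.

Definition yangian_relations : relations C ygen :=
  Relations yangian_rel_const.

End ShiftedYangian.

Section Triangular.
Variables (C : fieldType) (par : 'I_2 -> bool) (py : pyramid) (s : 'M[nat]_2).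

Local Notation U := (@Ugl C _ (@bpar par py)).
Local Notation gr := (@Ugl_grading C _ (@bpar par py)).
Local Notation dr := (@drinfeld C par py).

(* The level enters the relations only through k: d_1^(r) = 0 for r > k. *)
Definition W_is_shifted_yangian : Prop :=
  presented_by gr (Wpi C par py) (fun x : ygen s => dparity par (val x))
    (yangian_relations C par s (pyr_k py)) (fun x => dr (val x)).

Definition Omega0 (x : dindex) : bool :=
  (x.1.1 == x.1.2) && (0 < x.2 <= row_size py x.1.1)%N.
Definition OmegaP (x : dindex) : bool :=
  (x.1 == (0, 1)) && (s12 s < x.2 <= s12 s + pyr_k py)%N.
Definition OmegaN (x : dindex) : bool :=
  (x.1 == (1, 0)) && (s21 s < x.2 <= s21 s + pyr_k py)%N.

Definition Wgen (Om : pred dindex) : subalgebra U :=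
  subalg_gen [set dr x | x in [set x | Om x]].

Definition W0 : subalgebra U := Wgen Omega0.
Definition WP : subalgebra U := Wgen OmegaP.
Definition WN : subalgebra U := Wgen OmegaN.
Definition Wsharp : subalgebra U := Wgen (predU Omega0 OmegaP).
Definition Wflat : subalgebra U := Wgen (predU OmegaN Omega0).

Definition free_supercommutative_on_Omega (Om : pred dindex) : Prop :=
  free_supercommutative_on gr (Wgen Om)
    (fun x : {x : dindex | Om x} => dparity par (val x)) (fun x => dr (val x)).

Definition mul_iso2 (A B W : subalgebra U) : Prop :=
  exists2 mu : {linear tensor A B -> W}, bijective mu &
    forall (a : A) (b : B), incl (mu (tens a b)) = incl a * incl b.

Definition mul_iso3 (A B D W : subalgebra U) : Prop :=
  exists2 mu : {linear tensor (tensor A B) D -> W}, bijective mu &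
    forall (a : A) (b : B) (d : D),
      incl (mu (tens (tens a b) d)) = incl a * incl b * incl d.

(* (i, j) = (0, 1) or (1, 0): the surjection kills e^(r), resp. f^(r). *)
Definition is_projection (W : subalgebra U) (i j : 'I_2) (phi : W -> W0) : Prop :=
  [/\ even_map (sub_grading gr W) (sub_grading gr W0) phi,
      forall y, exists x, phi x = y,
      forall r, (s i j < r)%N ->
        exists2 x : W, incl x = dr (i, j, r) & phi x = 0
    & forall (x : W) (y : W0), incl x = incl y -> phi x = y].

Definition unique_projection (W : subalgebra U) (i j : 'I_2) : Prop :=
  exists2 phi : {lrmorphism W -> W0}, is_projection i j phi &
    forall psi : {lrmorphism W -> W0}, is_projection i j psi -> psi =1 phi.

End Triangular.

Arguments W_is_shifted_yangian C par py s.
Arguments Omega0 py x.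
Arguments OmegaP py s x.
Arguments OmegaN py s x.
Arguments W0 C par py.
Arguments WP C par py s.
Arguments WN C par py s.
Arguments Wsharp C par py s.
Arguments Wflat C par py s.
Arguments free_supercommutative_on_Omega C par py Om.
Arguments unique_projection {C par py} s W i j.

(* Main.v *)
Require Import Defs.
From HB Require Import structures.
From mathcomp Require Import all_boot all_order all_algebra.
From mathcomp Require Import boolp classical_sets reals complex.
From mathcomp Require Import finmap zify ring.
From mathcomp.multinomials Require Import monalg.

Set Implicit Arguments.
Unset Strict Implicit.
Unset Printing Implicit Defensive.

Import GRing.Theory Num.Theory.
Local Open Scope ring_scope.
Local Open Scope classical_set_scope.

(** The hypothesis identifies [W] with an algebra [Y] given by generators and
    relations, so the theorem is a normal form statement about [Y] together with
    its linear consequences.  Write [E j], [F j] for the generators [e], [f]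
    numbered from their first admissible index, and [D0], [D1] for the two
    diagonal series; [l0] is the sum of the shifts, so that [l = l0 + k].

    Spanning.  As [D0 r = 0] for [r > k], the bracket of [D0 k.+1] with [E i] is a
    recursion expressing every [E j] through the first [k] ones with coefficients
    polynomial in [D0] on the left; likewise for [F].  The supercommutator of this
    recursion with [F j] contains the convolution of [D0] with the series
    [dt * D1], where [dt] is the inverse of [D0]: it solves for [D1 n] with
    [n > l] in terms of products [F D0 E] ([D1_high]).  Hence nothing but the
    generators of the three families Omega is needed, and moving each [E] to the
    right of each [F] shows that the products in triangular order span
    ([triangular_span]).

    Independence.  The algebra [Y] acts on the exterior algebra of [k] fermions,
    with creation operators [b i] and annihilation operators [a i], depending on
    parameters [x i], [q i], [z n].  The series [D0] acts by the product of the
    [1 - (x i + eps * n i) t], where [n i = b i * a i] is the number operator, the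
    quotient [D1 / D0] is a central scalar series whose coefficients beyond [l0]
    are the power sums [\sum_i q i * x i ^+ j], and [F j], [E j] are the sums
    [\sum_i x i ^+ j *: b i] and [\sum_i eps * q i * x i ^+ j *: a i]
    ([model_family]).  By the Vandermonde determinant [E] and [F] are, for generic
    parameters, just other bases of the annihilation and creation operators.
    A vanishing combination of the triangular products can then be tested on the
    states created from the vacuum by the duals of the [E] ([clifford_indep]),
    and it forces the coefficients, polynomials in [D0] and [D1], to vanish at the
    eigenvalues of the vacuum.  These eigenvalues are Zariski-dense when the
    parameters vary ([zero_of_generic]), so the coefficients are zero
    ([triangular_free]).

    Consequences.  Independence over the diagonal polynomials contains the freeness
    of the three subalgebras.  Since the outer factors are spanned by finitely many
    ordered monomials, every tensor is a finite sum of pure tensors of monomials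
    with diagonal coefficients, and independence is the injectivity of
    multiplication.  Finally the products with at least one [E] (or [F]) span
    an ideal complementary to the diagonal subalgebra, which gives the projections
    ([projection_of]).  They preserve parity because their values are even and
    the even and odd parts of the enveloping algebra meet trivially; this last
    fact comes from the automorphism changing the sign of the odd part
    ([parity_automorphism]). *)

(** * Linear combinations, subalgebras and presented algebras *)

Section LinearExtension.
Context {C : fieldType} {K : choiceType} {V : lmodType C} (h : K -> V).

Definition malg_lift (g : {malg C[K]}) : V :=
  \sum_(k <- msupp g) mcoeff k g *: h k.

Lemma malg_liftEw (d : {fset K}) (g : {malg C[K]}) : fsubset (msupp g) d ->
  malg_lift g = \sum_(k <- d) mcoeff k g *: h k.
Proof.
move=> le; rewrite [LHS](big_fset_incl _ le) => //= x xd /mcoeff_outdom ->.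
by rewrite scale0r.
Qed.

Fact malg_lift_linear : linear malg_lift.
Proof.
move=> a u v; pose d := fsetU (msupp (a *: u + v)) (fsetU (msupp u) (msupp v)).
have du : fsubset (msupp u) d by rewrite !fsubsetU ?fsubset_refl ?orbT.
have dv : fsubset (msupp v) d by rewrite !fsubsetU ?fsubset_refl ?orbT.
rewrite (@malg_liftEw d _ (fsubsetUl _ _)) (malg_liftEw du) (malg_liftEw dv).
rewrite scaler_sumr -big_split; apply: eq_bigr => k _ /=.
by rewrite mcoeffD mcoeffZ scalerDl scalerA.
Qed.

HB.instance Definition _ :=
  GRing.isLinear.Build C {malg C[K]} V *:%R malg_lift malg_lift_linear.

Lemma malg_liftU k : malg_lift (mkmalgU k 1) = h k.
Proof.
rewrite (malg_liftEw msuppU_le) big_seq_fset1 mcoeffUU; exact: scale1r.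
Qed.

End LinearExtension.

Lemma malg_ind (C : fieldType) (K : choiceType) (P : set {malg C[K]}) :
  is_submod P -> (forall k, P (mkmalgU k 1)) -> forall g, P g.
Proof.
move=> [P0 PD] PU g; rewrite [g]monalgE.
elim/big_ind: _ => // [u v Pu Pv|k _]; first by rewrite -[u]scale1r; exact: PD.
have -> : mkmalgU k (mcoeff k g) = mcoeff k g *: mkmalgU k 1 + 0.
  apply/malgP => k'; rewrite addr0 mcoeffZ !mcoeffU.
  by case: eqP => _; rewrite ?mulr1 ?mulr0.
exact: PD.
Qed.

Section LRMorphismBuild.
Context {C : fieldType} {A B : algType C} (f : A -> B).

(** The unbundled form, for maps whose target or source structure is not yet
    packaged. *)
Definition alg_morphism : Prop :=
  [/\ linear f, f 1 = 1 & forall x y, f (x * y) = f x * f y].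

Lemma lrmorphism_of : alg_morphism -> {g : {lrmorphism A -> B} | g =1 f}.
Proof.
case=> fL f1 fM.
pose L := GRing.isLinear.Build C A B *:%R f fL.
pose M := GRing.isMonoidMorphism.Build A B f (f1, fM).
pose g : {lrmorphism A -> B} := HB.pack f L M.
by exists g.
Qed.

End LRMorphismBuild.

Section UniversalProperty.
Context {C : fieldType} {X : choiceType} {B : algType C} (g : X -> B).

(** The universal property of the free algebra. *)
Definition falg_lift : free_alg C X -> B :=
  @malg_lift C {fmonom X} B (fun m => \prod_(x <- (m : seq X)) g x).

Lemma falg_lift_morphism : alg_morphism falg_lift.
Proof.
have L : linear falg_lift by exact: malg_lift_linear.
have U k : falg_lift (mkmalgU k 1) = \prod_(x <- (k : seq X)) g x.
  exact: malg_liftU.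
split=> // [|x y].
  by rewrite [1]/(mkmalgU _ _) U fm1 big_nil.
pose P u := falg_lift (u * y) = falg_lift u * falg_lift y.
pose Q k v := falg_lift (mkmalgU k 1 * v) = falg_lift (mkmalgU k 1) * falg_lift v.
have l0 : falg_lift 0 = 0.
  exact: (raddf0 (@malg_lift C {fmonom X} B _)).
suff: P x by [].
apply: (@malg_ind C _ P); first split.
- by rewrite /P mul0r l0 mul0r.
- move=> a u v Pu Pv; rewrite /P mulrDl -scalerAl !L.
  by rewrite mulrDl -scalerAl; congr (_ *: _ + _).
move=> k; apply: (@malg_ind C _ (Q k)); first split.
- by rewrite /Q mulr0 l0 mulr0.
- move=> a u v Pu Pv; rewrite /Q mulrDr -free_alg_scaleAr !L.
  by rewrite mulrDr -scalerAr; congr (_ *: _ + _).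
move=> k'; rewrite /Q [LHS](_ : _ = falg_lift (mkmalgU (mmul k k') 1)).
  by rewrite !U fmM big_cat.
congr falg_lift; rewrite [LHS]malgM_def fgmulUU; congr mkmalgU; exact: mulr1.
Qed.

Lemma falg_lift_gen x : falg_lift (fgen x) = g x.
Proof. by rewrite [LHS]malg_liftU fmU big_seq1. Qed.

End UniversalProperty.

HB.instance Definition _ (C : fieldType) (X : choiceType) (B : algType C)
    (g : X -> B) :=
  GRing.isLinear.Build C (free_alg C X) B *:%R (falg_lift g)
    (let: And3 l _ _ := falg_lift_morphism g in l).
HB.instance Definition _ (C : fieldType) (X : choiceType) (B : algType C)
    (g : X -> B) :=
  GRing.isMonoidMorphism.Build (free_alg C X) B (falg_lift g)
    (let: And3 _ l m := falg_lift_morphism g in (l, m)).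

Section Subspaces.
Context {C : fieldType} {V : lmodType C}.
Implicit Types P : set V.

Lemma submodD P u v : is_submod P -> P u -> P v -> P (u + v).
Proof. by move=> [_ PD] Pu Pv; rewrite -[u]scale1r; exact: PD. Qed.

Lemma submodZ P a u : is_submod P -> P u -> P (a *: u).
Proof. by move=> [P0 PD] Pu; rewrite -[_ *: _]addr0; exact: PD. Qed.

Lemma submodN P u : is_submod P -> P u -> P (- u).
Proof. by move=> HP Pu; rewrite -scaleN1r; exact: submodZ. Qed.

Lemma submodB P u v : is_submod P -> P u -> P v -> P (u - v).
Proof. by move=> HP Pu Pv; apply: submodD => //; exact: submodN. Qed.

Lemma submod_sum P (I : Type) (r : seq I) (Q : pred I) (F : I -> V) :
  is_submod P -> (forall i, Q i -> P (F i)) -> P (\sum_(i <- r | Q i) F i).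
Proof.
move=> HP PF; elim/big_ind: _ => //; first by case: HP.
by move=> u v; exact: submodD.
Qed.

Lemma lspan_range (I : finType) (h : I -> V) v :
  lspan (range h) v -> exists a : I -> C, v = \sum_i a i *: h i.
Proof.
apply: (@lspan_sub _ _ (range h) [set v | exists a : I -> C, v = \sum_i a i *: h i]).
  split=> [|b u w [a ->] [a' ->]].
    by exists (fun=> 0); rewrite big1 // => i _; rewrite scale0r.
  exists (fun i => b * a i + a' i).
  by rewrite scaler_sumr -big_split; apply: eq_bigr => i _; rewrite scalerDl scalerA.
move=> _ [i _ <-]; exists (fun j => (j == i)%:R).
rewrite (bigD1 i) //= eqxx scale1r big1 ?addr0 // => j /negPf->.
by rewrite scale0r.
Qed.

End Subspaces.

Section Products.
Context {C : fieldType} {A : algType C}.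

Definition mulspan (S T : set A) : set A :=
  lspan [set x | exists y z, [/\ S y, T z & x = y * z]].

Lemma mulspan_submod S T : is_submod (mulspan S T).
Proof. exact: lspan_submod. Qed.

Lemma mem_mulspan (S T : set A) x y : S x -> T y -> mulspan S T (x * y).
Proof. by move=> Sx Ty; apply: sub_lspan; exists x, y. Qed.

Lemma mulspan_sub (S T P : set A) : is_submod P ->
  (forall x y, S x -> T y -> P (x * y)) -> mulspan S T `<=` P.
Proof. by move=> HP H; apply: lspan_sub => // _ [x [y [Sx Ty ->]]]; exact: H. Qed.

Lemma submod_mull (P : set A) x : is_submod P -> is_submod [set y | P (x * y)].
Proof.
move=> [P0 PD]; split=> [|a u v /= Pu Pv]; first by rewrite /= mulr0.
by rewrite mulrDr -scalerAr; exact: PD.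
Qed.

Lemma submod_mulr (P : set A) x : is_submod P -> is_submod [set y | P (y * x)].
Proof.
move=> [P0 PD]; split=> [|a u v /= Pu Pv]; first by rewrite /= mul0r.
by rewrite mulrDl -scalerAl; exact: PD.
Qed.

Lemma mulspan_mull (S T P : set A) x : is_submod P ->
  (forall y z, S y -> T z -> P (x * y * z)) ->
  forall w, mulspan S T w -> P (x * w).
Proof.
move=> HP H; apply: (mulspan_sub (submod_mull x HP)) => y z Sy Tz /=.
by rewrite mulrA; exact: H.
Qed.

Lemma mulspan_mulr (S T P : set A) x : is_submod P ->
  (forall y z, S y -> T z -> P (y * (z * x))) ->
  forall w, mulspan S T w -> P (w * x).
Proof.
move=> HP H; apply: (mulspan_sub (submod_mulr x HP)) => y z Sy Tz /=.
by rewrite -mulrA; exact: H.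
Qed.

Lemma subalg_submod (P : set A) : is_subalg P -> is_submod P.
Proof. by case. Qed.
Lemma subalg1 (P : set A) : is_subalg P -> P 1.
Proof. by case. Qed.
Lemma subalgM (P : set A) x y : is_subalg P -> P x -> P y -> P (x * y).
Proof. by case=> _ _; exact. Qed.

Lemma sub_subalg_gen (S : set A) : S `<=` subalg_set (subalg_gen S).
Proof. by move=> x Sx P [_]; exact. Qed.

Lemma subalg_gen_sub (S P : set A) : is_subalg P -> S `<=` P ->
  subalg_set (subalg_gen S) `<=` P.
Proof. by move=> HP SP x; apply; split. Qed.

(** The elements carrying a subspace into itself by left multiplication form a
    subalgebra, so stability needs to be checked on generators only. *)
Lemma left_stabilizer_subalg (P : set A) :
  is_submod P -> is_subalg [set x | forall y, P y -> P (x * y)].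
Proof.
move=> [P0 PD]; split=> [||x y Px Py z Pz] /=; last 1 first.
- by rewrite -mulrA; apply: Px; exact: Py.
- split=> [y Py|a u v Pu Pv y Py] /=; first by rewrite mul0r.
  by rewrite mulrDl -scalerAl; apply: PD; [exact: Pu | exact: Pv].
- by move=> y; rewrite mul1r.
Qed.

Lemma right_stabilizer_subalg (P : set A) :
  is_submod P -> is_subalg [set x | forall y, P y -> P (y * x)].
Proof.
move=> [P0 PD]; split=> [||x y Px Py z Pz] /=; last 1 first.
- by rewrite mulrA; apply: Py; exact: Px.
- split=> [y Py|a u v Pu Pv y Py] /=; first by rewrite mulr0.
  by rewrite mulrDr -scalerAr; apply: PD; [exact: Pu | exact: Pv].
- by move=> y; rewrite mulr1.
Qed.

Lemma commutant_subalg (x : A) : is_subalg [set y | x * y = y * x].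
Proof.
split=> [||u v /= xu xv].
- split=> [|a u v /= xu xv]; first by rewrite /= mulr0 mul0r.
  by rewrite mulrDr mulrDl -scalerAr -scalerAl xu xv.
- by rewrite /= mulr1 mul1r.
- by rewrite mulrA xu -mulrA xv mulrA.
Qed.

End Products.

Section Preimage.
Context {C : fieldType} {A B : algType C}.

Lemma subalg_preimage (f : {lrmorphism A -> B}) (P : set B) :
  is_subalg P -> is_subalg [set x | P (f x)].
Proof.
move=> [[P0 PD] P1 PM]; split=> [||x y Px Py] /=.
- by split=> [|a u v Pu Pv] /=; rewrite ?raddf0 // linearP; exact: PD.
- by rewrite rmorph1.
- by rewrite rmorphM; exact: PM.
Qed.

End Preimage.

Section Inclusion.
Context {C : fieldType} {A : algType C} (W : subalgebra A).

Lemma incl_inj : injective (@incl C A W).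
Proof. exact: val_inj. Qed.
Lemma incl_mem (x : W) : subalg_set W (incl x).
Proof. exact/subalg_predP/valP. Qed.

Lemma incl_morphism : alg_morphism (@incl C A W).
Proof. by split=> [a u v||x y]; rewrite /incl ?linearP ?rmorph1 ?rmorphM. Qed.

Definition mkincl (x : A) (Wx : subalg_set W x) : W :=
  Sub x (introT (subalg_predP W x) Wx).

Lemma mkinclK x (Wx : subalg_set W x) : incl (mkincl Wx) = x.
Proof. exact: SubK. Qed.

Lemma corestrict (B : algType C) (f : {lrmorphism B -> A}) :
  (forall x, subalg_set W (f x)) ->
  {g : {lrmorphism B -> W} | forall x, incl (g x) = f x}.
Proof.
move=> Wf; have [g gE] : {g : {lrmorphism B -> W} | g =1 fun x => mkincl (Wf x)}.
  have [iL i1 iM] := incl_morphism.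
  apply: lrmorphism_of; split=> [a x y||x y]; apply: incl_inj.
  - by rewrite iL !mkinclK linearP.
  - by rewrite i1 mkinclK rmorph1.
  - by rewrite iM !mkinclK rmorphM.
by exists g => x; rewrite gE mkinclK.
Qed.

End Inclusion.

HB.instance Definition _ (C : fieldType) (A : algType C) (W : subalgebra A) :=
  GRing.isLinear.Build C W A *:%R (@incl C A W)
    (let: And3 l _ _ := incl_morphism W in l).
HB.instance Definition _ (C : fieldType) (A : algType C) (W : subalgebra A) :=
  GRing.isMonoidMorphism.Build W A (@incl C A W)
    (let: And3 _ l m := incl_morphism W in (l, m)).

Section PresentedUniversal.
Context {C : fieldType} {X : choiceType} (R : relations C X).

HB.instance Definition _ :=
  GRing.isLinear.Build C (free_alg C X) (presented R) *:%R (@ppi C X R)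
    (@lpi_is_linear _ _ _).
HB.instance Definition _ :=
  GRing.isMonoidMorphism.Build (free_alg C X) (presented R) (@ppi C X R)
    (erefl, @ppi_mul C X R).

Lemma ppi_rel u : rel_set R u -> ppi R u = 0.
Proof.
move=> Ru; rewrite -(raddf0 (@ppi C X R)); apply/ppiE; rewrite subr0.
by apply: sub_lspan; exists 1, u, 1; rewrite mul1r mulr1.
Qed.

Lemma falg_ind (P : set (free_alg C X)) :
  is_subalg P -> (forall x, P (fgen x)) -> forall u, P u.
Proof.
move=> [Ps P1 PM] Pg; apply: (@malg_ind C {fmonom X}) => // k.
case: k => s; elim: s => [|x s IHs].
  by have -> : mkmalgU (FMonom [::]) 1 = 1 :> free_alg C X by rewrite -fmoneE.
suff -> : mkmalgU (FMonom (x :: s)) 1 = fgen x * mkmalgU (FMonom s) 1 :> free_alg C X.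
  exact: PM.
rewrite [RHS]malgM_def fgmulUU mulr1; congr mkmalgU.
by apply/eqP; rewrite -val_eqE /= fmM fmU.
Qed.

Lemma presented_ind (P : set (presented R)) :
  is_subalg P -> (forall x, P (pgen R x)) -> forall y, P y.
Proof.
move=> HP Pg y; rewrite -[y]preprK.
by apply: (falg_ind (subalg_preimage (@ppi C X R) HP)) => x; exact: Pg.
Qed.

Lemma presented_lift (B : algType C) (g : X -> B) :
  (forall u, rel_set R u -> falg_lift g u = 0) ->
  {h : {lrmorphism presented R -> B} | forall u, h (ppi R u) = falg_lift g u}.
Proof.
move=> gR.
have kill u : lspan (rel_ideal_gen R) u -> falg_lift g u = 0.
  apply: (@lspan_sub _ _ _ [set u | falg_lift g u = 0]) => [|_ [x [r [y [Rr ->]]]]].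
    split=> [|a v w /= v0 w0]; first exact: raddf0.
    by rewrite linearP /= v0 w0 scaler0 addr0.
  by rewrite /= !rmorphM /= (gR _ Rr) mulr0 mul0r.
pose h (x : presented R) := falg_lift g (prepr x).
have hE u : h (ppi R u) = falg_lift g u.
  apply/eqP; rewrite -subr_eq0 -raddfB; apply/eqP/kill/ppiE.
  by rewrite preprK.
have [f fE] : {f : {lrmorphism presented R -> B} | f =1 h}.
  apply: lrmorphism_of; split=> [a x y||x y].
  - by rewrite -[x]preprK -[y]preprK -linearP !hE linearP.
  - by rewrite -(rmorph1 (@ppi C X R)) hE rmorph1.
  - by rewrite -[x]preprK -[y]preprK -rmorphM !hE rmorphM.
by exists f => u; rewrite fE hE.
Qed.

End PresentedUniversal.

(** * Tensor products *)

Lemma bij_of_inj_surj (S T : Type) (f : S -> T) :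
  injective f -> (forall y, exists x, f x = y) -> bijective f.
Proof.
move=> fI /choice[g gK]; exists g => // x; exact/fI/gK.
Qed.

Section Tensor.
Context {C : fieldType}.

Lemma lquot_lift (V Z : lmodType C) (S : set V) (f : {linear V -> Z}) :
  (forall x, S x -> f x = 0) ->
  {h : {linear lquot S -> Z} | forall v, h (lpi S v) = f v}.
Proof.
move=> fS; pose h (x : lquot S) := f (repr x).
have hE v : h (lpi S v) = f v.
  apply/eqP; rewrite -subr_eq0 -raddfB; apply/eqP.
  suff : lspan S `<=` [set u | f u = 0].
    by apply; apply/lpiE; rewrite lpi_repr.
  apply: lspan_sub => //; split=> [|a u w /= u0 w0]; first exact: raddf0.
  by rewrite linearP /= u0 w0 scaler0 addr0.
have hL : linear h.
  move=> a x y; rewrite -[x]lpi_repr -[y]lpi_repr -lpi_is_linear !hE.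
  exact: linearP.
pose L := GRing.isLinear.Build C (lquot S) Z *:%R h hL.
pose g : {linear lquot S -> Z} := HB.pack h L.
by exists g.
Qed.

Variables V W : lmodType C.

Lemma tensPl a v v' (w : W) :
  tens (a *: v + v' : V) w = a *: tens v w + tens v' w.
Proof.
rewrite /tens -lpi_is_linear; apply/lpiE; apply: sub_lspan; exact: (@TensorRelL C V W a v v' w).
Qed.

Lemma tensPr a (v : V) (w w' : W) :
  tens v (a *: w + w') = a *: tens v w + tens v w'.
Proof.
rewrite /tens -lpi_is_linear; apply/lpiE; apply: sub_lspan; exact: (@TensorRelR C V W a v w w').
Qed.

Lemma tensDr (v : V) (w w' : W) : tens v (w + w') = tens v w + tens v w'.
Proof. by have := tensPr 1 v w w'; rewrite !scale1r. Qed.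
Lemma tensDl (v v' : V) (w : W) : tens (v + v') w = tens v w + tens v' w.
Proof. by have := tensPl 1 v v' w; rewrite !scale1r. Qed.
Lemma tens0r (v : V) : tens v (0 : W) = 0.
Proof. by apply: (addrI (tens v 0)); rewrite -tensDr !addr0. Qed.
Lemma tens0l (w : W) : tens (0 : V) w = 0.
Proof. by apply: (addrI (tens 0 w)); rewrite -tensDl !addr0. Qed.
Lemma tensZr a (v : V) (w : W) : tens v (a *: w) = a *: tens v w.
Proof. by rewrite -[a *: w]addr0 tensPr tens0r addr0. Qed.
Lemma tensZl a (v : V) (w : W) : tens (a *: v) w = a *: tens v w.
Proof. by rewrite -[a *: v]addr0 tensPl tens0l addr0. Qed.

Lemma tensor_lift (Z : lmodType C) (b : V -> W -> Z) :
  (forall v, linear (b v)) -> (forall w, linear (b^~ w)) ->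
  {h : {linear tensor V W -> Z} | forall v w, h (tens v w) = b v w}.
Proof.
move=> bR bL; pose f : {linear {malg C[(V * W)%type]} -> Z} :=
  @malg_lift C (V * W)%type Z (fun x => b x.1 x.2).
have fE v w : f (pair_basis v w) = b v w by apply: etrans (malg_liftU _ _) _.
have [|h hE] := @lquot_lift _ Z (@tensor_rel C V W) f.
  have fL a u v w : f (u - (a *: v + w)) = f u - (a *: f v + f w).
    by rewrite raddfB; congr (_ - _); exact: linearP.
  by move=> x [a v v' w|a v w w']; rewrite fL !fE ?bL ?bR subrr.
by exists h => v w; rewrite hE.
Qed.

Lemma tensor_ind (P : set (tensor V W)) :
  is_submod P -> (forall v w, P (tens v w)) -> forall t, P t.
Proof.
move=> [P0 PD] Pt t; rewrite -[t]lpi_repr.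
pose Q := [set u | P (lpi (@tensor_rel C V W) u)].
suff: Q (repr t) by [].
apply: malg_ind => [|[v w]]; last exact: Pt.
split=> [|a u v Pu Pv]; rewrite /Q /=; last by rewrite lpi_is_linear; exact: PD.
suff -> : lpi (@tensor_rel C V W) 0 = 0 by [].
by rewrite -(scale0r 0) lpi_scale scale0r.
Qed.

(** A tensor over a factor spanned by a finite family needs only one coefficient
    per member of the family; this is how injectivity of the multiplication maps
    is reduced to linear independence. *)
Lemma tensor_expand_l (I : finType) (h : I -> V) :
  (forall v, exists a, v = \sum_i a i *: h i) ->
  forall t : tensor V W, exists w, t = \sum_i tens (h i) (w i).
Proof.
move=> hspan; apply: tensor_ind; first split.
- by exists (fun=> 0); rewrite big1 // => i _; rewrite tens0r.
- move=> a _ _ [w ->] [w' ->]; exists (fun i => a *: w i + w' i).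
  by rewrite scaler_sumr -big_split; apply: eq_bigr => i _; rewrite tensPr.
move=> v w; have [a ->] := hspan v; exists (fun i => a i *: w).
transitivity (\sum_i tens (a i *: h i) w).
  elim/big_ind2: _ => [|_ v1 _ v2 <- <-|//]; [exact: tens0l|exact: tensDl].
by apply: eq_bigr => i _; rewrite tensZl tensZr.
Qed.

Lemma tensor_expand_r (I : finType) (h : I -> W) :
  (forall w, exists a, w = \sum_i a i *: h i) ->
  forall t : tensor V W, exists v, t = \sum_i tens (v i) (h i).
Proof.
move=> hspan; apply: tensor_ind; first split.
- by exists (fun=> 0); rewrite big1 // => i _; rewrite tens0l.
- move=> a _ _ [w ->] [w' ->]; exists (fun i => a *: w i + w' i).
  by rewrite scaler_sumr -big_split; apply: eq_bigr => i _; rewrite tensPl.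
move=> v w; have [a ->] := hspan w; exists (fun i => a i *: v).
transitivity (\sum_i tens v (a i *: h i)).
  elim/big_ind2: _ => [|_ v1 _ v2 <- <-|//]; [exact: tens0r|exact: tensDr].
by apply: eq_bigr => i _; rewrite tensZl tensZr.
Qed.

End Tensor.

Section MultiplicationIso.
Context {C : fieldType} {A : algType C}.

(** Multiplication as an isomorphism, the left factor being mapped to the algebra
    by [j]; allowing for [j] makes iterated tensor products an instance. *)
Definition mult_iso (V : lmodType C) (D W : subalgebra A) (j : V -> A) : Prop :=
  exists2 mu : {linear tensor V D -> W}, bijective mu &
    forall v (d : D), incl (mu (tens v d)) = j v * incl d.

Lemma mult_map (V : lmodType C) (D W : subalgebra A) (j : {linear V -> A}) :
  (forall v (d : D), subalg_set W (j v * incl d)) ->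
  {mu : {linear tensor V D -> W} |
    forall v (d : D), incl (mu (tens v d)) = j v * incl d}.
Proof.
move=> jW; pose b v d := mkincl (jW v d).
have [|w a v v'|mu muE] := @tensor_lift C V D W b.
- move=> v a d d'; apply: incl_inj; rewrite mkinclK !linearP /= !mkinclK.
  by rewrite mulrDr -scalerAr.
- apply: incl_inj; rewrite mkinclK !linearP /= !mkinclK.
  by rewrite mulrDl -scalerAl.
by exists mu => v d; rewrite muE mkinclK.
Qed.

Lemma mult_iso_of (V : lmodType C) (D W : subalgebra A) (j : {linear V -> A}) :
  (forall v (d : D), subalg_set W (j v * incl d)) ->
  (forall x, subalg_set W x -> lspan [set j v * incl d | v in setT & d in @setT D] x) ->
  (forall mu : {linear tensor V D -> W},
    (forall v (d : D), incl (mu (tens v d)) = j v * incl d) ->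
    forall t, mu t = 0 -> t = 0) ->
  @mult_iso V D W j.
Proof.
move=> jW Wj inj; have [mu muE] := mult_map jW; exists mu => //.
apply: bij_of_inj_surj => [x y xy|y].
  by apply/eqP; rewrite -subr_eq0; apply/eqP/(inj _ muE); rewrite linearB /= xy subrr.
suff [t tE] : exists t, incl (mu t) = incl y by exists t; exact: incl_inj.
move: (Wj _ (incl_mem y)); move: (incl y).
apply: lspan_sub => [|_ [v _ [d _ <-]]]; last by exists (tens v d).
split=> [|a _ _ [t <-] [t' <-]]; first by exists 0; rewrite !raddf0.
by exists (a *: t + t'); rewrite !linearP.
Qed.

End MultiplicationIso.

(** * Anticommuting families and fermion operators *)

Section Anticommuting.
Context {C : fieldType} {A : algType C} {I : finType} (y : I -> A).
Hypothesis C2 : 2%:R != 0 :> C.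
Hypothesis yC : forall i j, y i * y j + y j * y i = 0.

(** The order of the factors is that of [r]; the reversed order is needed as well,
    for pairing creation against annihilation operators. *)
Definition ordmon (r : seq I) (S : {set I}) : A := \prod_(i <- r | i \in S) y i.

Lemma anticomm_sqr i : y i * y i = 0.
Proof.
have /eqP := yC i i; rewrite -mulr2n -scaler_nat scaler_eq0 (negPf C2) /=.
by move/eqP.
Qed.

Lemma anticomm_swap i j : y i * y j = - (y j * y i).
Proof. by apply/eqP; rewrite -addr_eq0 yC. Qed.

Lemma ordmon0 r : ordmon r finset.set0 = 1.
Proof. by rewrite /ordmon big1 // => i; rewrite inE. Qed.

Lemma ordmon_mul0 (r : seq I) (S : {set I}) j :
  j \in r -> j \in S -> y j * ordmon r S = 0.
Proof.
move=> + jS; rewrite /ordmon; elim: r => // h r IHr; rewrite inE big_cons.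
case: (eqVneq j h) => [<- _|_ /= jr]; first by rewrite jS mulrA anticomm_sqr mul0r.
case: ifP => _; last exact: IHr.
by rewrite mulrA anticomm_swap mulNr -mulrA IHr // mulr0 oppr0.
Qed.

(** Moving a generator to its place only changes signs, and a repeated generator
    gives zero. *)
Lemma ordmon_mul (r : seq I) (S : {set I}) j : uniq r -> j \in r ->
  exists c, y j * ordmon r S = c *: ordmon r (j |: S).
Proof.
case: (boolP (j \in S)) => jS ur jr.
  by exists 0; rewrite ordmon_mul0 // scale0r.
elim: r ur jr => // h r IHr /= /andP[hr ur]; rewrite inE /ordmon !big_cons.
case: (eqVneq j h) => [jh _|jh /= jr].
  subst h; exists 1; rewrite (negPf jS) setU11 scale1r; congr (_ * _).
  rewrite [RHS]big_seq_cond [LHS]big_seq_cond; apply: eq_bigl => i; rewrite !inE.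
  case ir: (i \in r) => //=.
  by rewrite (_ : (i == j) = false) //; apply/eqP => ij; move: hr; rewrite -ij ir.
have [c cE] := IHr ur jr.
rewrite !inE eq_sym (negPf jh) /=; case: ifP => hS; last by exists c.
exists (- c); rewrite mulrA anticomm_swap mulNr -mulrA cE.
by rewrite -scalerAr scaleNr.
Qed.

Lemma ordmon_span (r : seq I) : uniq r -> (forall i, i \in r) ->
  forall x, subalg_set (subalg_gen (range y)) x ->
  lspan (range (ordmon r)) x.
Proof.
move=> ur rI x Wx; pose L := lspan (range (ordmon r)).
have HL : is_submod L by exact: lspan_submod.
suff stab : [set z | forall w, L w -> L (z * w)] x.
  rewrite -[x]mulr1; apply: stab; apply: sub_lspan.
  by exists finset.set0 => //; exact: ordmon0.
move: x Wx; apply: subalg_gen_sub; first exact: left_stabilizer_subalg.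
move=> _ [j _ <-] /=; apply: lspan_sub; first exact: submod_mull.
move=> _ [S _ <-] /=; have [c ->] := ordmon_mul S ur (rI j).
by apply: (submodZ c HL); apply: sub_lspan; exists (j |: S).
Qed.

End Anticommuting.

Lemma anticomm_prod (C : fieldType) (A : algType C) (I : Type) (r : seq I)
    (P : pred I) (y : I -> A) (z : A) :
  (forall i, P i -> y i * z = - (z * y i)) ->
  exists n, (\prod_(i <- r | P i) y i) * z
            = (-1) ^+ n *: (z * \prod_(i <- r | P i) y i).
Proof.
move=> yz; elim: r => [|h r [n IHr]].
  by exists 0; rewrite big_nil mulr1 mul1r scale1r.
rewrite big_cons; case: ifP => Ph; last by exists n.
exists n.+1; rewrite -mulrA IHr -scalerAr [y h * (z * _)]mulrA yz // mulNr scalerN.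
by rewrite exprS mulN1r scaleNr mulrA.
Qed.

Section Clifford.
Context {C : fieldType} {B : algType C} {I : finType} (a b : I -> B) (v : B).
Hypothesis ab : forall i j, a i * b j + b j * a i = (i == j)%:R.
Hypothesis av : forall i, a i * v = 0.

Lemma car_swap i j : i != j -> a i * b j = - (b j * a i).
Proof. by move=> ij; apply/eqP; rewrite -addr_eq0 ab (negPf ij). Qed.

Lemma car_diag i : a i * b i = 1 - b i * a i.
Proof. by apply/eqP; rewrite -subr_eq opprK ab eqxx. Qed.

(** An annihilation operator passes, up to sign, through the creation operators
    of the other fermions and kills the vacuum. *)
Lemma annihilate (r : seq I) (S : {set I}) i : (i \notin r) || (i \notin S) ->
  a i * (ordmon b r S * v) = 0.
Proof.
rewrite /ordmon; elim: r => [|h r IHr]; first by rewrite big_nil mul1r av.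
rewrite inE big_cons negb_or => H.
case: ifP => hS; last by apply: IHr; case/orP: H => [/andP[_ ->]|->]; rewrite ?orbT.
rewrite !mulrA car_swap; last first.
  by case/orP: H => [/andP[]//|]; apply: contraNneq => ->.
rewrite !mulNr -!mulrA IHr ?mulr0 ?oppr0 //.
by case/orP: H => [/andP[_ ->]|->]; rewrite ?orbT.
Qed.

(** With the reversed order the innermost pair [a i * b i] meets first, and can be
    replaced by [1] since [a i] kills what is on its right. *)
Lemma pairing_diag (r : seq I) (S : {set I}) : uniq r ->
  ordmon a r S * (ordmon b (rev r) S * v) = v.
Proof.
elim/last_ind: r => [|r h IHr]; first by rewrite /ordmon !big_nil !mul1r.
rewrite rcons_uniq => /andP[hr ur].
rewrite rev_rcons /ordmon -cats1 big_cat /= !big_cons big_nil.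
case: ifP => hS; rewrite mulr1; last exact: IHr.
rewrite -!mulrA [a h * _]mulrA.
rewrite car_diag.
rewrite mulrBl mul1r -mulrA annihilate ?mem_rev ?hr // mulr0 subr0.
exact: IHr.
Qed.

(** An annihilation operator without partner reaches the vacuum. *)
Lemma pairing_off (r : seq I) (S T : {set I}) : uniq r ->
  has (fun i => (i \in S) && (i \notin T)) r ->
  ordmon a r S * (ordmon b (rev r) T * v) = 0.
Proof.
elim/last_ind: r => // r h IHr.
rewrite rcons_uniq has_rcons => /andP[hr ur] /orP H.
rewrite rev_rcons /ordmon -cats1 big_cat /= !big_cons big_nil.
case: (boolP (h \in S)) => hS; case: (boolP (h \in T)) => hT; rewrite mulr1.
- rewrite -!mulrA [a h * _]mulrA.
  rewrite car_diag.
  rewrite mulrBl mul1r -mulrA annihilate ?mem_rev ?hr // mulr0 subr0.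
  by apply: IHr => //; case: H => //; rewrite hT andbF.
- by rewrite -mulrA annihilate ?mulr0 ?mem_rev ?hr.
- rewrite -mulrA mulrA.
  have [n ->] : exists n, (\prod_(i <- r | i \in S) a i) * b h =
      (-1) ^+ n *: (b h * \prod_(i <- r | i \in S) a i).
    by apply: anticomm_prod => i iS; apply: car_swap; apply: contraTneq iS => ->.
  rewrite -scalerAl -mulrA IHr ?mulr0 ?scaler0 //.
  by case: H => //; rewrite (negPf hS).
- by apply: IHr => //; case: H => //; rewrite (negPf hS).
Qed.

End Clifford.

(** The product of all annihilation operators serves as the vacuum vector of the
    left regular representation; it is nonzero because supercommuting it with the
    creation operators one after the other gives [1]. *)
Lemma vacuum_neq0 (C : fieldType) (B : algType C) (I : finType) (a b : I -> B) r :
  (forall i j, a i * b j + b j * a i = (i == j)%:R) ->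
  uniq r -> \prod_(i <- r) a i != 0.
Proof.
move=> ab; elim: r => [|h r IHr] /=; first by rewrite big_nil oner_neq0.
move=> /andP[hr ur]; rewrite big_cons; apply: contra (IHr ur) => /eqP aP0.
have [n nE] : exists n, (\prod_(i <- r | i \in r) a i) * b h =
      (-1) ^+ n *: (b h * \prod_(i <- r | i \in r) a i).
  by apply: anticomm_prod => i ir; apply: (car_swap ab); apply: contraTneq ir => ->.
rewrite -big_seq in nE; set P := \prod_(i <- r) a i in nE aP0 *.
have bP : b h * P = (-1) ^+ n *: (P * b h) by rewrite nE scalerA -expr2 sqrr_sign scale1r.
(* Insert [1] as the supercommutator of [a h] and [b h]. *)
rewrite -[P]mul1r -[1](_ : a h * b h + b h * a h = 1); last by rewrite ab eqxx.
by rewrite mulrDl -!mulrA aP0 mulr0 addr0 bP -scalerAr mulrA aP0 mul0r scaler0.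
Qed.

(** The annihilation and creation operators of [k] fermions exist as matrices:
    a further fermion doubles the size, and the previous operators are extended
    with opposite signs on the two halves (Jordan and Wigner). *)
Lemma car_matrices (C : fieldType) (k : nat) :
  exists n (a b : nat -> 'M[C]_n.+1),
    [/\ forall i j, (i < k)%N -> (j < k)%N -> a i * b j + b j * a i = (i == j)%:R,
        forall i j, (i < k)%N -> (j < k)%N -> a i * a j + a j * a i = 0
      & forall i j, (i < k)%N -> (j < k)%N -> b i * b j + b j * b i = 0].
Proof.
elim: k => [|k [n [a [b [ab aa bb]]]]]; first by exists 0, (fun=> 0), (fun=> 0).
pose ext (x : nat -> 'M[C]_n.+1) (new : 'M[C]_(n.+1 + n.+1)) i : 'M[C]_(n.+1 + n.+1) :=
  if i == k then new else block_mx (x i) 0 0 (- x i).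
(* The three anticommutators are the same computation, with [e] the expected value. *)
have calc (x y : nat -> 'M[C]_n.+1) (p q : 'M[C]_(n.+1 + n.+1)) (e : nat -> nat -> bool) :
    (forall i j, (i < k)%N -> (j < k)%N -> x i * y j + y j * x i = (e i j)%:R) ->
    (forall z : 'M[C]_n.+1, p *m block_mx z 0 0 (- z) + block_mx z 0 0 (- z) *m p = 0) ->
    (forall z : 'M[C]_n.+1, q *m block_mx z 0 0 (- z) + block_mx z 0 0 (- z) *m q = 0) ->
    p *m q + q *m p = (e k k)%:R%:M ->
    (forall i, (i < k)%N -> e i k = false /\ e k i = false) ->
    forall i j, (i < k.+1)%N -> (j < k.+1)%N ->
    ext x p i *m ext y q j + ext y q j *m ext x p i = (e i j)%:R%:M.
  move=> xy pz qz pq ek i j; rewrite !ltnS /ext.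
  case: (eqVneq i k) => [->|ik] ik'; case: (eqVneq j k) => [->|jk] jk' //.
  - have jk2 : (j < k)%N by rewrite ltn_neqAle jk.
    by rewrite pz (ek _ jk2).2 /= raddf0.
  - have ik2 : (i < k)%N by rewrite ltn_neqAle ik.
    by rewrite addrC qz (ek _ ik2).1 /= raddf0.
  - have ik2 : (i < k)%N by rewrite ltn_neqAle ik.
    have jk2 : (j < k)%N by rewrite ltn_neqAle jk.
    rewrite !mulmx_block !mulmx0 !mul0mx !addr0 !add0r !mulmxN !mulNmx !opprK.
    rewrite add_block_mx !addr0 [x i *m y j + y j *m x i](xy _ _ ik2 jk2).
    by rewrite scalar_mx_block; case: (e i j); rewrite ?raddf0.
pose pa : 'M[C]_(n.+1 + n.+1) := block_mx 0 0 1%:M 0.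
pose pb : 'M[C]_(n.+1 + n.+1) := block_mx 0 1%:M 0 0.
have pza z : pa *m block_mx z 0 0 (- z) + block_mx z 0 0 (- z) *m pa = 0.
  rewrite !mulmx_block !mulmx0 !mul0mx !addr0 !add0r mul1mx mulmx1.
  by rewrite add_block_mx !addr0 subrr; exact: block_mx0.
have pzb z : pb *m block_mx z 0 0 (- z) + block_mx z 0 0 (- z) *m pb = 0.
  rewrite !mulmx_block !mulmx0 !mul0mx !addr0 !add0r mul1mx mulmx1.
  by rewrite add_block_mx !addr0 addNr; exact: block_mx0.
have one x : (x%:R%:M : 'M[C]_((n + n.+1).+1)) = x%:R by rewrite -scalemx1 scaler_nat.
have zero (x y : nat -> 'M[C]_n.+1) (p q : 'M[C]_(n.+1 + n.+1)) i j :
    ext x p i *m ext y q j + ext y q j *m ext x p i = 0%:R%:M ->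
    (ext x p i : 'M[C]_((n + n.+1).+1)) * ext y q j + (ext y q j : 'M[C]_((n + n.+1).+1)) * ext x p i = 0.
  by move->; rewrite one.
exists (n + n.+1)%N, (ext a pa), (ext b pb); split=> i j ik jk.
- rewrite -one; apply: (calc _ _ _ _ (fun i j => i == j)) => //.
    rewrite !mulmx_block !mulmx0 !mul0mx !addr0 !add0r mul1mx add_block_mx.
    by rewrite !addr0 !add0r eqxx scalar_mx_block.
  by move=> h hk; rewrite (gtn_eqF hk) (ltn_eqF hk).
- apply/zero/(calc _ _ _ _ (fun i j => false)) => //.
  rewrite !mulmx_block !mulmx0 !mul0mx !addr0 !block_mx0 addr0; exact/esym/raddf0.
- apply/zero/(calc _ _ _ _ (fun i j => false)) => //.
  rewrite !mulmx_block !mulmx0 !mul0mx !addr0 !block_mx0 addr0; exact/esym/raddf0.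
Qed.

(** * Independence in a Clifford algebra *)

Section CliffordIndependence.
Context {C : fieldType} {B : algType C} {I : finType}.
Variables (g f e h : I -> B) (v : B).
Hypothesis gf : forall i j, g i * f j + f j * g i = (i == j)%:R.
Hypothesis eh : forall i j, e i * h j + h j * e i = (i == j)%:R.
Hypothesis gv : forall i, g i * v = 0.
Hypothesis ev : forall i, e i * v = 0.
Hypothesis v0 : v != 0.
Let r := enum I.

Lemma not_subset_has (S T : {set I}) :
  ~~ (S \subset T) -> has (fun i => (i \in S) && (i \notin T)) r.
Proof.
case/subsetPn => i iS iT; apply/hasP; exists i; first exact: mem_enum.
by rewrite iS.
Qed.

(** Among the monomials with nonzero coefficient take a maximal one: the dual
    annihilation monomial keeps its coefficient and kills all the others. *)
Lemma fock_free (c : {set I} -> C) :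
  \sum_(S : {set I}) c S *: (ordmon f (rev r) S * v) = 0 -> forall S, c S = 0.
Proof.
move=> sum0 S; move: {-1}#|~: S| (leqnn #|~: S|) => n.
elim/ltn_ind: n S => n IHn S Sn.
have := congr1 (fun x => ordmon g r S * x) sum0; rewrite mulr0 mulr_sumr.
rewrite (bigD1 S) //= big1 ?addr0 => [|T TS].
  rewrite -scalerAr pairing_diag ?enum_uniq // => /eqP.
  by rewrite scaler_eq0 (negPf v0) orbF => /eqP.
rewrite -scalerAr; case: (boolP (S \subset T)) => ST; last first.
  by rewrite pairing_off ?scaler0 ?enum_uniq ?not_subset_has.
have lt : (#|~: T| < #|~: S|)%N.
  apply: proper_card; rewrite finset.properEneq finset.setCS ST andbT.
  by apply: contra TS => /eqP/finset.setC_inj->.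
by rewrite (IHn #|~: T|) ?scale0r //; exact: leq_trans lt Sn.
Qed.

(** The states created by the operators [h] dual to the [e] are killed by every
    monomial in the [e] that is not contained in the state.  If the coefficients
    of all smaller monomials are known to vanish, only the one of [J0] survives,
    and its coefficient acts on the vacuum. *)
Lemma clifford_indep (w : {set I} -> {set I} -> B) (chi : {set I} -> {set I} -> C) (J0 : {set I}) :
  (forall S J, w S J * v = chi S J *: v) ->
  (forall J : {set I}, (#|J| < #|J0|)%N -> forall S, w S J = 0) ->
  \sum_(S : {set I}) \sum_(J : {set I})
    ordmon f (rev r) S * w S J * ordmon e r J = 0 ->
  forall S, chi S J0 = 0.
Proof.
move=> wv wlt sum0; apply: fock_free.
have := congr1 (fun x => x * (ordmon h (rev r) J0 * v)) sum0.
rewrite mul0r mulr_suml => sum1; rewrite -[RHS]sum1; apply: eq_bigr => S _.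
rewrite mulr_suml (bigD1 J0) //= big1 => [|J JJ0].
  by rewrite addr0 -!mulrA pairing_diag ?enum_uniq // wv scalerAr.
have [/wlt->|leJ] := ltnP #|J| #|J0|; first by rewrite mulr0 !mul0r.
rewrite -mulrA pairing_off ?mulr0 ?enum_uniq // not_subset_has //.
apply: contra JJ0 => JJ0; by rewrite eqEcard JJ0.
Qed.

End CliffordIndependence.

Section ChangeOfBasis.
Context {C : fieldType} {B : algType C} {n : nat}.

(** Anticommutators that are scalars extend bilinearly. *)
Lemma lincomb_car (x y : 'I_n -> B) (E : 'I_n -> 'I_n -> C) (u w : 'I_n -> C) :
  (forall i j, x i * y j + y j * x i = (E i j)%:A) ->
  (\sum_i u i *: x i) * (\sum_j w j *: y j)
    + (\sum_j w j *: y j) * (\sum_i u i *: x i)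
  = (\sum_i \sum_j u i * w j * E i j)%:A.
Proof.
move=> xy; rewrite mulr_suml mulr_sumr -big_split scaler_suml.
apply: eq_bigr => i _; rewrite mulr_sumr mulr_suml -big_split scaler_suml.
apply: eq_bigr => j _ /=.
rewrite -!scalerAl -!scalerAr !scalerA [w j * _]mulrC -scalerDr xy.
by rewrite scalerA.
Qed.

Lemma dual_basis (a b : 'I_n -> B) (M : 'M[C]_n) :
  (forall i j, a i * b j + b j * a i = (i == j)%:R) -> M \in unitmx ->
  forall j m, (\sum_i M i j *: a i) * (\sum_i invmx M m i *: b i)
    + (\sum_i invmx M m i *: b i) * (\sum_i M i j *: a i) = (j == m)%:R.
Proof.
move=> ab Mu j m; rewrite (@lincomb_car a b (fun i j => (i == j)%:R)); last first.
  by move=> i i'; rewrite ab scaler_nat.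
have -> : \sum_i \sum_i0 M i j * invmx M m i0 * (i == i0)%:R = (invmx M *m M) m j.
  rewrite mxE; apply: eq_bigr => i _; rewrite (bigD1 i) //= eqxx mulr1 mulrC.
  by rewrite big1 ?addr0 // => i' /negPf i'i; rewrite eq_sym i'i mulr0.
by rewrite mulVmx // mxE eq_sym scaler_nat.
Qed.

Lemma lincomb_anticomm (x y : 'I_n -> B) (u w : 'I_n -> C) :
  (forall i j, x i * y j + y j * x i = 0) ->
  (\sum_i u i *: x i) * (\sum_j w j *: y j)
    + (\sum_j w j *: y j) * (\sum_i u i *: x i) = 0.
Proof.
move=> xy; rewrite (@lincomb_car x y (fun _ _ => 0)) => [|i j]; last by rewrite xy scale0r.
by rewrite big1 ?scale0r // => i _; rewrite big1 // => j _; rewrite mulr0.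
Qed.

End ChangeOfBasis.

(** * Normal ordering from the relations of the shifted Yangian *)

Section Convolution.
Context {R : pzRingType}.

(** The coefficients of the product of two power series over a ring that need not
    be commutative. *)
Definition conv (u v : nat -> R) (n : nat) : R := \sum_(a < n.+1) u a * v (n - a)%N.

Lemma eq_conv (u u' v v' : nat -> R) n :
  (forall a, (a <= n)%N -> u a = u' a) -> (forall a, (a <= n)%N -> v a = v' a) ->
  conv u v n = conv u' v' n.
Proof.
move=> uu vv; apply: eq_bigr => a _; rewrite uu ?vv ?leq_subr //.
by rewrite -ltnS ltn_ord.
Qed.

Lemma conv_delta_l (v : nat -> R) n : conv (fun a => (a == 0%N)%:R) v n = v n.
Proof.
by rewrite /conv big_ord_recl /= mul1r subn0 big1 ?addr0 // => a _; rewrite mul0r.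
Qed.

End Convolution.

(** Reduced to the product of polynomials by truncation. *)
Lemma conv_assoc (R : nzRingType) (u v w : nat -> R) n :
  conv u (conv v w) n = conv (conv u v) w n.
Proof.
pose P (x : nat -> R) : {poly R} := \poly_(i < n.+1) x i.
have PE x i : (i <= n)%N -> (P x)`_i = x i by move=> le; rewrite coef_poly ltnS le.
have PM x y i : (i <= n)%N -> (P x * P y)`_i = conv x y i.
  move=> le; rewrite coefM; apply: eq_bigr => a _; rewrite !PE //.
    by apply: leq_trans (leq_subr _ _) le.
  by apply: leq_trans le; rewrite -ltnS ltn_ord.
transitivity ((P u * (P v * P w))`_n).
  rewrite coefM; apply: eq_bigr => a _; rewrite PE ?PM ?leq_subr //.
  by rewrite -ltnS ltn_ord.
rewrite mulrA coefM; apply: eq_bigr => a _; rewrite [(P w)`_ _]PE ?PM ?leq_subr //.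
by rewrite -ltnS ltn_ord.
Qed.

(** The inverse series is built as the sequence of its initial segments. *)
Lemma conv_inverse (R : nzRingType) (D : nat -> R) : D 0%N = 1 ->
  exists dt, forall r, conv dt D r = (r == 0%N)%:R.
Proof.
move=> D0; pose next (u : seq R) :=
  (size u == 0%N)%:R - \sum_(a < size u) u`_a * D (size u - a)%N.
pose dts := fix dts n := if n is m.+1 then rcons (dts m) (next (dts m)) else [::].
have sz n : size (dts n) = n by elim: n => //= n IHn; rewrite size_rcons IHn.
have nthE n a : (a < n)%N -> (dts n)`_a = (dts a.+1)`_a.
  elim: n => // n IHn; rewrite ltnS leq_eqVlt => /orP[/eqP->//|an].
  by rewrite /= nth_rcons sz an IHn.
exists (fun r => (dts r.+1)`_r) => r; rewrite /conv big_ord_recr /= subnn D0 mulr1.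
rewrite nth_rcons sz ltnn eqxx /next sz addrC.
rewrite (eq_bigr (fun a : 'I_r => (dts a.+1)`_a * D (r - a)%N)) ?subrK // => a _.
by rewrite nthE.
Qed.

Section YangianFamily.
Context {C : fieldType} {A : algType C}.
Variables (eps : C) (E F D : nat -> A).

Definition bracket_raise := forall r j,
  D r * E j - E j * D r = eps *: \sum_(a < r) D a * E (j + (r - 1 - a))%N.
Definition bracket_lower := forall r j,
  D r * F j - F j * D r = - (eps *: \sum_(a < r) F (j + (r - 1 - a))%N * D a).

End YangianFamily.

(** The relations of the shifted Yangian of level [k], in terms of the sequences
    [E j] and [F j] of the generators [e] and [f] numbered from their first
    admissible index; the sum [l0] of the two shifts then occurs only in the
    supercommutator of [E] and [F].  The sequence [dt] is the inverse of the
    series [D0]. *)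
Record yangian_family (C : fieldType) (A : algType C) (k l0 : nat) (eps : C)
    (dt D0 D1 E F : nat -> A) : Prop := YangianFamily {
  yf_D00 : D0 0%N = 1;
  yf_D10 : D1 0%N = 1;
  yf_level : forall r, (k < r)%N -> D0 r = 0;
  yf_D0C : forall r t, D0 r * D0 t = D0 t * D0 r;
  yf_D01C : forall r t, D0 r * D1 t = D1 t * D0 r;
  yf_D1C : forall r t, D1 r * D1 t = D1 t * D1 r;
  yf_EE : forall i j, E i * E j + E j * E i = 0;
  yf_FF : forall i j, F i * F j + F j * F i = 0;
  yf_D0E : bracket_raise eps E D0;
  yf_D1E : bracket_raise eps E D1;
  yf_D0F : bracket_lower eps F D0;
  yf_D1F : bracket_lower eps F D1;
  yf_EF : forall i j, E i * F j + F j * E i = eps *: conv dt D1 (l0 + i + j).+1;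
  yf_dt : forall r, conv dt D0 r = (r == 0%N)%:R }.

Section Spanning.
Context {C : fieldType} {A : algType C}.
Variables (k l0 : nat) (eps : C) (dt D0 D1 E F : nat -> A).
Hypothesis eps0 : eps != 0.
Hypothesis Y : yangian_family k l0 eps dt D0 D1 E F.
Let D00 := yf_D00 Y.
Let D10 := yf_D10 Y.
Let D0k := yf_level Y.
Let D0C := yf_D0C Y.
Let D0E := yf_D0E Y.
Let D1E := yf_D1E Y.
Let D0F := yf_D0F Y.
Let D1F := yf_D1F Y.
Let EF := yf_EF Y.
Let dtP := yf_dt Y.

Let l := (l0 + k)%N.
Definition dgens : set A :=
  [set x | (exists2 r, (0 < r <= k)%N & x = D0 r)
           \/ (exists2 r, (0 < r <= l)%N & x = D1 r)].
Definition egens : set A := range (fun i : 'I_k => E i).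
Definition fgens : set A := range (fun i : 'I_k => F i).
Local Notation gen S := (subalg_set (subalg_gen S)).
Local Notation Z := (gen dgens).
Local Notation P := (gen egens).
Local Notation N := (gen fgens).
Local Notation SH := (gen (dgens `|` egens)).
Local Notation FL := (gen (fgens `|` dgens)).

Let genA (S : set A) : is_subalg (gen S).
Proof. exact: subalg_setP. Qed.
Let genM (S : set A) : is_submod (gen S).
Proof. exact: subalg_submod. Qed.
Hint Resolve genA genM : core.

Lemma gen_mono (S S' : set A) : S `<=` S' -> gen S `<=` gen S'.
Proof.
move=> SS'; apply: subalg_gen_sub => // x Sx.
by apply: sub_subalg_gen; exact: SS'.
Qed.

Lemma Z_D0 r : Z (D0 r).
Proof.
case: r => [|r]; first by rewrite D00; exact: subalg1.
have [rk|kr] := leqP r.+1 k; last by rewrite D0k //; case: (genM dgens).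
by apply: sub_subalg_gen; left; exists r.+1.
Qed.

Lemma Z_D1 r : (r <= l)%N -> Z (D1 r).
Proof.
case: r => [|r] rl; first by rewrite D10; exact: subalg1.
by apply: sub_subalg_gen; right; exists r.+1.
Qed.

(** The recursion for the inverse series involves [D0] only. *)
Lemma dtilde_mem (S : set A) : is_subalg S -> (forall r, S (D0 r)) -> forall a, S (dt a).
Proof.
move=> HS SD; elim/ltn_ind => r IHr.
have HM := subalg_submod HS.
have := dtP r; rewrite /conv big_ord_recr /= subnn D00 mulr1 => /(canRL (addKr _)) ->.
apply: (submodD HM); first apply: (submodN HM).
  by apply: (submod_sum _ HM) => a _; apply: (subalgM HS) => //; exact: IHr.
by case: (r == 0%N); [exact: subalg1 | case: HM].
Qed.

Lemma dtilde_inv r : conv D0 dt r = (r == 0%N)%:R.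
Proof.
rewrite -dtP /conv (reindex_inj rev_ord_inj) /=; apply: eq_bigr => a _.
rewrite subSS subKn; last by rewrite -ltnS ltn_ord.
apply: (dtilde_mem (commutant_subalg (D0 (r - a)))) => t; exact: D0C.
Qed.

Lemma recursion_E i : \sum_(a < k.+1) D0 a * E (i + (k - a))%N = 0.
Proof.
have /esym/eqP := D0E k.+1 i; rewrite D0k // mul0r mulr0 subrr.
rewrite scaler_eq0 (negPf eps0) /= => /eqP sum0.
by rewrite -[RHS]sum0; apply: eq_bigr => a _; rewrite subSS subn0.
Qed.

Lemma recursion_F i : \sum_(a < k.+1) F (i + (k - a))%N * D0 a = 0.
Proof.
have /esym/eqP := D0F k.+1 i; rewrite D0k // mul0r mulr0 subrr.
rewrite oppr_eq0 scaler_eq0 (negPf eps0) /= => /eqP sum0.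
by rewrite -[RHS]sum0; apply: eq_bigr => a _; rewrite subSS subn0.
Qed.

(** The recursion expresses [E j] through the [k] preceding ones. *)
Lemma E_window j : mulspan Z egens (E j).
Proof.
have HM := mulspan_submod Z egens.
elim/ltn_ind: j => j IHj; have [jk|kj] := ltnP j k.
  rewrite -[E j]mul1r; apply: mem_mulspan; first exact: subalg1.
  by exists (Ordinal jk).
have := recursion_E (j - k); rewrite big_ord_recl D00 mul1r subn0 subnK //.
move/(canRL (addrK _)); rewrite sub0r => ->; apply: (submodN HM).
apply: (submod_sum _ HM) => a _; apply: (mulspan_mull HM _ (IHj _ _)).
  move=> y z Zy Sz; apply: mem_mulspan => //; apply: (subalgM (genA _)) => //; exact: Z_D0.
rewrite /= /bump /= add1n; have := ltn_ord a; lia.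
Qed.

Lemma F_window j : mulspan fgens Z (F j).
Proof.
have HM := mulspan_submod fgens Z.
elim/ltn_ind: j => j IHj; have [jk|kj] := ltnP j k.
  rewrite -[F j]mulr1; apply: mem_mulspan; last exact: subalg1.
  by exists (Ordinal jk).
have := recursion_F (j - k); rewrite big_ord_recl D00 mulr1 subn0 subnK //.
move/(canRL (addrK _)); rewrite sub0r => ->; apply: (submodN HM).
apply: (submod_sum _ HM) => a _; apply: (mulspan_mulr HM _ (IHj _ _)).
  move=> y z Sy Zz; apply: mem_mulspan => //; apply: (subalgM (genA _)) => //; exact: Z_D0.
rewrite /= /bump /= add1n; have := ltn_ord a; lia.
Qed.

Lemma dgens_ind (Q : set A) :
  (forall D r, bracket_raise eps E D -> bracket_lower eps F D ->
     (forall a, (a <= r)%N -> Z (D a)) -> Q (D r)) ->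
  dgens `<=` Q.
Proof.
move=> HQ _ [[r /andP[_ rk] ->]|[r /andP[_ rl] ->]]; apply: HQ => // a ar.
  exact: Z_D0.
by apply: Z_D1; exact: leq_trans rl.
Qed.

(** The bracket of [D] with [E i] produces [E] of arbitrary index, which
    the recursion brings back to the window. *)
Lemma window_E_Z x z : mulspan Z egens x -> Z z -> mulspan Z egens (x * z).
Proof.
have HM := mulspan_submod Z egens.
move=> + Zz; move: z Zz x; apply: subalg_gen_sub; first exact: right_stabilizer_subalg.
have mulZ y w : Z y -> mulspan Z egens w -> mulspan Z egens (y * w).
  move=> Zy; apply: (mulspan_mull HM) => z e Zz ez; apply: mem_mulspan => //.
  exact: (subalgM (genA _)).
apply: dgens_ind => D r DE _ ZD /=.
apply: (mulspan_mulr HM) => y _ Zy [i _ <-]; apply: (mulZ) => //.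
have -> : E i * D r = D r * E i - eps *: \sum_(a < r) D a * E (i + (r - 1 - a))%N.
  by rewrite -DE opprB addrC subrK.
apply: (submodB HM); first by apply: mem_mulspan; [exact: ZD | exists i].
apply: (submodZ _ HM); apply: (submod_sum _ HM) => a _.
by apply: (mulZ); [apply: (ZD); exact: ltnW | exact: E_window].
Qed.

Lemma window_Z_F x z : mulspan fgens Z x -> Z z -> mulspan fgens Z (z * x).
Proof.
have HM := mulspan_submod fgens Z.
move=> + Zz; move: z Zz x; apply: subalg_gen_sub; first exact: left_stabilizer_subalg.
have mulZ y w : Z y -> mulspan fgens Z w -> mulspan fgens Z (w * y).
  move=> Zy; apply: (mulspan_mulr HM) => f z Ff Zz; apply: mem_mulspan => //.
  exact: (subalgM (genA _)).
apply: dgens_ind => D r _ DF ZD /=.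
apply: (mulspan_mull HM) => _ y [i _ <-] Zy; apply: (mulZ) => //.
have -> : D r * F i = F i * D r - eps *: \sum_(a < r) F (i + (r - 1 - a))%N * D a.
  by rewrite -DF addrC subrK.
apply: (submodB HM); first by apply: mem_mulspan; [exists i | exact: ZD].
apply: (submodZ _ HM); apply: (submod_sum _ HM) => a _.
by apply: (mulZ); [apply: (ZD); exact: ltnW | exact: F_window].
Qed.

Lemma sharp_span x : SH x -> mulspan Z P x.
Proof.
have HM := mulspan_submod Z P.
move=> SHx; suff : [set y | forall w, mulspan Z P w -> mulspan Z P (y * w)] x.
  move=> H; rewrite -[x]mulr1; apply: H; rewrite -[1]mulr1.
  by apply: mem_mulspan; exact: subalg1.
move: x SHx; apply: subalg_gen_sub; first exact: left_stabilizer_subalg.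
move=> x [dx|[i _ <-]]; apply: (mulspan_mull HM) => z p Zz Pp.
  by apply: mem_mulspan => //; apply: (subalgM (genA _)) => //; exact: sub_subalg_gen.
apply: (mulspan_mulr HM _ (window_E_Z _ Zz)); last first.
  by rewrite -[E i]mul1r; apply: mem_mulspan; [exact: subalg1 | exists i].
move=> y e Zy ee; apply: mem_mulspan => //; apply: (subalgM (genA _)) => //.
exact: sub_subalg_gen.
Qed.

Lemma flat_span x : FL x -> mulspan N Z x.
Proof.
have HM := mulspan_submod N Z.
move=> FLx; suff : [set y | forall w, mulspan N Z w -> mulspan N Z (w * y)] x.
  move=> H; rewrite -[x]mul1r; apply: H; rewrite -[1]mulr1.
  by apply: mem_mulspan; exact: subalg1.
move: x FLx; apply: subalg_gen_sub; first exact: right_stabilizer_subalg.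
move=> x [[i _ <-]|dx]; apply: (mulspan_mulr HM) => n z Nn Zz; last first.
  by apply: mem_mulspan => //; apply: (subalgM (genA _)) => //; exact: sub_subalg_gen.
apply: (mulspan_mull HM _ (window_Z_F _ Zz)); last first.
  by rewrite -[F i]mulr1; apply: mem_mulspan; [exists i | exact: subalg1].
move=> f y ff Zy; apply: mem_mulspan => //; apply: (subalgM (genA _)) => //.
exact: sub_subalg_gen.
Qed.

Lemma E_sharp j : SH (E j).
Proof.
apply: (mulspan_sub (P := SH) _ _ (E_window j)) => // z e Zz ee; apply: (subalgM (genA _)) => //.
  by apply: (gen_mono _ Zz) => ?; left.
by apply: sub_subalg_gen; right.
Qed.

Lemma F_flat j : FL (F j).
Proof.
apply: (mulspan_sub (P := FL) _ _ (F_window j)) => // f z ff Zz; apply: (subalgM (genA _)) => //.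
  by apply: sub_subalg_gen; left.
by apply: (gen_mono _ Zz) => ?; right.
Qed.

(** Both terms of the supercommutator of [recursion_E] with [F] are computed with
    the relations: the supercommutators of [E] and [F] add up to the convolution
    of [D0] with [dt] and [D1], that is to [D1] alone, and the brackets of [D0]
    with [F] give the right-hand side. *)
Lemma D1_high n : (l < n)%N ->
  D1 n = - \sum_(a < k.+1) \sum_(b < a)
            F ((n - l.+1) + (a - 1 - b))%N * D0 b * E (k - a)%N.
Proof.
move=> ln; pose j := (n - l.+1)%N.
have nE : n = (l0 + k + j).+1 by rewrite /j /l in ln *; lia.
have X0 := recursion_E 0.
have : \sum_(a < k.+1) (D0 a * E (0 + (k - a))%N * F j + F j * (D0 a * E (0 + (k - a))%N)) = 0.
  by rewrite big_split /= -mulr_suml -mulr_sumr X0 mul0r mulr0 addr0.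
have split a : (a <= k)%N ->
    D0 a * E (0 + (k - a))%N * F j + F j * (D0 a * E (0 + (k - a))%N)
    = eps *: (D0 a * conv dt D1 (n - a)
        + \sum_(b < a) F (j + (a - 1 - b))%N * D0 b * E (k - a)%N).
  move=> ak; rewrite add0n.
  have -> : (n - a)%N = (l0 + (k - a) + j).+1 by lia.
  rewrite scalerDr scalerAr -EF mulrDr -mulrA -addrA; congr (_ + _).
  rewrite -mulr_suml scalerAl; set S := eps *: _.
  have -> : S = F j * D0 a - D0 a * F j by rewrite -[S]opprK -D0F opprB.
  by rewrite mulrBl !mulrA addrC subrK.
rewrite (eq_bigr (fun a : 'I_k.+1 => eps *: (D0 a * conv dt D1 (n - a)
        + \sum_(b < a) F (j + (a - 1 - b))%N * D0 b * E (k - a)%N))); last first.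
  by move=> a _; apply: split; rewrite -ltnS ltn_ord.
rewrite -scaler_sumr => /eqP; rewrite scaler_eq0 (negPf eps0) big_split /= addr_eq0.
move=> /eqP <-.
transitivity (conv D0 (conv dt D1) n).
  rewrite conv_assoc (eq_conv (u' := fun a => (a == 0%N)%:R) (v' := D1)) //.
    by rewrite conv_delta_l.
  by move=> a _; exact: dtilde_inv.
rewrite /conv -(big_mkord xpredT (fun a => D0 a * conv dt D1 (n - a))).
rewrite -(big_mkord xpredT (fun a => D0 a * conv dt D1 (n - a))).
rewrite (big_cat_nat (n := k.+1)) //=; last by rewrite nE; lia.
rewrite [X in _ + X](_ : _ = 0) ?addr0 // big_nat big1 // => a /andP[ka _].
by rewrite D0k ?mul0r.
Qed.

Local Notation T := (mulspan N SH).

(** The left factors [F] and [D] are absorbed by the flat part. *)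
Lemma flat_triang y t : FL y -> T t -> T (y * t).
Proof.
have HM := mulspan_submod N SH.
have FLT w x : FL w -> SH x -> T (w * x).
  move=> /flat_span FLw SHx; move: w FLw; apply: (mulspan_mulr HM) => n z Nn Zz.
  apply: mem_mulspan => //; apply: (subalgM (genA _)) => //.
  by apply: (gen_mono _ Zz) => ?; left.
move=> FLy; apply: (mulspan_mull HM) => n x Nn SHx; apply: FLT => //.
by apply: (subalgM (genA _)) => //; apply: (gen_mono _ Nn) => ?; left.
Qed.

(** Induction on the factors [F]: moving [E i] to the right of one of them leaves a
    coefficient [D1 n] applied to a shorter product, where for large [n] the formula
    [D1_high] applies, and the [E] that it creates acts on a shorter product too. *)
Lemma window_triang (i : 'I_k) t : T t -> T (E i * t).
Proof.
have HM := mulspan_submod N SH.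
(* [Q] carries the induction on the number of factors [F] in [n]. *)
pose Q := [set n | N n /\ forall (i : 'I_k) x, SH x -> T (E i * n * x)].
have ZT z u : Z z -> T u -> T (z * u).
  by move=> Zz; apply: flat_triang; apply: (gen_mono _ Zz) => ?; right.
have Q1 : Q 1.
  split=> [|i' x SHx]; first exact: subalg1.
  rewrite mulr1 -[_ * x]mul1r; apply: mem_mulspan; first exact: subalg1.
  by apply: (subalgM (genA _)) => //; exact: E_sharp.
have QM : is_submod Q.
  split=> [|a u w [Nu Qu] [Nw Qw]]; split.
  - by case: (genM fgens).
  - by move=> i' x _; rewrite mulr0 mul0r; case: HM.
  - by case: (genM fgens) => _; exact.
  - move=> i' x SHx; rewrite mulrDr mulrDl -scalerAr -scalerAl.
    by case: HM => _; apply; [exact: Qu | exact: Qw].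
have QF (j : 'I_k) n : Q n -> Q (F j * n).
  move=> [Nn Qn]; split.
    by apply: (subalgM (genA _)) => //; apply: sub_subalg_gen; exists j.
  move=> i' x SHx; have Tnx : T (n * x) by exact: mem_mulspan.
  have ET c : T (E c * (n * x)).
    move: (E c) (E_window c); apply: (mulspan_mulr HM) => z _ Zz [i2 _ <-].
    by apply: (ZT) => //; rewrite mulrA; exact: Qn.
  have D1T b : T (D1 b * (n * x)).
    have [bl|lb] := leqP b l; first by apply: (ZT) => //; exact: Z_D1.
    rewrite D1_high // mulNr; apply: (submodN HM).
    rewrite mulr_suml; apply: (submod_sum _ HM) => a _.
    rewrite mulr_suml; apply: (submod_sum _ HM) => b' _; rewrite -!mulrA.
    apply: flat_triang; first exact: F_flat.
    apply: (ZT); [exact: Z_D0 | exact: ET].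
  have -> : E i' * (F j * n) * x =
      eps *: \sum_(a < (l0 + i' + j).+2) dt a * (D1 ((l0 + i' + j).+1 - a)%N * (n * x))
      - F j * (E i' * (n * x)).
    rewrite (eq_bigr (fun a : 'I__ => dt a * D1 ((l0 + i' + j).+1 - a)%N * (n * x))); last first.
      by move=> a _; rewrite mulrA.
    by rewrite -mulr_suml scalerAl -EF mulrDl !mulrA addrK.
  apply: (submodB HM); last first.
    by apply: flat_triang; [exact: F_flat | exact: ET].
  apply: (submodZ _ HM); apply: (submod_sum _ HM) => a _; apply: (ZT) => //.
  by apply: dtilde_mem => // r; exact: Z_D0.
have NQ : N `<=` Q.
  move=> n Nn; suff stab : [set y | forall w, Q w -> Q (y * w)] n.
    by rewrite -[n]mulr1; exact: stab.
  move: n Nn; apply: subalg_gen_sub; first exact: left_stabilizer_subalg.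
  by move=> _ [j _ <-] n Qn /=; exact: QF.
apply: (mulspan_mull HM) => n x Nn SHx; exact: (NQ _ Nn).2.
Qed.

Lemma T_stabilizer : is_subalg [set y | forall t, T t -> T (y * t)].
Proof. exact/left_stabilizer_subalg/mulspan_submod. Qed.

Lemma E_triang j t : T t -> T (E j * t).
Proof.
have HS := subalg_submod T_stabilizer.
move: t; apply: (mulspan_sub HS _ (E_window j)) => z _ Zz [i _ <-] t Tt /=.
rewrite -mulrA; apply: flat_triang; first by apply: (gen_mono _ Zz) => ?; right.
exact: window_triang.
Qed.

Lemma D1_triang n t : T t -> T (D1 n * t).
Proof.
move=> Tt; have HM := mulspan_submod N SH.
have ZT z u : Z z -> T u -> T (z * u).
  by move=> Zz; apply: flat_triang; apply: (gen_mono _ Zz) => ?; right.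
have [nl|ln] := leqP n l; first by apply: (ZT) => //; exact: Z_D1.
rewrite D1_high // mulNr; apply: (submodN HM).
rewrite mulr_suml; apply: (submod_sum _ HM) => a _.
rewrite mulr_suml; apply: (submod_sum _ HM) => b _; rewrite -!mulrA.
apply: flat_triang; first exact: F_flat.
by apply: (ZT); [exact: Z_D0 | exact: E_triang].
Qed.

(** Normal ordering: whatever is generated by all the [D0], [D1], [E] and [F] is
    spanned by products in triangular order of the generators in the windows. *)
Lemma triangular_span (S : set A) :
  (forall y, S y -> [\/ exists r, y = D0 r, exists r, y = D1 r, exists j, y = E j
                      | exists j, y = F j]) ->
  forall y, gen S y -> mulspan N SH y.
Proof.
move=> HS y Sy; suff stab : [set y | forall t, T t -> T (y * t)] y.
  rewrite -[y]mulr1; apply: stab; rewrite -[1]mulr1.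
  by apply: mem_mulspan; exact: subalg1.
move: y Sy; apply: subalg_gen_sub; first exact: T_stabilizer.
move=> y /HS[] [r ->] t Tt.
- apply: flat_triang => //; apply: (gen_mono _ (Z_D0 r)) => ?; by right.
- exact: D1_triang.
- exact: E_triang.
- by apply: flat_triang => //; exact: F_flat.
Qed.

End Spanning.

(** * The fermion model of the relations *)

(** The brackets with [D r] in the relations are the solutions of a recursion of
    first order in [r], which is what the model verifies. *)
Lemma first_order_recursion (C : comNzRingType) (V : lmodType C) (x : C) (w g : nat -> V) :
  w 0%N = 0 -> (forall m, w m.+1 = x *: w m + g m) ->
  forall r, w r = \sum_(t < r) x ^+ (r - 1 - t) *: g t.
Proof.
move=> w0 wS; elim=> [|r IHr]; first by rewrite big_ord0.
rewrite wS IHr big_ord_recr /= subSS subn0 subnn expr0 scale1r scaler_sumr.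
congr (_ + _); apply: eq_bigr => t _; rewrite scalerA -exprS; congr (x ^+ _ *: _).
by have := ltn_ord t; lia.
Qed.

Section FermionModel.
Context {C : fieldType} {B : algType C} {k : nat}.
Variables (a b : 'I_k -> B).
Hypothesis C2 : 2%:R != 0 :> C.
Hypothesis ab : forall i j, a i * b j + b j * a i = (i == j)%:R.
Hypothesis aa : forall i j, a i * a j + a j * a i = 0.
Hypothesis bb : forall i j, b i * b j + b j * b i = 0.
Variables (l0 : nat) (eps : C) (x q : 'I_k -> C) (z : nat -> C).

Let ba i := car_diag ab i.
Let aS i := anticomm_sqr C2 aa i.
Let bS i := anticomm_sqr C2 bb i.

(** The number operator [b i * a i] shifts the point [x i] by [eps] in the states
    where the fermion [i] is present. *)
Definition occ (i : 'I_k) : B := (x i)%:A + eps *: (b i * a i).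

Lemma occ_b i : occ i * b i = (x i + eps) *: b i.
Proof.
rewrite /occ mulrDl -!scalerAl mul1r -mulrA ba mulrBr mulr1 mulrA bS mul0r subr0.
by rewrite scalerDl.
Qed.
Lemma b_occ i : b i * occ i = x i *: b i.
Proof. by rewrite /occ mulrDr -!scalerAr mulr1 mulrA bS mul0r scaler0 addr0. Qed.
Lemma occ_a i : occ i * a i = x i *: a i.
Proof. by rewrite /occ mulrDl -!scalerAl mul1r -mulrA aS mulr0 scaler0 addr0. Qed.
Lemma a_occ i : a i * occ i = (x i + eps) *: a i.
Proof.
rewrite /occ mulrDr -!scalerAr mulr1 mulrA ba mulrBl mul1r -mulrA aS mulr0 subr0.
by rewrite scalerDl.
Qed.
Lemma occ_comm_b i j : i != j -> occ i * b j = b j * occ i.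
Proof.
move=> ij; rewrite /occ mulrDl mulrDr -!scalerAl -!scalerAr mul1r mulr1 -mulrA.
by rewrite (car_swap ab ij) mulrN mulrA (anticomm_swap bb) mulNr opprK mulrA.
Qed.
Lemma occ_comm_a i j : i != j -> occ i * a j = a j * occ i.
Proof.
move=> ij; rewrite /occ mulrDl mulrDr -!scalerAl -!scalerAr mul1r mulr1 -mulrA.
rewrite (anticomm_swap aa) mulrN mulrA [a j * (b i * _)]mulrA (car_swap ab) 1?eq_sym //.
by rewrite mulNr.
Qed.
Lemma occ_comm i j : occ i * occ j = occ j * occ i.
Proof.
have [->//|ij] := eqVneq i j.
have := commutant_subalg (occ i) => -[[c0 cD] c1 cM].
rewrite {2 3}/occ; apply: (cD) => //; rewrite -[_ *: _]addr0; apply: (cD) => //.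
by apply: cM; [exact: occ_comm_b | exact: occ_comm_a].
Qed.

Definition linfac (i : 'I_k) : {poly B} := 1 - (occ i)%:P * 'X.
Definition detpoly (r : seq 'I_k) : {poly B} := \prod_(i <- r) linfac i.
Definition linfacC (c : C) : {poly B} := 1 - (c%:A)%:P * 'X.

Lemma linfac_comm (w : B) i : occ i * w = w * occ i ->
  w%:P * linfac i = linfac i * w%:P.
Proof.
by move=> ow; rewrite /linfac mulrBr mulrBl mulr1 mul1r -mulrA -commr_polyX !mulrA -!polyCM ow.
Qed.

Lemma linfacC_comm c (s : {poly B}) : s * linfacC c = linfacC c * s.
Proof.
rewrite /linfacC mulrBr mulrBl mulr1 mul1r; congr (_ - _); apply/polyP => m.
rewrite mulrA -[in RHS]mulrA -[in RHS]commr_polyX !mulrA !coefMX coefMC coefCM.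
by case: eqP => // _; rewrite -scalerAl -scalerAr mulr1 mul1r.
Qed.

Lemma detpoly_comm (w : B) r : (forall i, i \in r -> occ i * w = w * occ i) ->
  w%:P * detpoly r = detpoly r * w%:P.
Proof.
move=> ow; rewrite /detpoly big_seq; apply: (big_ind (fun s => w%:P * s = s * w%:P)).
- by rewrite mulr1 mul1r.
- by move=> s t ws wt; rewrite mulrA ws -mulrA wt mulrA.
by move=> i ir; apply: linfac_comm; exact: ow.
Qed.

(** A single fermion operator changes only its own factor of the product. *)
Lemma detpoly_intertwine (y : B) (i : 'I_k) (al be : C) r :
  (forall j, j != i -> occ j * y = y * occ j) ->
  occ i * y = al *: y -> y * occ i = be *: y -> uniq r -> i \in r ->
  detpoly r * y%:P * linfacC be = y%:P * detpoly r * linfacC al.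
Proof.
move=> yC yl yr; rewrite /detpoly; elim: r => // h r IHr /= /andP[hr ur].
rewrite inE big_cons => ir.
have Ly : linfac i * y%:P = y%:P * linfacC al.
  rewrite linfacC_comm /linfac /linfacC !mulrBl mul1r -!mulrA -commr_polyX !mulrA.
  by rewrite -!polyCM yl -scalerAl mul1r.
have yL : y%:P * linfac i = y%:P * linfacC be.
  rewrite /linfac /linfacC !mulrBr mulr1 !mulrA -!polyCM yr.
  by rewrite -scalerAr mulr1.
case: (eqVneq h i) => [hi|hi]; last first.
  move: ir; rewrite eq_sym (negPf hi) /= => ir.
  by rewrite -!mulrA [_ * (y%:P * _)]mulrA IHr // !mulrA (linfac_comm (yC h hi)).
subst h; rewrite -/(detpoly r) -[_ * detpoly r * _]mulrA -detpoly_comm; last first.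
  move=> j jr; apply: yC; by apply: contraTneq jr => ->.
rewrite !mulrA Ly yL -!mulrA; congr (_ * _).
by rewrite [detpoly r * linfacC al]linfacC_comm !mulrA linfacC_comm mulrA.
Qed.

Definition model_d0 (m : nat) : B := (detpoly (enum 'I_k))`_m.

Lemma coef_linfac_mul i (s : {poly B}) m :
  (linfac i * s)`_m = s`_m - (if m is m'.+1 then occ i * s`_m' else 0).
Proof.
rewrite /linfac mulrBl mul1r -mulrA -commr_polyX mulrA coefB coefMX coefCM.
by case: m.
Qed.

Lemma coef_mul_linfacC c (s : {poly B}) m :
  (s * linfacC c)`_m.+1 = s`_m.+1 - c *: s`_m.
Proof.
rewrite /linfacC mulrBr mulr1 mulrA coefB coefMX coefMC /=.
by rewrite -scalerAr mulr1.
Qed.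

Lemma model_d0_0 : model_d0 0%N = 1.
Proof.
rewrite /model_d0 /detpoly; elim: (enum _) => [|h r IHr]; first by rewrite big_nil coef1.
by rewrite big_cons coef_linfac_mul IHr subr0.
Qed.

Lemma model_d0_level r : (k < r)%N -> model_d0 r = 0.
Proof.
move=> kr; apply: nth_default; apply: leq_trans kr.
have : (size (detpoly (enum 'I_k)) <= (size (enum 'I_k)).+1)%N.
  rewrite /detpoly; elim: (enum _) => [|h s IHs].
    by rewrite big_nil size_poly1.
  rewrite big_cons /=; apply: leq_trans (size_polyMleq _ _) _.
  have : (size (linfac h) <= 2)%N.
    apply: leq_trans (size_polyD _ _) _; rewrite geq_max size_poly1 size_polyN /=.
    apply: leq_trans (size_polyMleq _ _) _; rewrite size_polyX.
    by have := size_polyC_leq1 (occ h); lia.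
  by move=> w2; rewrite -subn1 leq_subLR; exact: leq_trans (leq_add w2 IHs) _.
by rewrite size_enum_ord.
Qed.

Lemma model_d0_comm (w : B) m : (forall i, occ i * w = w * occ i) ->
  w * model_d0 m = model_d0 m * w.
Proof.
move=> ow; rewrite /model_d0 -coefCM -coefMC detpoly_comm //.
Qed.

Lemma model_d0C r t : model_d0 r * model_d0 t = model_d0 t * model_d0 r.
Proof.
by apply: model_d0_comm => i; apply: model_d0_comm => j; exact: occ_comm.
Qed.

Definition comm0 (y : B) m := model_d0 m * y - y * model_d0 m.

Lemma comm0_recursion (y : B) (i : 'I_k) (al be : C) :
  (forall j, j != i -> occ j * y = y * occ j) ->
  occ i * y = al *: y -> y * occ i = be *: y ->
  forall m, model_d0 m.+1 * y - be *: (model_d0 m * y) = y * model_d0 m.+1 - al *: (y * model_d0 m).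
Proof.
move=> yC yl yr m.
have := congr1 (fun s : {poly B} => s`_m.+1)
  (detpoly_intertwine yC yl yr (enum_uniq 'I_k) (mem_enum _ i)).
by rewrite !coef_mul_linfacC !coefMC !coefCM.
Qed.

Lemma comm0_0 (y : B) : comm0 y 0%N = 0.
Proof. by rewrite /comm0 model_d0_0 mul1r mulr1 subrr. Qed.

Lemma comm0_b i m : comm0 (b i) m.+1 = x i *: comm0 (b i) m + - (eps *: (b i * model_d0 m)).
Proof.
have /eqP := @comm0_recursion (b i) i _ _ (fun j ji => occ_comm_b ji) (occ_b i) (b_occ i) m.
rewrite subr_eq => /eqP; rewrite /comm0 => ->.
rewrite scalerDl scalerBr addrAC [b i * _ - _ - _]addrAC subrr add0r opprD.
by rewrite addrC addrA.
Qed.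

Lemma comm0_a i m : comm0 (a i) m.+1 = x i *: comm0 (a i) m + eps *: (model_d0 m * a i).
Proof.
have /eqP := @comm0_recursion (a i) i _ _ (fun j ji => occ_comm_a ji) (occ_a i) (a_occ i) m.
rewrite subr_eq => /eqP; rewrite /comm0 => ->.
rewrite scalerDl scalerBr addrAC [a i * _ - _ - _]addrAC subrr add0r.
by rewrite addrA; congr (_ + _); exact: addrC.
Qed.

(** The coefficients of the central series; only from [l0] on do they involve
    the residues [q] at the points [x]. *)
Definition zser (n : nat) : C :=
  if n == 0%N then 1 else if (n <= l0)%N then z n
  else \sum_i q i * x i ^+ (n - l0.+1).

Definition model_d1 (n : nat) : B := \sum_(c < n.+1) zser c *: model_d0 (n - c)%N.

Lemma model_d1E n : model_d1 n = conv (fun c => (zser c)%:A) model_d0 n.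
Proof. by apply: eq_bigr => c _; rewrite -scalerAl mul1r. Qed.

Lemma model_d1_0 : model_d1 0%N = 1.
Proof. by rewrite /model_d1 big_ord1 /zser /= scale1r model_d0_0. Qed.

Definition comm1 (y : B) m := model_d1 m * y - y * model_d1 m.

Lemma comm1E y m : comm1 y m = \sum_(c < m.+1) zser c *: comm0 y (m - c)%N.
Proof.
rewrite /comm1 mulr_suml mulr_sumr -sumrB; apply: eq_bigr => c _.
by rewrite -scalerAl -scalerAr -scalerBr.
Qed.

Lemma comm1_0 y : comm1 y 0%N = 0.
Proof. by rewrite /comm1 model_d1_0 mul1r mulr1 subrr. Qed.

(** Convolution with the central series commutes with the recursion, so that [D1]
    inherits the brackets of [D0]. *)
Lemma comm1_recursion y c (g : nat -> B) :
  (forall m, comm0 y m.+1 = c *: comm0 y m + g m) ->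
  forall m, comm1 y m.+1 = c *: comm1 y m + \sum_(i < m.+1) zser i *: g (m - i)%N.
Proof.
move=> yS m; rewrite !comm1E big_ord_recr /= subnn comm0_0 scaler0 addr0.
rewrite scaler_sumr -big_split; apply: eq_bigr => i _ /=.
rewrite subSn; last by rewrite -ltnS ltn_ord.
by rewrite yS scalerDr !scalerA mulrC.
Qed.

Lemma comm1_b i m : comm1 (b i) m.+1 = x i *: comm1 (b i) m + - (eps *: (b i * model_d1 m)).
Proof.
rewrite (comm1_recursion (comm0_b i)); congr (_ + _).
rewrite mulr_sumr scaler_sumr -sumrN; apply: eq_bigr => c _.
by rewrite scalerN -scalerAr !scalerA mulrC.
Qed.

Lemma comm1_a i m : comm1 (a i) m.+1 = x i *: comm1 (a i) m + eps *: (model_d1 m * a i).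
Proof.
rewrite (comm1_recursion (comm0_a i)); congr (_ + _).
rewrite mulr_suml scaler_sumr; apply: eq_bigr => c _.
by rewrite -scalerAl !scalerA mulrC.
Qed.

Definition model_e (j : nat) : B := \sum_i (eps * q i * x i ^+ j) *: a i.
Definition model_f (j : nat) : B := \sum_i (x i ^+ j) *: b i.

Lemma model_raise (D : nat -> B) :
  (forall i, D 0%N * a i - a i * D 0%N = 0) ->
  (forall i m, D m.+1 * a i - a i * D m.+1
     = x i *: (D m * a i - a i * D m) + eps *: (D m * a i)) ->
  bracket_raise eps model_e D.
Proof.
move=> D0 DS r j; rewrite mulr_sumr mulr_suml -sumrB.
have sol i := first_order_recursion (D0 i) (DS i) r.
under eq_bigr => i _ do rewrite -scalerAr -scalerAl -scalerBr sol scaler_sumr.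
rewrite exchange_big scaler_sumr; apply: eq_bigr => t _ /=.
rewrite mulr_sumr scaler_sumr; apply: eq_bigr => i _.
by rewrite -scalerAr !scalerA exprD; congr (_ *: _); ring.
Qed.

Lemma model_lower (D : nat -> B) :
  (forall i, D 0%N * b i - b i * D 0%N = 0) ->
  (forall i m, D m.+1 * b i - b i * D m.+1
     = x i *: (D m * b i - b i * D m) + - (eps *: (b i * D m))) ->
  bracket_lower eps model_f D.
Proof.
move=> D0 DS r j; rewrite mulr_sumr mulr_suml -sumrB.
have sol i := first_order_recursion (D0 i) (DS i) r.
under eq_bigr => i _ do rewrite -scalerAr -scalerAl -scalerBr sol scaler_sumr.
rewrite exchange_big scaler_sumr -sumrN; apply: eq_bigr => t _ /=.
rewrite mulr_suml scaler_sumr -sumrN; apply: eq_bigr => i _.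
by rewrite -scalerAl !scalerN !scalerA exprD; congr (- (_ *: _)); ring.
Qed.

Lemma model_EF i j : model_e i * model_f j + model_f j * model_e i = (eps * zser (l0 + i + j).+1)%:A.
Proof.
rewrite (@lincomb_car _ _ _ a b (fun i j => (i == j)%:R)); last first.
  by move=> i' j'; rewrite ab scaler_nat.
congr (_ *: _); rewrite /zser /= ltnNge -addnA leq_addr /= mulr_sumr.
apply: eq_bigr => h _; rewrite (bigD1 h) //= eqxx mulr1 big1 ?addr0; last first.
  by move=> h' /negPf hh; rewrite eq_sym hh mulr0.
by rewrite subSS addKn exprD !mulrA.
Qed.

(** The series [D1] is [D0] times a series with scalar coefficients, and these
    commute with the inverse of [D0]. *)
Lemma central_quotient (dt : nat -> B) n :
  (forall r, conv dt model_d0 r = (r == 0%N)%:R) -> conv dt model_d1 n = (zser n)%:A.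
Proof.
move=> dtP; pose cA c : B := (zser c)%:A.
rewrite (eq_conv (u' := dt) (v' := conv cA model_d0)) // => [|m _]; last exact: model_d1E.
rewrite conv_assoc.
rewrite (eq_conv (u' := conv cA dt) (v' := model_d0)) // => [|m _]; last first.
  rewrite /conv (reindex_inj rev_ord_inj) /=; apply: eq_bigr => c _.
  rewrite subSS subKn; last by rewrite -ltnS ltn_ord.
  by rewrite /cA -scalerAr -scalerAl mulr1 mul1r.
rewrite -conv_assoc (eq_conv (u' := cA) (v' := fun r => (r == 0%N)%:R)) //.
rewrite /conv big_ord_recr /= subnn mulr1 big1 ?add0r // => c _.
by rewrite subn_eq0 leqNgt ltn_ord mulr0.
Qed.

Lemma model_d01C r t : model_d0 r * model_d1 t = model_d1 t * model_d0 r.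
Proof.
rewrite mulr_sumr mulr_suml; apply: eq_bigr => c _.
by rewrite -scalerAl -scalerAr model_d0C.
Qed.

Lemma model_d1C r t : model_d1 r * model_d1 t = model_d1 t * model_d1 r.
Proof.
rewrite {1}/model_d1 mulr_suml [model_d1 r in RHS]/model_d1 mulr_sumr; apply: eq_bigr => c _.
by rewrite -scalerAl -scalerAr model_d01C.
Qed.

Lemma model_family (dt : nat -> B) : (forall r, conv dt model_d0 r = (r == 0%N)%:R) ->
  yangian_family k l0 eps dt model_d0 model_d1 model_e model_f.
Proof.
move=> dtP; split => //.
- exact: model_d0_0.
- exact: model_d1_0.
- exact: model_d0_level.
- exact: model_d0C.
- exact: model_d01C.
- exact: model_d1C.
- by move=> i j; exact: lincomb_anticomm.
- by move=> i j; exact: lincomb_anticomm.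
- apply: model_raise; [move=> i; exact: comm0_0 | exact: comm0_a].
- apply: model_raise; [move=> i; exact: comm1_0 | exact: comm1_a].
- apply: model_lower; [move=> i; exact: comm0_0 | exact: comm0_b].
- apply: model_lower; [move=> i; exact: comm1_0 | exact: comm1_b].
- by move=> i j; rewrite model_EF (central_quotient _ dtP) scalerA.
Qed.

(** The eigenvalue of the series [D0] on the vacuum, where all fermions are absent. *)
Definition detpolyC : {poly C} := \prod_(i <- enum 'I_k) (1 - (x i)%:P * 'X).

Lemma model_d0_vacuum (v : B) m : (forall i, a i * v = 0) ->
  model_d0 m * v = detpolyC`_m *: v.
Proof.
move=> av; rewrite /model_d0 /detpoly /detpolyC.
elim: (enum _) m => [|h r IHr] m.
  by rewrite !big_nil !coef1; case: eqP => _; rewrite ?mul1r ?scale1r ?mul0r ?scale0r.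
rewrite !big_cons coef_linfac_mul mulrBl IHr.
rewrite (mulrBl _ 1) mul1r -mulrA -commr_polyX mulrA coefB coefMX coefCM scalerBl.
congr (_ - _); case: m => [|m] /=; first by rewrite mul0r scale0r.
rewrite -mulrA IHr -scalerAr /occ mulrDl -!scalerAl mul1r -mulrA av mulr0 scaler0.
by rewrite addr0 scalerA mulrC.
Qed.

Lemma model_d1_vacuum (v : B) m : (forall i, a i * v = 0) ->
  model_d1 m * v = conv zser (fun n => detpolyC`_n) m *: v.
Proof.
move=> av; rewrite /model_d1 mulr_suml /conv scaler_suml; apply: eq_bigr => c _.
by rewrite -scalerAl model_d0_vacuum // scalerA.
Qed.

End FermionModel.

(** * Homomorphisms from the shifted Yangian *)

Section ShiftedYangianPresentation.
Context {C : fieldType}.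
Variables (par : 'I_2 -> bool) (s : 'M[nat]_2) (k : nat).
Hypothesis shift : is_shift_matrix s.
Local Notation R := (yangian_relations C par s k).
Local Notation F := (free_alg C (ygen s)).
Local Notation eps := ((-1) ^+ par 0 : C).

Lemma shift_diag (i : 'I_2) : s i i = 0%N.
Proof.
have [s0 s1] := shift; have [->|i0] := eqVneq i 0; first exact: s0.
suff -> : i = 1 by exact: s1.
by apply/val_inj; case: i i0 => [[|[|//]] lti].
Qed.

Definition pres_d (i : 'I_2) (r : nat) : presented R := ppi R (yd C s i r).
Definition pres_e (j : nat) : presented R := ppi R (ye C s (s12 s + j).+1).
Definition pres_f (j : nat) : presented R := ppi R (yf C s (s21 s + j).+1).

Lemma supercomm00 (A : pzRingType) (u v : A) : supercomm false false u v = u * v - v * u.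
Proof. by rewrite /supercomm /= expr0 mul1r. Qed.
Lemma supercomm01 (A : pzRingType) (u v : A) : supercomm false true u v = u * v - v * u.
Proof. by rewrite /supercomm /= expr0 mul1r. Qed.
Lemma supercomm11 (A : pzRingType) (u v : A) : supercomm true true u v = u * v + v * u.
Proof. by rewrite /supercomm /= expr1 mulN1r opprK. Qed.

Let ppi_eq (u v : F) : yangian_rel par k (u - v) -> ppi R u = ppi R v.
Proof.
move=> Ruv; apply/eqP; rewrite -subr_eq0 -raddfB; apply/eqP.
exact: (@ppi_rel C _ R).
Qed.
Let ppi_eqN (u v : F) : yangian_rel par k (u + v) -> ppi R u = - ppi R v.
Proof.
move=> Ruv; apply/eqP; rewrite -addr_eq0 -raddfD; apply/eqP.
exact: (@ppi_rel C _ R).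
Qed.
Let ppi_bracket (u v : F) :
  ppi R (supercomm false true u v) = ppi R u * ppi R v - ppi R v * ppi R u.
Proof.
rewrite supercomm01 raddfB /=.
exact: (f_equal2 (fun p q => p - q) (ppi_mul R u v) (ppi_mul R v u)).
Qed.
Let ppi_anti (u v : F) :
  ppi R (supercomm true true u v) = ppi R u * ppi R v + ppi R v * ppi R u.
Proof.
rewrite supercomm11 raddfD /=.
exact: (f_equal2 +%R (ppi_mul R u v) (ppi_mul R v u)).
Qed.
Let ppi_lincomb c (n : nat) (f g : nat -> F) :
  ppi R (c *: \sum_(a < n) f a * g a) = c *: \sum_(a < n) ppi R (f a) * ppi R (g a).
Proof.
have S : ppi R (\sum_(a < n) f a * g a) = \sum_(a < n) ppi R (f a) * ppi R (g a).
  by rewrite raddf_sum; apply: eq_bigr => a _; rewrite /= ppi_mul.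
by rewrite ppiZ S.
Qed.

Lemma yd_comm i j r t : pres_d i r * pres_d j t = pres_d j t * pres_d i r.
Proof.
have y0 i' : pres_d i' 0 = 1 by exact: rmorph1.
case: r => [|r]; first by rewrite y0 mul1r mulr1.
case: t => [|t]; first by rewrite y0 mul1r mulr1.
apply/eqP; rewrite -subr_eq0 -!rmorphM -rmorphB -supercomm00; apply/eqP/(@ppi_rel C _ R).
exact: YDD.
Qed.

(** Only one inverse of the series [D0] in the free algebra is needed: the relation
    for the supercommutator of [e] and [f] holds for each. *)
Lemma presented_family : exists dt,
  yangian_family k (s12 s + s21 s) eps dt (pres_d 0) (pres_d 1) pres_e pres_f.
Proof.
have [dtF dtFP] := @conv_inverse F (yd C s 0) erefl.
have Y0 i : pres_d i 0 = 1 by exact: rmorph1.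
have idx (a b c r : nat) : (a < r)%N -> (r + (b + c).+1 - 1 - a = (b + (c + (r - 1 - a))).+1)%N.
  by lia.
have raise i : bracket_raise eps pres_e (pres_d i).
  case=> [|r] j; first by rewrite Y0 mul1r mulr1 subrr big_ord0 scaler0.
  have rel := ppi_eq (@YDE C par s k i r.+1 (s12 s + j).+1 isT (leq_addr _ _)).
  apply: (etrans (esym (ppi_bracket _ _))); apply: (etrans rel).
  apply: (etrans (ppi_lincomb _ _ _ (fun a => ye C s (r.+1 + (s12 s + j).+1 - 1 - a)))).
  by apply: congr1; apply: eq_bigr => a _; rewrite (idx (nat_of_ord a) _ _ _ (ltn_ord a)).
have lower i : bracket_lower eps pres_f (pres_d i).
  case=> [|r] j; first by rewrite Y0 mul1r mulr1 subrr big_ord0 scaler0 oppr0.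
  have rel := ppi_eqN (@YDF C par s k i r.+1 (s21 s + j).+1 isT (leq_addr _ _)).
  apply: (etrans (esym (ppi_bracket _ _))); apply: (etrans rel); apply: (congr1 -%R).
  apply: (etrans (ppi_lincomb _ _ (fun a => yf C s (r.+1 + (s21 s + j).+1 - 1 - a)) _)).
  by apply: congr1; apply: eq_bigr => a _; rewrite (idx (nat_of_ord a) _ _ _ (ltn_ord a)).
exists (fun r => ppi R (dtF r)); split.
- exact: Y0.
- exact: Y0.
- by move=> r kr; apply: (@ppi_rel C _ R); exact: YLevel.
- by move=> r t; exact: yd_comm.
- by move=> r t; exact: yd_comm.
- by move=> r t; exact: yd_comm.
- move=> i j; apply: (etrans (esym (ppi_anti _ _))); apply: (@ppi_rel C _ R).
  by apply: YEE; exact: leq_addr.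
- move=> i j; apply: (etrans (esym (ppi_anti _ _))); apply: (@ppi_rel C _ R).
  by apply: YFF; exact: leq_addr.
- exact: raise.
- exact: raise.
- exact: lower.
- exact: lower.
- move=> i j.
  have := ppi_eq (@YEF C par s k dtF (s12 s + i).+1 (s21 s + j).+1 dtFP
                       (leq_addr _ _) (leq_addr _ _)).
  have -> : ((s12 s + i).+1 + (s21 s + j).+1 = (s12 s + s21 s + i + j).+2)%N by lia.
  move=> rel; apply: (etrans (esym (ppi_anti _ _))); apply: (etrans rel).
  apply: (etrans (ppi_lincomb _ _ _ (fun a => yd C s 1 ((s12 s + s21 s + i + j).+2 - 1 - a)))).
  by apply: congr1; apply: eq_bigr => a _; rewrite subn1.
- move=> r; transitivity (ppi R (conv dtF (yd C s 0) r)).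
    by rewrite /conv raddf_sum; apply: eq_bigr => a _; rewrite /= ppi_mul.
  by rewrite dtFP; case: (r == 0%N); [exact: rmorph1 | exact: raddf0].
Qed.

Section Lift.
Context {B : algType C}.
Variables D0 D1 E Fs : nat -> B.
Hypothesis fam : forall dt, (forall r, conv dt D0 r = (r == 0%N)%:R) ->
  yangian_family k (s12 s + s21 s) eps dt D0 D1 E Fs.
Hypothesis D00 : D0 0%N = 1.

(** The indices of [e] and [f] are counted from the first admissible one. *)
Definition yangian_image (x : dindex) : B :=
  if x.1.1 == x.1.2 then (if x.1.1 == 0 then D0 x.2 else D1 x.2)
  else if x.1.1 == 0 then E (x.2 - (s12 s).+1) else Fs (x.2 - (s21 s).+1).

Let g (x : ygen s) : B := yangian_image (val x).

Lemma yelt_image i j r : (s i j < r)%N ->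
  falg_lift g (yelt C s i j r) = yangian_image (i, j, r).
Proof.
by move=> sr; rewrite /yelt; case: insubP => [u _ uE|/negP//]; rewrite falg_lift_gen /g uE.
Qed.

Lemma yd_image i r :
  falg_lift g (yd C s i r) = if i == 0 then D0 r else D1 r.
Proof.
have [dt dtP] := conv_inverse D00; have Y := fam dtP.
case: r => [|r].
  by rewrite rmorph1 (yf_D00 Y) (yf_D10 Y); case: ifP.
by rewrite /yd /= yelt_image ?shift_diag // /yangian_image /= eqxx.
Qed.

Lemma ye_image j : falg_lift g (ye C s (s12 s + j).+1) = E j.
Proof. by rewrite /ye yelt_image ?ltnS ?leq_addr // /yangian_image /= subSS addKn. Qed.
Lemma yf_image j : falg_lift g (yf C s (s21 s + j).+1) = Fs j.
Proof. by rewrite /yf yelt_image ?ltnS ?leq_addr // /yangian_image /= subSS addKn. Qed.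

Local Notation G := (falg_lift g).
Let liftM (u v : F) : G (u * v) = G u * G v.
Proof. by rewrite rmorphM. Qed.
Let lift_bracket p (u v : F) :
  G (supercomm false p u v) = G u * G v - G v * G u.
Proof.
rewrite /supercomm /= expr0 mul1r raddfB /=.
exact: (f_equal2 (fun p q => p - q) (liftM u v) (liftM v u)).
Qed.
Let lift_anti (u v : F) : G (supercomm true true u v) = G u * G v + G v * G u.
Proof.
rewrite supercomm11 raddfD /=; exact: (f_equal2 +%R (liftM u v) (liftM v u)).
Qed.
Let lift_lincomb c (n : nat) (f h : nat -> F) :
  G (c *: \sum_(a < n) f a * h a) = c *: \sum_(a < n) G (f a) * G (h a).
Proof.
have S : G (\sum_(a < n) f a * h a) = \sum_(a < n) G (f a) * G (h a).
  by rewrite raddf_sum; apply: eq_bigr => a _; rewrite /= liftM.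
have Z (u : F) : G (c *: u) = c *: G u by rewrite linearZ.
by rewrite Z S.
Qed.
Let lift_sub0 (u v : F) : G u = G v -> G (u - v) = 0.
Proof. by move=> uv; rewrite raddfB /= uv subrr. Qed.
Let lift_add0 (u v : F) : G u = - G v -> G (u + v) = 0.
Proof. by move=> uv; rewrite raddfD /= uv addNr. Qed.

(** An inverse of [D0] in the free algebra maps to an inverse of its image,
    whence the quantification over all inverses. *)
Lemma yangian_rel_image u : yangian_rel par k u -> falg_lift g u = 0.
Proof.
have [dt0 dt0P] := conv_inverse D00; have Y := fam dt0P.
have shiftK b t : (b < t)%N -> t = (b + (t - b.+1)).+1 by lia.
have idx (a b c r : nat) : (a < r)%N -> (r + (b + c).+1 - 1 - a = (b + (c + (r - 1 - a))).+1)%N.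
  by lia.
case=> [r kr|i j r t _ _|r t sr st|r t sr st|dt r t dtP sr st|i r t r0 st|i r t r0 st].
- by rewrite yd_image (yf_level Y).
- rewrite lift_bracket !yd_image; apply/eqP; rewrite subr_eq0; apply/eqP.
  by case: ifP => _; case: ifP => _; rewrite ?(yf_D0C Y r) ?(yf_D01C Y) ?(yf_D1C Y r).
- rewrite (shiftK _ _ sr) (shiftK _ _ st) lift_anti !ye_image.
  exact: yf_EE Y _ _.
- rewrite (shiftK _ _ sr) (shiftK _ _ st) lift_anti !yf_image.
  exact: yf_FF Y _ _.
- rewrite (shiftK _ _ sr) (shiftK _ _ st); move: (r - _)%N (t - _)%N => i j.
  have dtI q : conv (fun a => G (dt a)) D0 q = (q == 0%N)%:R.
    rewrite -(rmorph_nat G) -dtP raddf_sum; apply: eq_bigr => a _.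
    by rewrite /= liftM yd_image.
  have -> : ((s12 s + i).+1 + (s21 s + j).+1 = (s12 s + s21 s + i + j).+2)%N by lia.
  apply: lift_sub0; rewrite lift_anti ye_image yf_image (yf_EF (fam dtI)).
  rewrite (lift_lincomb _ _ _ (fun a => yd C s 1 ((s12 s + s21 s + i + j).+2 - 1 - a))).
  by apply: congr1; apply: eq_bigr => a _; rewrite yd_image subn1.
- rewrite (shiftK _ _ st); move: (t - _)%N => j.
  have raise : bracket_raise eps E (fun r => if i == 0 then D0 r else D1 r).
    by case: (i == 0); [exact: yf_D0E Y | exact: yf_D1E Y].
  apply: lift_sub0; rewrite lift_bracket yd_image ye_image raise.
  rewrite (lift_lincomb _ _ _ (fun a => ye C s (r + (s12 s + j).+1 - 1 - a))).
  by apply: congr1; apply: eq_bigr => a _; rewrite yd_image (idx (nat_of_ord a) _ _ _ (ltn_ord a)) ye_image.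
- rewrite (shiftK _ _ st); move: (t - _)%N => j.
  have lower : bracket_lower eps Fs (fun r => if i == 0 then D0 r else D1 r).
    by case: (i == 0); [exact: yf_D0F Y | exact: yf_D1F Y].
  apply: lift_add0; rewrite lift_bracket yd_image yf_image lower; apply: (congr1 -%R).
  rewrite (lift_lincomb _ _ (fun a => yf C s (r + (s21 s + j).+1 - 1 - a)) _).
  by apply: congr1; apply: eq_bigr => a _; rewrite yd_image (idx (nat_of_ord a) _ _ _ (ltn_ord a)) yf_image.
Qed.

Lemma yangian_lift :
  {h : {lrmorphism presented R -> B} |
    [/\ forall r, h (pres_d 0 r) = D0 r, forall r, h (pres_d 1 r) = D1 r,
        forall j, h (pres_e j) = E j & forall j, h (pres_f j) = Fs j]}.
Proof.
have [h hE] := @presented_lift C _ R B g yangian_rel_image.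
by exists h; split=> r; rewrite hE ?yd_image ?ye_image ?yf_image.
Qed.

End Lift.

End ShiftedYangianPresentation.

(** * Evaluation of free commutative polynomials *)

Lemma rmorph_supercomm (A B : pzRingType) (f : {rmorphism A -> B}) p q u v :
  f (supercomm p q u v) = supercomm p q (f u) (f v).
Proof. by rewrite /supercomm rmorphB !rmorphM rmorphXn rmorphN1. Qed.

Lemma equalizer_subalg (C : fieldType) (A B : algType C) (f g : {lrmorphism A -> B}) :
  is_subalg [set u | f u = g u].
Proof.
split=> [||u v /= fu fv].
- split=> [|a u v /= fu fv]; first by rewrite /= !raddf0.
  by rewrite !linearP /= fu fv.
- by rewrite /= !rmorph1.
- by rewrite !rmorphM /= fu fv.
Qed.

Section CommutativeFree.
Context {C : fieldType} {X : choiceType} (par : X -> bool).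
Hypothesis even : forall x, par x = false.
Local Notation Pol := (presented (supercomm_relations C par)).
Local Notation pg := (pgen (supercomm_relations C par)).

(** The universal property of the free supercommutative algebra. *)
Lemma supercomm_gen_lift (B : algType C) (g : X -> B) :
  (forall x y, supercomm (par x) (par y) (g x) (g y) = 0) ->
  {h : {lrmorphism Pol -> B} | forall x, h (pg x) = g x}.
Proof.
move=> gC; have [u [x y]|h hE] := @presented_lift C X (supercomm_relations C par) B g.
  apply: (etrans (rmorph_supercomm (falg_lift g) _ _ _ _)).
  by rewrite /= !falg_lift_gen; exact: gC.
by exists h => x; rewrite hE falg_lift_gen.
Qed.

Lemma comm_lift (B : algType C) (g : X -> B) :
  (forall x y, g x * g y = g y * g x) ->
  {h : {lrmorphism Pol -> B} | forall x, h (pg x) = g x}.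
Proof.
move=> gC; apply: supercomm_gen_lift => x y.
by rewrite !even supercomm00 gC subrr.
Qed.

End CommutativeFree.

Lemma pgen_comm (C : fieldType) (X : choiceType) (par : X -> bool) x y :
  (forall x, par x = false) ->
  pgen (supercomm_relations C par) x * pgen (supercomm_relations C par) y
  = pgen (supercomm_relations C par) y * pgen (supercomm_relations C par) x.
Proof.
move=> even; have rel : supercomm_rel par (supercomm (par x) (par y) (fgen x) (fgen y) : free_alg C X).
  exact: SupercommRel.
have := @ppi_rel C X (supercomm_relations C par) _ rel.
rewrite !even supercomm00 raddfB /= => /eqP; rewrite subr_eq0 => /eqP e.
exact: (etrans (esym (ppi_mul _ _ _)) (etrans e (ppi_mul _ _ _))).
Qed.

Section Evaluation.
Context {C : numFieldType} {X : choiceType} (par : X -> bool).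
Hypothesis even : forall x, par x = false.
Local Notation Pol := (presented (supercomm_relations C par)).
Local Notation pg := (pgen (supercomm_relations C par)).

(** The polynomial vanishing at the exceptional points makes up for them. *)
Lemma poly_vanish (p : {poly C}) (bad : seq C) :
  (forall t, t \notin bad -> p.[t] = 0) -> p = 0.
Proof.
move=> pt; pose q := p * \prod_(c <- bad) ('X - c%:P).
have q0 : q = 0.
  apply: (@roots_geq_poly_eq0 _ _ [seq i%:R | i <- iota 0 (size q)]).
  - apply/allP => t _; rewrite rootE hornerM; case: (boolP (t \in bad)) => tb.
      rewrite [X in _ * X](_ : _ = 0) ?mulr0 //; apply/eqP.
      by rewrite -rootE root_prod_XsubC.
    by rewrite pt ?mul0r.
  - by rewrite map_inj_uniq ?iota_uniq // => i j /eqP; rewrite eqr_nat => /eqP.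
  - by rewrite size_map size_iota.
apply/eqP; move/eqP: q0; rewrite mulf_eq0 => /orP[//|].
by rewrite (negPf (monic_neq0 (monic_prod_XsubC _ _ _))).
Qed.

(** The target is the regular algebra [C^o] because the universal property produces
    morphisms of algebras. *)
Definition ev (th : X -> C) : {lrmorphism Pol -> C^o} :=
  sval (@comm_lift C X par even C^o th (fun x y => mulrC (th x) (th y))).

Lemma evE th x : ev th (pg x) = th x.
Proof. exact: (svalP (comm_lift even _)). Qed.

(** Along a path with polynomial coordinates, a polynomial is polynomial in the
    parameter. *)
Lemma ev_path (th : X -> {poly C}) u :
  exists p : {poly C}, forall t, p.[t] = ev (fun x => (th x).[t]) u.
Proof.
have [h hE] := @comm_lift C X par even {poly C} th (fun x y => mulrC (th x) (th y)).
exists (h u) => t; move: u; apply: presented_ind => [|x]; last by rewrite /= hE evE.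
split=> [||u v /= fu fv] /=; rewrite ?rmorph1 ?hornerC ?rmorphM ?hornerM ?fu ?fv //.
split=> [|a u v /= fu fv] /=; first by rewrite !raddf0 horner0.
by rewrite !linearP /= hornerD hornerZ fu fv.
Qed.

(** A polynomial vanishing at all but finitely many points of a polynomial path
    vanishes on the whole path. *)
Lemma ev_perturb (th : X -> {poly C}) (bad : seq C) u :
  (forall t, t \notin bad -> ev (fun x => (th x).[t]) u = 0) ->
  ev (fun x => (th x).[0]) u = 0.
Proof.
have [p pE] := ev_path th u => H.
by rewrite -pE (@poly_vanish p bad) ?horner0 // => t tb; rewrite pE H.
Qed.

Lemma eq_ev th th' u : th =1 th' -> ev th u = ev th' u.
Proof. by move=> /funext ->. Qed.

Lemma pol_pgen_central x u : pg x * u = u * pg x.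
Proof.
move: u; apply: presented_ind => [|y]; first exact: commutant_subalg.
by apply: pgen_comm.
Qed.

(** Induction on the variables: with respect to one variable, whose values are
    free, a polynomial vanishing everywhere has vanishing coefficients. *)
Lemma ev_separates (xs : seq X) : uniq xs -> (forall x, x \in xs) ->
  forall u, (forall th, ev th u = 0) -> u = 0.
Proof.
move=> uxs Xxs u; pose sub (ys : seq X) := subalg_set (subalg_gen [set pg x | x in [set x | x \in ys]]).
suff : sub xs u.
  elim: xs uxs u {Xxs} => [_|x ys IHys /= /andP[xys uys]] u su u0.
    have [c uc] : exists c, u = c%:A.
      move: u su {u0}; apply: subalg_gen_sub => [|y [x]]; last by rewrite /= in_nil.
      split=> [||_ _ [a ->] [b ->]].
      - split=> [|a _ _ [b ->] [c ->]]; first by exists 0; rewrite scale0r.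
        by exists (a * b + c); rewrite scalerA -scalerDl.
      - by exists 1; rewrite scale1r.
      - by exists (a * b); rewrite -scalerAl mul1r scalerA.
    have := u0 (fun=> 0); rewrite uc linearZ /= rmorph1 => c1.
    by rewrite -[c]mulr1 [c * 1]c1 scale0r.
  have [p [ps pu]] : exists p : {poly Pol}, (forall i, sub ys p`_i) /\ u = p.[pg x].
    pose Q := [set u | exists p : {poly Pol}, (forall i, sub ys p`_i) /\ u = p.[pg x]].
    have HA : is_subalg (sub ys) by exact: subalg_setP.
    have [[s0 sD] s1 sM] := HA.
    have Q1 : Q 1 by exists 1; rewrite hornerC; split=> // i; rewrite coef1; case: eqP.
    have QM : is_submod Q.
      split=> [|a _ _ [p [ps ->]] [q [qs ->]]].
        by exists 0; rewrite horner0; split=> // i; rewrite coef0.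
      exists (a%:A *: p + q); rewrite hornerD hornerZ -scalerAl mul1r; split=> // i.
      rewrite coefD coefZ -scalerAl mul1r; exact: sD.
    suff stab : [set v | forall w, Q w -> Q (v * w)] u.
      by rewrite -[u]mulr1; exact: stab.
    move: u su {u0}; apply: subalg_gen_sub; first exact: left_stabilizer_subalg.
    move=> _ [y yx <-] _ [p [ps ->]]; move: yx; rewrite /= inE => /orP[/eqP ->|yys].
      exists (p * 'X); rewrite hornerMX pol_pgen_central; split=> // i.
      by rewrite coefMX; case: eqP.
    exists ((pg y)%:P * p); rewrite hornerCM; split=> // i; rewrite coefCM.
    by apply: sM => //; apply: sub_subalg_gen; exists y.
  suff p0 : p = 0 by rewrite pu p0 horner0.
  apply/polyP => i; rewrite coef0; apply: IHys => // th.
  pose q : {poly C} := map_poly (ev th : Pol -> C) p.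
  have qi : q`_i = ev th p`_i by rewrite /q (@coef_map _ _ (ev th)).
  rewrite -qi; suff -> : q = 0 by rewrite coef0.
  apply: (@poly_vanish q [::]) => c _.
  pose th' y := if y == x then c else th y.
  have same v : sub ys v -> ev th' v = ev th v.
    move: v; apply: subalg_gen_sub; first exact: equalizer_subalg.
    move=> _ [y /= yys <-]; rewrite /= !evE /th'; case: eqP => // yx.
    by move: xys; rewrite -yx yys.
  have := u0 th'; rewrite pu -(horner_map (ev th')) /= evE /th' eqxx => <-.
  congr (_.[c]); apply/polyP => m; rewrite /q (@coef_map _ _ (ev th)) (@coef_map _ _ (ev th')).
  by rewrite /= same.
move: u; apply: presented_ind; first exact: subalg_setP.
by move=> x; apply: sub_subalg_gen; exists x => //=.
Qed.

End Evaluation.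

(** * Density of the vacuum eigenvalues *)

(** Reversing the coefficients exchanges the factors [X - x] and [1 - x X]. *)
Lemma coef_prod_reverse (C : comNzRingType) (s : seq C) r :
  (\prod_(x <- s) (1 - x%:P * 'X))`_r
  = if (r <= size s)%N then (\prod_(x <- s) ('X - x%:P))`_(size s - r) else 0.
Proof.
elim: s r => [|x s IHs] r; first by rewrite !big_nil !coef1; case: r.
have big m : (size s < m)%N -> (\prod_(y <- s) ('X - y%:P))`_m = 0.
  by move=> sm; rewrite nth_default // size_prod_XsubC.
have L (p : {poly C}) m : ((1 - x%:P * 'X) * p)`_m
    = p`_m - x * (if m is m'.+1 then p`_m' else 0).
  by rewrite mulrBl mul1r -mulrA coefB coefCM coefXM; case: m.
have M (p : {poly C}) m : (('X - x%:P) * p)`_m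
    = (if m is m'.+1 then p`_m' else 0) - x * p`_m.
  by rewrite mulrBl coefB coefCM coefXM; case: m.
rewrite !big_cons L M; case: r => [|r] /=; first by rewrite IHs !subn0 (big _ (ltnSn _)) !mulr0.
rewrite !IHs ltnS subSS; case: ltngtP => [rs|rs|->].
- by rewrite -[(size s - r)%N]prednK ?subn_gt0 // -subnS.
- by rewrite mulr0 subr0.
by rewrite subnn.
Qed.

Section GenericParameters.
Context {C : numClosedFieldType} {X : choiceType} (par : X -> bool).
Hypothesis even : forall x, par x = false.
Variables (k l0 : nat) (top : X -> bool) (deg : X -> nat).
Hypothesis top_deg : forall x, top x -> (deg x <= k)%N.
Hypothesis bot_deg : forall x, ~~ top x -> (0 < deg x <= l0 + k)%N.
Local Notation Pol := (presented (supercomm_relations C par)).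

Definition theta (f0 f1 : nat -> C) (x : X) : C :=
  if top x then f0 (deg x) else f1 (deg x).

Local Notation P x := (fun r => (@detpolyC C k x)`_r).

Lemma detpolyC0 (x : 'I_k -> C) : (detpolyC x)`_0 = 1.
Proof.
rewrite /detpolyC; elim: (enum _) => [|h r IHr]; first by rewrite big_nil coef1.
by rewrite big_cons coef0M IHr mulr1 coefB coef1 coefCM coefX mulr0 subr0.
Qed.

(** Shifting all [q i] by the same parameter makes them nonzero for almost all
    values of it. *)
Lemma generic_step1 u (x : 'I_k -> C) :
  (forall q z, (forall i, q i != 0) ->
     ev even (theta (P x) (conv (zser l0 x q z) (P x))) u = 0) ->
  forall q z, ev even (theta (P x) (conv (zser l0 x q z) (P x))) u = 0.
Proof.
move=> H q z.
pose zp n : {poly C} := (zser l0 x q z n)%:P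
  + (if (n <= l0)%N then 0 else \sum_i x i ^+ (n - l0.+1)) *: 'X.
pose path y : {poly C} := if top y then (P x (deg y))%:P
  else \sum_(c < (deg y).+1) zp c * (P x (deg y - c)%N)%:P.
have pathE t y : (path y).[t]
    = theta (P x) (conv (zser l0 x (fun i => q i + t) z) (P x)) y.
  rewrite /path /theta; case: ifP => _; first by rewrite hornerC.
  rewrite horner_sum; apply: eq_bigr => c _; rewrite hornerM hornerC; congr (_ * _).
  rewrite hornerD hornerC hornerZ hornerX /zser.
  case: eqP => [->|_]; first by rewrite leq0n mul0r addr0.
  case: ifP => _; first by rewrite mul0r addr0.
  rewrite mulr_suml -big_split; apply: eq_bigr => i _ /=.
  by rewrite mulrDl [t * _]mulrC.
have := @ev_perturb C X par even path [seq - q i | i <- enum 'I_k] u.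
rewrite (eq_ev even _ (th' := theta (P x) (conv (zser l0 x q z) (P x)))); last first.
  move=> y; rewrite pathE; congr (theta _ (conv (zser l0 x _ z) _) y).
  by apply/funext => i; rewrite addr0.
apply=> t tbad; rewrite (eq_ev even _ (pathE t)); apply: H => i.
apply: contra tbad; rewrite addr_eq0 => /eqP qt.
by apply/mapP; exists i; rewrite ?mem_enum // qt opprK.
Qed.

Lemma interpolate (x : 'I_k -> C) (c : nat -> C) : injective x ->
  exists q : 'I_k -> C, forall j, (j < k)%N -> \sum_i q i * x i ^+ j = c j.
Proof.
move=> xI; pose V := Vandermonde k (\row_i x i).
have Vu : V \in unitmx.
  rewrite unitmxE det_Vandermonde unitfE; apply/prodf_neq0 => i _.
  apply/prodf_neq0 => j ij; rewrite !mxE subr_eq0.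
  by apply: contraTneq ij => /xI ->; rewrite ltnn.
pose q := invmx V *m (\col_j c (val j)).
exists (fun i => q i 0) => j jk.
have : (V *m q) (Ordinal jk) 0 = c j by rewrite mulmxA mulmxV // mul1mx mxE.
by move=> <-; rewrite mxE; apply: eq_bigr => i _; rewrite !mxE mulrC.
Qed.

(** Given [x], the second series is arbitrary: dividing it by the first series
    determines [z] and, by interpolation, [q]. *)
Lemma generic_step2 u (x : 'I_k -> C) : injective x ->
  (forall q z, (forall i, q i != 0) ->
     ev even (theta (P x) (conv (zser l0 x q z) (P x))) u = 0) ->
  forall f1, ev even (theta (P x) f1) u = 0.
Proof.
move=> xI /generic_step1 H f1.
have [Pinv PinvE] := conv_inverse (detpolyC0 x).
(* The value of the series at [0] is not prescribed by the generators. *)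
pose d n : C := if n == 0%N then 1 else f1 n.
pose c := conv d Pinv.
have [q qE] := interpolate (fun j => c (j + l0.+1)%N) xI.
have zE n : (n <= l0 + k)%N -> zser l0 x q c n = c n.
  rewrite /zser => nl; case: eqP => [->|n0].
    have := PinvE 0%N; rewrite /c /conv !big_ord1 /= detpolyC0 mulr1 => ->.
    by rewrite /d /= mulr1.
  by case: leqP => // ln; rewrite qE ?subnK //; lia.
apply: (etrans _ (H q c)); apply: eq_ev => y; rewrite /theta; case: ifP => // ty.
have /andP[y0 yl] := bot_deg (negbT ty).
rewrite (eq_conv (u' := c) (v' := P x)) // => [|a al]; last by apply: zE; exact: leq_trans yl.
rewrite -conv_assoc (eq_conv (u' := d) (v' := fun r => (r == 0%N)%:R)) //.
rewrite /conv big_ord_recr /= subnn mulr1 big1 ?add0r /d ?gtn_eqF // => a _.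
by rewrite subn_eq0 leqNgt ltn_ord mulr0.
Qed.

(** The first series is a polynomial with constant term [1], hence a product of
    factors [1 - x i X], possibly with repetitions; moving the [x i] apart with
    different speeds makes them distinct for almost all times. *)
Lemma generic_ev u :
  (forall (x q : 'I_k -> C) z, injective x -> (forall i, q i != 0) ->
     ev even (theta (P x) (conv (zser l0 x q z) (P x))) u = 0) ->
  forall f0 f1, f0 0%N = 1 -> ev even (theta f0 f1) u = 0.
Proof.
move=> H f0 f1 f00.
(* The reversed polynomial is monic of degree [k]. *)
pose Q : {poly C} := \poly_(i < k.+1) f0 (k - i)%N.
have Qk : Q`_k = 1 by rewrite coef_poly ltnSn subnn.
have szQ : size Q = k.+1.
  apply/eqP; rewrite eqn_leq size_poly ltnNge; apply/negP => szQ.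
  by have := oner_neq0 C; rewrite -Qk nth_default // eqxx.
have [r rQ] := closed_field_poly_normal Q.
have QE : Q = \prod_(y <- r) ('X - y%:P) by rewrite {1}rQ lead_coefE szQ Qk scale1r.
have szr : size r = k by apply: succn_inj; rewrite -szQ QE size_prod_XsubC.
pose x (i : 'I_k) := r`_i.
have rx : r = [seq x i | i <- enum 'I_k].
  apply: (@eq_from_nth _ 0) => [|i ir]; first by rewrite size_map size_enum_ord.
  rewrite szr in ir; rewrite (nth_map (Ordinal ir)) ?size_enum_ord //.
  by rewrite /x nth_enum_ord.
have f0E m : (m <= k)%N -> f0 m = P x m.
  move=> mk; rewrite /detpolyC -(big_map x xpredT (fun y => 1 - y%:P * 'X)) -rx.
  rewrite coef_prod_reverse szr mk -QE coef_poly subKn //.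
  by rewrite ltnS leq_subr.
pose xt (t : C) (i : 'I_k) : C := x i + i%:R * t.
pose Dt : {poly {poly C}} :=
  \prod_(i <- enum 'I_k) (1 - ((x i)%:P + i%:R *: 'X)%:P * 'X).
have DtE t m : (Dt`_m).[t] = P (xt t) m.
  rewrite -[LHS]/(horner_eval t Dt`_m) -coef_map rmorph_prod; congr ((_ : {poly C})`_m).
  apply: eq_bigr => i _; rewrite rmorphB rmorph1 rmorphM /= map_polyX map_polyC /=.
  by rewrite /horner_eval !hornerE.
pose path y : {poly C} := if top y then Dt`_(deg y) else (f1 (deg y))%:P.
have pathE t y : (path y).[t] = theta (P (xt t)) f1 y.
  by rewrite /path /theta; case: ifP => _; rewrite ?DtE ?hornerC.
(* The times at which two of the moving points meet. *)
pose bad := [seq (x i - x j) / (j%:R - i%:R) | i <- enum 'I_k, j <- enum 'I_k].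
have := @ev_perturb C X par even path bad u.
rewrite (eq_ev even _ (th' := theta f0 f1)); last first.
  move=> y; rewrite pathE /theta; case: ifP => // /top_deg yk.
  rewrite f0E //; congr ((detpolyC _)`_ _); apply/funext => i.
  by rewrite /xt mulr0 addr0.
apply=> t tbad; rewrite (eq_ev even _ (pathE t)).
suff xtI : injective (xt t) by apply: (generic_step2 xtI) => q z q0; exact: H.
move=> i j xij; apply/eqP; apply: contraNT tbad => ij; apply/allpairsP; exists (i, j).
rewrite !mem_enum; split=> //=.
have d0 : (j%:R - i%:R : C) != 0 by rewrite subr_eq0 eqr_nat eq_sym.
apply: (mulIf d0); rewrite divfK //; move: xij; rewrite /xt => /(canRL (addrK _)) ->.
by ring.
Qed.

End GenericParameters.

(** * Independence of the triangular monomials *)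

Section DrinfeldGenerators.
Context {C : numClosedFieldType}.
Variables (par : 'I_2 -> bool) (py : pyramid) (s : 'M[nat]_2).
Hypothesis shift : is_shift_matrix s.
Hypothesis compat : compatible s py.
Local Notation k := (pyr_k py).
Local Notation l0 := (s12 s + s21 s)%N.
Local Notation eps := ((-1) ^+ par 0 : C).
Local Notation R := (yangian_relations C par s k).
Local Notation diag_index := {x : dindex | Omega0 py x}.
Local Notation par_diag := (fun x : diag_index => dparity par (val x)).
Local Notation Pol := (presented (supercomm_relations C par_diag)).

Lemma pyr_lE : pyr_l py = (l0 + k)%N.
Proof. by move: compat; rewrite /compatible; case: ltnP => [_ [_ ->]|]; lia. Qed.

Lemma Omega0_even x : par_diag x = false.
Proof. by have /andP[/eqP xx _] := valP x; rewrite /dparity xx addbb. Qed.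

Definition ztop (x : diag_index) : bool := (val x).1.1 == 0.
Definition zdeg (x : diag_index) : nat := (val x).2.

Lemma ztop_deg x : ztop x -> (zdeg x <= k)%N.
Proof.
by have /andP[_ /andP[_]] := valP x; rewrite /ztop /zdeg /row_size => + x0; rewrite x0.
Qed.

Lemma zbot_deg x : ~~ ztop x -> (0 < zdeg x <= l0 + k)%N.
Proof.
have /andP[_] := valP x; rewrite /ztop /zdeg /row_size => + x0.
by rewrite (negPf x0) pyr_lE.
Qed.

Lemma Omega0_val (x : diag_index) : val x = ((val x).1.1, (val x).1.1, zdeg x).
Proof. by have /andP[/eqP] := valP x; rewrite /zdeg; case: (val x) => [[i j] r] /= ->. Qed.

Lemma ord2 (i : 'I_2) : i != 0 -> i = 1.
Proof. by move=> i0; apply/val_inj; case: i i0 => [[|[|//]] lti]. Qed.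

Definition zlist : seq diag_index :=
  undup (pmap insub [seq (i, i, r) | i <- enum 'I_2, r <- iota 0 (k + pyr_l py).+1]).

Lemma mem_zlist x : x \in zlist.
Proof.
rewrite mem_undup mem_pmap_sub Omega0_val; apply/allpairsPdep.
exists (val x).1.1, (zdeg x); rewrite mem_enum mem_iota; split=> //=.
case: (boolP (ztop x)) => [/ztop_deg|/zbot_deg]; first by rewrite add0n; lia.
by rewrite pyr_lE add0n; lia.
Qed.

(** A polynomial in the diagonal generators is zero when it vanishes at the
    eigenvalues of the vacuum of each model with generic parameters. *)
Lemma zero_of_generic (u : Pol) :
  (forall (x q : 'I_k -> C) z, injective x -> (forall i, q i != 0) ->
     ev Omega0_even (theta ztop zdeg (fun r => (detpolyC x)`_r)
        (conv (zser l0 x q z) (fun r => (detpolyC x)`_r))) u = 0) -> u = 0.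
Proof.
have uz : uniq zlist by exact: undup_uniq.
move=> H; apply: (@ev_separates C diag_index par_diag Omega0_even zlist uz mem_zlist u) => th.
(* The default value is that of the series at [0]. *)
pose f i r : C := if insub (i, i, r) is Some x then th x else 1.
rewrite (eq_ev Omega0_even _ (th' := theta ztop zdeg (f 0) (f 1))).
  apply: (generic_ev ztop_deg zbot_deg) => //.
  by rewrite /f insubF.
move=> x; rewrite /theta.
have fx i : (val x).1.1 = i -> th x = f i (zdeg x).
  by move=> <-; rewrite /f -Omega0_val valK.
case: ifP => [/eqP/fx//|/negbT/ord2/fx //].
Qed.

Definition ydiag (x : diag_index) : presented R := pres_d par s k (val x).1.1 (val x).2.

Lemma ydiag_comm x y : ydiag x * ydiag y = ydiag y * ydiag x.
Proof. exact: yd_comm. Qed.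

(** The diagonal polynomials inside the shifted Yangian. *)
Definition diag_map : {lrmorphism Pol -> presented R} :=
  sval (comm_lift Omega0_even ydiag_comm).

Lemma diag_mapE x : diag_map (pgen _ x) = ydiag x.
Proof. exact: (svalP (comm_lift Omega0_even ydiag_comm)). Qed.

Definition fmon (S : {set 'I_k}) : presented R :=
  ordmon (fun i : 'I_k => pres_f par s k i) (rev (enum 'I_k)) S.
Definition emon (S : {set 'I_k}) : presented R :=
  ordmon (fun i : 'I_k => pres_e par s k i) (enum 'I_k) S.

Lemma rmorph_ordmon (A B : algType C) (h : {lrmorphism A -> B}) (I : finType) (y : I -> A) r S :
  h (ordmon y r S) = ordmon (fun i => h (y i)) r S.
Proof. by rewrite /ordmon rmorph_prod. Qed.

Lemma unitmx_powers (x : 'I_k -> C) (c : 'I_k -> C) :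
  injective x -> (forall i, c i != 0) ->
  (\matrix_(i < k, j < k) (c i * x i ^+ j)) \in unitmx.
Proof.
move=> xI c0.
have -> : \matrix_(i < k, j < k) (c i * x i ^+ j)
    = diag_mx (\row_i c i) *m (Vandermonde k (\row_i x i))^T.
  by apply/matrixP => i j; rewrite mul_diag_mx !mxE.
rewrite unitmx_mul unitmx_tr !unitmxE det_diag det_Vandermonde !unitfE.
apply/andP; split; apply/prodf_neq0 => i _; first by rewrite mxE.
apply/prodf_neq0 => j ij; rewrite !mxE subr_eq0.
by apply: contraTneq ij => /xI ->; rewrite ltnn.
Qed.

(** Linear independence of the triangular monomials over the polynomials in the
    diagonal generators, tested in all fermion models. *)
Lemma triangular_free (u : {set 'I_k} -> {set 'I_k} -> Pol) :
  \sum_(S : {set 'I_k}) \sum_(J : {set 'I_k}) fmon S * diag_map (u S J) * emon J = 0 ->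
  forall S J, u S J = 0.
Proof.
move=> sum0 S J; move: {-1}#|J| (leqnn #|J|) => n.
elim/ltn_ind: n S J => n IHn S0 J0 Jn.
have lt0 (J : {set 'I_k}) : (#|J| < #|J0|)%N -> forall S, u S J = 0.
  by move=> JJ0 S; apply: (IHn #|J|) => //; exact: leq_trans JJ0 Jn.
apply: zero_of_generic => x q z xI q0.
have C2 : 2%:R != 0 :> C by rewrite pnatr_eq0.
have eps0 : eps != 0 by rewrite signr_eq0.
have [m [a' [b' [ab' aa' bb']]]] := car_matrices C k.
pose a (i : 'I_k) := a' i; pose b (i : 'I_k) := b' i.
have ab i j : a i * b j + b j * a i = (i == j)%:R by exact: ab'.
have aa i j : a i * a j + a j * a i = 0 by exact: aa'.
have bb i j : b i * b j + b j * b i = 0 by exact: bb'.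
have ba i j : b i * a j + a j * b i = (i == j)%:R by rewrite addrC ab eq_sym.
pose D0 := model_d0 a b eps x; pose D1 := model_d1 a b l0 eps x q z.
have fam dt (dtP : forall r, conv dt D0 r = (r == 0%N)%:R) :
  yangian_family k l0 eps dt D0 D1 (model_e a eps x q) (model_f b x) by exact: model_family.
have [rho [rho0 rho1 rhoE rhoF]] := yangian_lift shift fam (model_d0_0 a b eps x).
pose v := ordmon a (enum 'I_k) [set: 'I_k].
have vE : v = \prod_(i <- enum 'I_k) a i by apply: eq_bigl => i; rewrite inE.
have v0 : v != 0 by rewrite vE; apply: (vacuum_neq0 ab); exact: enum_uniq.
have av i : a i * v = 0 by apply: ordmon_mul0 => //; rewrite ?mem_enum ?inE.
have lincomb_v (c : 'I_k -> C) : (\sum_i c i *: a i) * v = 0.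
  by rewrite mulr_suml big1 // => i _; rewrite -scalerAl av scaler0.
pose M := \matrix_(i < k, j < k) (eps * q i * x i ^+ j).
pose N := \matrix_(i < k, j < k) (1 * x i ^+ j).
have Mu : M \in unitmx by apply: unitmx_powers => // i; rewrite mulf_neq0.
have Nu : N \in unitmx by apply: unitmx_powers => // i; exact: oner_neq0.
have MeE j : model_e a eps x q (val j) = \sum_i M i j *: a i.
  by apply: eq_bigr => i _; rewrite mxE.
have NfE j : model_f b x (val j) = \sum_i N i j *: b i.
  by apply: eq_bigr => i _; rewrite mxE mul1r.
pose e j := \sum_i M i j *: a i; pose h j := \sum_i invmx M j i *: b i.
pose f j := \sum_i N i j *: b i; pose g j := \sum_i invmx N j i *: a i.
have eh i j : e i * h j + h j * e i = (i == j)%:R by exact: dual_basis.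
have gf i j : g i * f j + f j * g i = (i == j)%:R.
  by rewrite addrC eq_sym; exact: dual_basis.
have wv w : rho (diag_map w) * v = ev Omega0_even (theta ztop zdeg (fun r => (detpolyC x)`_r)
        (conv (zser l0 x q z) (fun r => (detpolyC x)`_r))) w *: v.
  move: w; set chi := ev _ _.
  apply: (presented_ind (P := [set w | rho (diag_map w) * v = chi w *: v])) => [|y] /=.
    split=> [||w w' /= wv wv'] /=; last first.
    - by rewrite !rmorphM /= -mulrA wv' -scalerAr wv scalerA mulrC.
    - by rewrite !rmorph1 mul1r scale1r.
    split=> [|c w w' /= wv wv'] /=; first by rewrite !raddf0 mul0r scale0r.
    by rewrite !linearP /= mulrDl -scalerAl wv wv' scalerDl scalerA.
  rewrite diag_mapE evE /ydiag /theta; case: ifP => [/eqP y0|/negbT/ord2 y1].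
    by rewrite y0 rho0 /D0 model_d0_vacuum.
  by rewrite y1 rho1 /D1 model_d1_vacuum.
have rho_f S : rho (fmon S) = ordmon f (rev (enum 'I_k)) S.
  by rewrite /fmon rmorph_ordmon; apply: eq_bigr => i _; rewrite rhoF NfE.
have rho_e J : rho (emon J) = ordmon e (enum 'I_k) J.
  by rewrite /emon rmorph_ordmon; apply: eq_bigr => i _; rewrite rhoE MeE.
apply: (@clifford_indep C _ _ g f e h v gf eh (fun=> lincomb_v _) (fun=> lincomb_v _) v0
  (fun S J => rho (diag_map (u S J))) (fun S J => ev Omega0_even _ (u S J)) J0) => [S J|J JJ0 S|].
- exact: wv.
- by rewrite lt0 // !raddf0.
have := congr1 rho sum0; rewrite raddf0 raddf_sum => sum1.
rewrite -[RHS]sum1; apply: eq_bigr => S _; rewrite /= raddf_sum; apply: eq_bigr => J _.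
by rewrite /= !rmorphM /= rho_f rho_e.
Qed.

End DrinfeldGenerators.

(** * The parity automorphism of the enveloping algebra *)

Section Gradings.
Context {C : fieldType} {A : algType C} (G : bool -> set A).

Lemma gen_grading_gen p x : G p x -> gen_grading G p x.
Proof.
move=> Gx; rewrite -[x]mulr1 -[p]addbF; apply: sub_lspan.
by apply: HomogMul => //; exact: HomogOne.
Qed.

Lemma gen_grading1 : gen_grading G false 1.
Proof. by apply: sub_lspan; exact: HomogOne. Qed.

Lemma homog_prodM p q x y :
  homog_prod G p x -> homog_prod G q y -> homog_prod G (p (+) q) (x * y).
Proof.
elim=> [|p' q' x' y' Gx _ IH] Hy; first by rewrite mul1r.
by rewrite -mulrA -addbA; apply: HomogMul => //; exact: IH.
Qed.

Lemma gen_gradingM p q x y :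
  gen_grading G p x -> gen_grading G q y -> gen_grading G (p (+) q) (x * y).
Proof.
have HM := lspan_submod (homog_prod G (p (+) q)).
move=> + gy; move: x; apply: (lspan_sub (submod_mulr y HM)) => x Hx.
move: y gy; apply: (lspan_sub (submod_mull x HM)) => y Hy.
by apply: sub_lspan; exact: homog_prodM.
Qed.

End Gradings.

Lemma scaler_mulAA (C : fieldType) (A : algType C) (a b : C) (x y : A) :
  (a *: x) * (b *: y) = (a * b) *: (x * y).
Proof. by rewrite -scalerAl -scalerAr scalerA. Qed.

Section ParityAutomorphism.
Context {C : fieldType} {N : nat} (par : 'I_N -> bool).
Local Notation iota := (@Defs.iota C N par).

(** Conjugation by the diagonal matrix of the signs [(-1) ^+ par i]. *)
Definition mx_parity (x : 'M[C]_N) : 'M[C]_N :=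
  \matrix_(i, j) ((-1) ^+ (par i (+) par j) * x i j).

Lemma mx_parityP a x y : mx_parity (a *: x + y) = a *: mx_parity x + mx_parity y.
Proof. by apply/matrixP => i j; rewrite !mxE; ring. Qed.

Lemma mx_parityM x y : mx_parity (x *m y) = mx_parity x *m mx_parity y.
Proof.
apply/matrixP => i j; rewrite !mxE mulr_sumr; apply: eq_bigr => h _.
rewrite !mxE mulrACA -signr_addb; congr ((-1) ^+ (nat_of_bool _) * _).
by case: (par i); case: (par h); case: (par j).
Qed.

Lemma mx_parity_homog p (x : 'M[C]_N) : mx_homog par p x -> mx_parity x = (-1) ^+ p *: x.
Proof.
move=> xp; apply/matrixP => i j; rewrite !mxE.
by have [->|/xp ->] := eqVneq (x i j) 0; rewrite ?mulr0.
Qed.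

Lemma mx_homogZ p a (x : 'M[C]_N) : mx_homog par p x -> mx_homog par p (a *: x).
Proof. by move=> xp i j; rewrite mxE mulf_eq0 negb_or => /andP[_ /xp]. Qed.

Lemma mx_parity_supercomm p q (x y : 'M[C]_N) :
  mx_parity (supercomm p q x y) = supercomm p q (mx_parity x) (mx_parity y).
Proof.
rewrite /supercomm; have sgnE (z : 'M[C]_N) : (-1) ^+ (p && q) * z = (-1) ^+ (p && q) *: z.
  by case: (p && q); rewrite ?expr0 ?mul1r ?scale1r // expr1 mulN1r scaleN1r.
rewrite !sgnE addrC -scaleNr mx_parityP addrC scaleNr; congr (_ - _ *: _);
  exact: mx_parityM.
Qed.

Lemma iotaP a (x y : 'M[C]_N) : iota (a *: x + y) = a *: iota x + iota y.
Proof.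
have rel := @ppi_rel C _ (gl_relations par) _ (@GlLinear C N par a x y).
rewrite raddfB /= in rel; move/eqP: rel; rewrite subr_eq0 => /eqP rel.
apply: (etrans rel); exact: (linearP (@ppi C _ (gl_relations par))).
Qed.

Lemma iotaZ a (x : 'M[C]_N) : iota (a *: x) = a *: iota x.
Proof.
have iota0 : iota 0 = 0.
  by have := iotaP (-1) 0 0; rewrite scaler0 addr0 scaleN1r addNr.
by have := iotaP a x 0; rewrite addr0 iota0 addr0.
Qed.

Lemma iota_supercomm p q (x y : 'M[C]_N) : mx_homog par p x -> mx_homog par q y ->
  supercomm p q (iota x) (iota y) = iota (supercomm p q x y).
Proof.
move=> xp yq; have rel := @ppi_rel C _ (gl_relations par) _ (GlBracket xp yq).
rewrite raddfB /= in rel; move/eqP: rel; rewrite subr_eq0 => /eqP rel.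
apply: etrans rel; apply/esym.
exact: (rmorph_supercomm (@ppi C _ (gl_relations par))).
Qed.

(** The automorphism acting by [(-1) ^+ p] on elements of parity [p]: it is what
    makes the even and the odd part of the enveloping algebra meet trivially. *)
Lemma parity_automorphism :
  {th : {lrmorphism @Ugl C N par -> @Ugl C N par} |
    forall p y, @Ugl_grading C N par p y -> th y = (-1) ^+ p *: y}.
Proof.
pose g x := iota (mx_parity x).
have [u [a x y|p q x y xp yq]|th thE] := @presented_lift C _ (gl_relations par) _ g.
- rewrite raddfB raddfD /= !falg_lift_gen linearZ /= falg_lift_gen.
  by rewrite /g mx_parityP iotaP subrr.
- have E : falg_lift g (supercomm p q (fgen x) (fgen y)) = supercomm p q (g x) (g y).
    by apply: (etrans (rmorph_supercomm (falg_lift g) _ _ _ _)); rewrite /= !falg_lift_gen.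
  rewrite raddfB /= E falg_lift_gen /g mx_parity_supercomm iota_supercomm ?subrr //.
    by rewrite (mx_parity_homog xp); exact: mx_homogZ.
  by rewrite (mx_parity_homog yq); exact: mx_homogZ.
exists th => p.
apply: (@lspan_sub _ _ _ [set y | th y = (-1) ^+ p *: y]) => [|y Hy].
  split=> [|a u v /= tu tv]; first by rewrite /= raddf0 scaler0.
  by rewrite linearP /= tu tv scalerDr !scalerA mulrC.
elim: Hy => {p y} [|p q x y [m mp <-] _ IH] /=; first by rewrite rmorph1 scale1r.
rewrite rmorphM /= IH.
have -> : th (iota m) = (-1) ^+ p *: iota m.
  rewrite /Defs.iota [LHS]thE falg_lift_gen /g (mx_parity_homog mp).
  exact: iotaZ.
rewrite signr_addb; exact: scaler_mulAA.
Qed.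

End ParityAutomorphism.

(** * Free odd superalgebras and retractions *)

Section FreeOdd.
Context {C : fieldType} {A : algType C} (gr : bool -> set A).
Variables (X : choiceType) (par : X -> bool) (g : X -> A) (k : nat) (idx : 'I_k -> X).
Hypothesis C2 : 2%:R != 0 :> C.
Hypothesis odd_gens : forall x, par x = true.
Hypothesis idx_onto : forall x, exists i, x = idx i.
Hypothesis gC : forall x y, g x * g y + g y * g x = 0.
Hypothesis gr_alg : forall p q x y, gr p x -> gr q y -> gr (p (+) q) (x * y).
Hypothesis gr_sub : forall p, is_submod (gr p).
Hypothesis gr1 : gr false 1.
Hypothesis gr_gen : forall x, gr (par x) (g x).

Lemma even_map_presented (R : relations C X) (h : {lrmorphism presented R -> A}) :
  (forall x, h (pgen R x) = g x) ->
  forall p y, presented_grading R par p y -> gr p (h y).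
Proof.
move=> hg p; have [g0 gD] := gr_sub p.
apply: (@lspan_sub _ _ _ [set y | gr p (h y)]) => [|y Hy].
  split=> [|a u v Hu Hv] /=; first by rewrite raddf0.
  by rewrite linearP; exact: gD.
elim: Hy => {p g0 gD y} [|p q _ y [x /= <- <-] _ IH] /=; first by rewrite rmorph1.
rewrite rmorphM; apply: gr_alg => //.
by have := gr_gen x; rewrite -hg.
Qed.

(** Ordered monomials span the free superalgebra on odd generators, hence it
    embeds as soon as they stay independent. *)
Lemma free_odd (r : seq 'I_k) : uniq r -> (forall i, i \in r) ->
  (forall a : {set 'I_k} -> C,
     \sum_(S : {set 'I_k}) a S *: ordmon (g \o idx) r S = 0 -> forall S, a S = 0) ->
  free_supercommutative_on gr (subalg_gen (range g)) par g.
Proof.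
move=> ur rI mon_free.
have [x y|h hE] := @supercomm_gen_lift C X par A g.
  by rewrite !odd_gens supercomm11 gC.
have Wh u : subalg_set (subalg_gen (range g)) (h u).
  move: u; apply: presented_ind.
    exact: (subalg_preimage h (subalg_setP (subalg_gen (range g)))).
  by move=> x; rewrite /= hE; apply: sub_subalg_gen; exists x.
have [phi phiE] := corestrict Wh.
exists phi; split.
- move=> p y py; rewrite /sub_grading /= phiE; exact: even_map_presented py.
- pose y i := pgen (supercomm_relations C par) (idx i).
  have yC i j : y i * y j + y j * y i = 0.
    have rel : supercomm_rel par (supercomm (par (idx i)) (par (idx j)) (fgen (idx i)) (fgen (idx j)) : free_alg C X).
      exact: SupercommRel.
    have := @ppi_rel C X (supercomm_relations C par) _ rel.
    rewrite !odd_gens => e; rewrite -supercomm11; apply: etrans e; apply/esym.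
    exact: (rmorph_supercomm (@ppi C X (supercomm_relations C par))).
  have span u : exists a : {set 'I_k} -> C, u = \sum_S a S *: ordmon y r S.
    apply: lspan_range; apply: (ordmon_span C2 yC ur rI).
    move: u; apply: presented_ind; first exact: subalg_setP.
    by move=> x; apply: sub_subalg_gen; have [i ->] := idx_onto x; exists i.
  have hmon S : h (ordmon y r S) = ordmon (g \o idx) r S.
    rewrite /ordmon rmorph_prod; apply: eq_bigr => i _; exact: hE.
  have hsum (a : {set 'I_k} -> C) :
      h (\sum_S a S *: ordmon y r S) = \sum_S a S *: ordmon (g \o idx) r S.
    rewrite raddf_sum; apply: eq_bigr => S _; by rewrite /= linearZ /= hmon.
  apply: bij_of_inj_surj => [u v uv|w].
    apply/eqP; rewrite -subr_eq0; apply/eqP; have [a aE] := span (u - v).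
    have h0 : h (u - v) = 0 by rewrite raddfB /= -!phiE uv subrr.
    rewrite aE; apply: big1 => S _; rewrite (mon_free a) ?scale0r //.
    by rewrite -hsum -aE.
  suff [u uE] : exists u, h u = incl w by exists u; apply: incl_inj; rewrite phiE.
  move: (incl w) (incl_mem w); apply: subalg_gen_sub => [|_ [x _ <-]]; last by exists (pgen _ x).
  split=> [||_ _ [u <-] [v <-]].
  - split=> [|a _ _ [u <-] [v <-]]; first by exists 0; rewrite raddf0.
    by exists (a *: u + v); rewrite linearP.
  - by exists 1; rewrite rmorph1.
  - by exists (u * v); rewrite rmorphM.
- by move=> x; rewrite phiE hE.
Qed.

End FreeOdd.

Section Projection.
Context {C : fieldType} {A : algType C} (V Z : subalgebra A) (K : set A).
Hypothesis HK : is_submod K.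
Hypothesis VZ : forall x, subalg_set V x -> exists2 z, subalg_set Z z & K (x - z).
Hypothesis Kl : forall x y, subalg_set V x -> K y -> K (x * y).
Hypothesis Kr : forall x y, subalg_set V x -> K y -> K (y * x).
Hypothesis ZV : forall z, subalg_set Z z -> subalg_set V z.
Hypothesis ZK : forall z, subalg_set Z z -> K z -> z = 0.

(** A complement of a subalgebra that is an ideal defines a retraction onto it. *)
Lemma projection_of :
  {phi : {lrmorphism V -> Z} | forall x z, phi x = z <-> K (incl x - incl z)}.
Proof.
have ex (x : V) : exists z : Z, K (incl x - incl z).
  have [z Zz Kz] := VZ (incl_mem x).
  by exists (mkincl Zz); rewrite mkinclK.
have [f fK] := choice ex.
have fE x z : K (incl x - incl z) -> f x = z.
  move=> Kz; apply/eqP; rewrite -subr_eq0; apply/eqP/incl_inj; rewrite raddf0.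
  apply: ZK; first exact: incl_mem.
  rewrite raddfB /= (_ : _ - _ = (incl x - incl z) - (incl x - incl (f x))).
    exact: submodB.
  by rewrite opprB [RHS]addrC addrA subrK.
have [|phi phiE] := @lrmorphism_of C V Z f.
  split=> [a x y||x y]; apply: fE.
  - have iL (U : subalgebra A) b (p q : U) : incl (b *: p + q) = b *: incl p + incl q.
      exact: linearP.
    rewrite !iL opprD addrACA -scalerBr; apply: HK.2; exact: fK.
  - by rewrite !rmorph1 subrr; case: HK.
  - rewrite !rmorphM /= (_ : _ - _ = incl x * (incl y - incl (f y))
        + (incl x - incl (f x)) * incl (f y)).
      apply: submodD => //; first by apply: Kl => //; exact: incl_mem.
      by apply: Kr => //; apply: ZV; exact: incl_mem.
    by rewrite mulrBr mulrBl addrA subrK.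
by exists phi => x z; split=> [<-|/fE <-]; rewrite phiE.
Qed.

End Projection.

(** * Triangular decomposition of an image of the shifted Yangian *)

Lemma yangian_family_map (C : fieldType) (A B : algType C) (h : {lrmorphism A -> B})
    k l0 eps dt D0 D1 E F :
  yangian_family k l0 eps dt D0 D1 E F ->
  yangian_family k l0 eps (h \o dt) (h \o D0) (h \o D1) (h \o E) (h \o F).
Proof.
have hsum c (n : nat) (f : nat -> A) (g : nat -> A) :
    h (c *: \sum_(a < n) f a * g a) = c *: \sum_(a < n) h (f a) * h (g a).
  rewrite linearZ raddf_sum /=; congr (_ *: _); apply: eq_bigr => a _.
  by rewrite rmorphM.
have hconv u v n : h (conv u v n) = conv (h \o u) (h \o v) n.
  by rewrite raddf_sum; apply: eq_bigr => a _; rewrite /= rmorphM.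
case=> D00 D10 lev D0C D01C D1C EE FF D0E D1E D0F D1F EF dtP.
split=> /= [||r kr|r t|r t|r t|i j|i j|r j|r j|r j|r j|i j|r].
- by rewrite D00 rmorph1.
- by rewrite D10 rmorph1.
- by rewrite lev ?raddf0.
- by rewrite -!rmorphM D0C.
- by rewrite -!rmorphM D01C.
- by rewrite -!rmorphM D1C.
- by rewrite -!rmorphM -raddfD EE raddf0.
- by rewrite -!rmorphM -raddfD FF raddf0.
- rewrite -!rmorphM -raddfB D0E; exact: (hsum _ _ _ (fun a => E (j + (r - 1 - a))%N)).
- rewrite -!rmorphM -raddfB D1E; exact: (hsum _ _ _ (fun a => E (j + (r - 1 - a))%N)).
- rewrite -!rmorphM -raddfB D0F raddfN; congr (- _); exact: (hsum _ _ (fun a => F (j + (r - 1 - a))%N) _).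
- rewrite -!rmorphM -raddfB D1F raddfN; congr (- _); exact: (hsum _ _ (fun a => F (j + (r - 1 - a))%N) _).
- by rewrite -!rmorphM -raddfD EF /= linearZ /= hconv.
- by rewrite -hconv dtP; case: (r == 0%N); rewrite ?rmorph1 ?raddf0.
Qed.

Section Assembly.
Context {C : numClosedFieldType}.
Variables (par : 'I_2 -> bool) (py : pyramid) (s : 'M[nat]_2).
Hypothesis shift : is_shift_matrix s.
Hypothesis compat : compatible s py.
Local Notation k := (pyr_k py).
Local Notation l0 := (s12 s + s21 s)%N.
Local Notation eps := ((-1) ^+ par 0 : C).
Local Notation R := (yangian_relations C par s k).
Context {A : algType C}.
Variables (gr : bool -> set A) (dr : dindex -> A) (W : subalgebra A).
Variable Phi : {lrmorphism presented R -> A}.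
Hypothesis Phi_inj : forall y, Phi y = 0 -> y = 0.
Hypothesis PhiE : forall x, Phi (pgen R x) = dr (val x).
Hypothesis WPhi : forall x, subalg_set W x <-> exists y, Phi y = x.
Hypothesis gr_alg : forall p q x y, gr p x -> gr q y -> gr (p (+) q) (x * y).
Hypothesis gr_sub : forall p, is_submod (gr p).
Hypothesis gr1 : gr false 1.
Hypothesis gr_gen : forall x : ygen s, gr (dparity par (val x)) (dr (val x)).
Variable th : {lrmorphism A -> A}.
Hypothesis thE : forall p y, gr p y -> th y = (-1) ^+ p *: y.

Let C2 : 2%:R != 0 :> C.
Proof. by rewrite pnatr_eq0. Qed.
Let eps0 : eps != 0.
Proof. by rewrite signr_eq0. Qed.

Let D0 r := Phi (pres_d par s k 0 r).
Let D1 r := Phi (pres_d par s k 1 r).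
Let E j := Phi (pres_e par s k j).
Let F j := Phi (pres_f par s k j).

Lemma image_family : exists dt, yangian_family k l0 eps dt D0 D1 E F.
Proof.
by have [dt Y] := @presented_family C par s k; exists (Phi \o dt); exact: yangian_family_map Y.
Qed.

Lemma Phi_yelt i j r : (s i j < r)%N -> Phi (ppi R (yelt C s i j r)) = dr (i, j, r).
Proof. by move=> sr; rewrite /yelt; case: insubP => [u _ uE|/negP//]; rewrite PhiE uE. Qed.

Lemma dr_d i r : (0 < r)%N -> dr (i, i, r) = Phi (pres_d par s k i r).
Proof.
by move=> r0; rewrite /pres_d /yd (gtn_eqF r0) Phi_yelt ?shift_diag.
Qed.
Lemma dr_e j : dr (0, 1, (s12 s + j).+1) = E j.
Proof. by rewrite -Phi_yelt ?ltnS ?leq_addr. Qed.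
Lemma dr_f j : dr (1, 0, (s21 s + j).+1) = F j.
Proof. by rewrite -Phi_yelt ?ltnS ?leq_addr. Qed.

Definition gens (Om : pred dindex) : set A := [set dr x | x in [set x | Om x]].
Local Notation gen S := (subalg_set (subalg_gen S)).
Local Notation SD := (dgens k l0 D0 D1).
Local Notation SE := (egens k E).
Local Notation SF := (fgens k F).

Lemma gens0 : gens (Omega0 py) = SD.
Proof.
apply/seteqP; split=> [_ [[[i j] r] Ox <-]|y].
  have /andP[/eqP /= ij /andP[/= r0 rl]] : Omega0 py (i, j, r) := Ox.
  rewrite -ij dr_d //; have [i0|/ord2 i1] := eqVneq i 0.
    by left; exists r; rewrite ?i0 // r0; move: rl; rewrite /row_size /= i0.
  right; exists r; rewrite ?i1 // r0 -(pyr_lE compat); move: rl.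
  by rewrite /row_size /= i1.
move=> [] [r /andP[r0 rk] ->].
  by exists (0, 0, r); rewrite ?dr_d //= /Omega0 /= r0.
by exists (1, 1, r); rewrite ?dr_d //= /Omega0 /= r0 /row_size /= (pyr_lE compat).
Qed.

Lemma gensP : gens (OmegaP py s) = SE.
Proof.
apply/seteqP; split=> [_ [[ij r] Ox <-]|_ [i _ <-]].
  have /andP[/eqP /= -> /andP[/= r0 rl]] : OmegaP py s (ij, r) := Ox.
  have rk : (r - (s12 s).+1 < k)%N by lia.
  by exists (Ordinal rk) => //=; rewrite -dr_e; congr (dr (_, _)); lia.
have Oi : OmegaP py s (0, 1, (s12 s + i).+1).
  by apply/andP; split=> //=; have := ltn_ord i; lia.
by exists (0, 1, (s12 s + i).+1); rewrite ?dr_e.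
Qed.

Lemma gensN : gens (OmegaN py s) = SF.
Proof.
apply/seteqP; split=> [_ [[ij r] Ox <-]|_ [i _ <-]].
  have /andP[/eqP /= -> /andP[/= r0 rl]] : OmegaN py s (ij, r) := Ox.
  have rk : (r - (s21 s).+1 < k)%N by lia.
  by exists (Ordinal rk) => //=; rewrite -dr_f; congr (dr (_, _)); lia.
have Oi : OmegaN py s (1, 0, (s21 s + i).+1).
  by apply/andP; split=> //=; have := ltn_ord i; lia.
by exists (1, 0, (s21 s + i).+1); rewrite ?dr_f.
Qed.

Lemma gensU Om Om' : gens (predU Om Om') = gens Om `|` gens Om'.
Proof.
apply/seteqP; split=> [_ [x /= /orP[] Ox <-]|_ [] [x Ox <-]].
- by left; exists x.
- by right; exists x.
- by exists x => //=; apply/orP; left.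
- by exists x => //=; apply/orP; right.
Qed.

(** ** Independence *)

Local Notation Pol := (presented (supercomm_relations C
    (fun x : {x : dindex | Omega0 py x} => dparity par (val x)))).

Lemma diag_image_exists : {z : {lrmorphism Pol -> A} | forall u, z u = Phi (diag_map par py s u)}.
Proof. by exists (Phi \o diag_map par py s). Qed.
(** The diagonal polynomials inside the algebra containing the image of the
    shifted Yangian. *)
Definition diag_image : {lrmorphism Pol -> A} := sval diag_image_exists.
Lemma diag_image_def u : diag_image u = Phi (diag_map par py s u).
Proof. exact: (svalP diag_image_exists). Qed.

(** The monomials in the [F] use the reversed order, so that they pair with
    monomials in the dual operators in the order of the fermions. *)
Definition fm (S : {set 'I_k}) : A := ordmon (fun i : 'I_k => F i) (rev (enum 'I_k)) S.
Definition em (S : {set 'I_k}) : A := ordmon (fun i : 'I_k => E i) (enum 'I_k) S.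

Lemma diag_imageE x : diag_image (pgen _ x) = dr (val x).
Proof.
rewrite diag_image_def diag_mapE /ydiag -dr_d; last by have /andP[_ /andP[]] := valP x.
by rewrite [in RHS]Omega0_val.
Qed.

Lemma fm_image S : Phi (fmon par s S) = fm S.
Proof. exact: rmorph_ordmon. Qed.
Lemma em_image S : Phi (emon par s S) = em S.
Proof. exact: rmorph_ordmon. Qed.

Lemma triangular_indep u :
  \sum_(S : {set 'I_k}) \sum_(J : {set 'I_k}) fm S * diag_image (u S J) * em J = 0 ->
  forall S J, u S J = 0.
Proof.
move=> sum0; apply: (triangular_free shift compat); apply: Phi_inj.
rewrite raddf_sum -[RHS]sum0; apply: eq_bigr => S _.
rewrite /= raddf_sum; apply: eq_bigr => J _.
by rewrite /= !rmorphM /= fm_image em_image diag_image_def.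
Qed.

Lemma fm0 : fm finset.set0 = 1. Proof. exact: ordmon0. Qed.
Lemma em0 : em finset.set0 = 1. Proof. exact: ordmon0. Qed.

Lemma triangular_indep_l (u : {set 'I_k} -> _) :
  \sum_(S : {set 'I_k}) fm S * diag_image (u S) = 0 -> forall S, u S = 0.
Proof.
move=> sum0 S.
have H := @triangular_indep (fun S J => if J == finset.set0 then u S else 0) _ S finset.set0.
rewrite eqxx in H; apply: H; rewrite -[RHS]sum0; apply: eq_bigr => T _.
rewrite (bigD1 finset.set0) //= eqxx em0 mulr1 big1 ?addr0 // => J /negPf ->.
by rewrite (raddf0 diag_image) mulr0 mul0r.
Qed.

Lemma triangular_indep_r (u : {set 'I_k} -> _) :
  \sum_(J : {set 'I_k}) diag_image (u J) * em J = 0 -> forall J, u J = 0.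
Proof.
move=> sum0 J.
have H := @triangular_indep (fun S J => if S == finset.set0 then u J else 0) _ finset.set0 J.
rewrite eqxx in H; apply: H; rewrite -[RHS]sum0.
rewrite (bigD1 finset.set0) //= [X in _ + X]big1 => [|S /negPf S0].
  by rewrite addr0; apply: eq_bigr => T _; rewrite eqxx fm0 mul1r.
by rewrite big1 // => T _; rewrite S0 (raddf0 diag_image) mulr0 mul0r.
Qed.

Lemma diag_image_inj u : diag_image u = 0 -> u = 0.
Proof.
move=> u0; have H := @triangular_indep_r (fun J => if J == finset.set0 then u else 0) _ finset.set0.
rewrite eqxx in H; apply: H.
rewrite (bigD1 finset.set0) //= eqxx em0 mulr1 u0 add0r big1 // => J /negPf ->.
by rewrite (raddf0 diag_image) mul0r.
Qed.

Lemma Z_image x : gen SD x <-> exists u, diag_image u = x.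
Proof.
split=> [|[u <-]].
  move: x; apply: subalg_gen_sub => [|y]; last first.
    by rewrite -gens0 => -[x Ox <-]; exists (pgen _ (exist _ x Ox)); rewrite diag_imageE.
  split=> [||_ _ [u <-] [v <-]].
  - split=> [|a _ _ [u <-] [v <-]]; first by exists 0; rewrite raddf0.
    by exists (a *: u + v); rewrite linearP.
  - by exists 1; rewrite rmorph1.
  - by exists (u * v); rewrite rmorphM.
move: u; apply: presented_ind => [|y].
  exact: (subalg_preimage diag_image (subalg_setP _)).
rewrite /= diag_imageE; apply: sub_subalg_gen; rewrite -gens0.
by exists (val y) => //; exact: valP y.
Qed.

Lemma E_anti i j : E i * E j + E j * E i = 0.
Proof. by have [dt Y] := image_family; exact: yf_EE Y _ _. Qed.
Lemma F_anti i j : F i * F j + F j * F i = 0.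
Proof. by have [dt Y] := image_family; exact: yf_FF Y _ _. Qed.

Lemma fm_span x : gen SF x -> exists a : {set 'I_k} -> C, x = \sum_S a S *: fm S.
Proof.
move=> SFx; apply: lspan_range.
apply: (ordmon_span C2 (fun i j : 'I_k => F_anti i j)) SFx.
  by rewrite rev_uniq enum_uniq.
by move=> i; rewrite mem_rev mem_enum.
Qed.
Lemma em_span x : gen SE x -> exists a : {set 'I_k} -> C, x = \sum_S a S *: em S.
Proof.
move=> SEx; apply: lspan_range.
apply: (ordmon_span C2 (fun i j : 'I_k => E_anti i j)) SEx.
  exact: enum_uniq.
by move=> i; rewrite mem_enum.
Qed.

Lemma gen_prod (S : set A) (y : 'I_k -> A) r T :
  (forall i, S (y i)) -> gen S (ordmon y r T).
Proof.
move=> Sy; apply: (big_ind (gen S)).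
- exact: subalg1 (subalg_setP _).
- by move=> u v; exact: subalgM (subalg_setP _).
- by move=> i _; exact: sub_subalg_gen.
Qed.

(** ** The three free superalgebras *)

Local Notation free_on Om := (free_supercommutative_on gr (subalg_gen (gens Om))
  (fun x : {x : dindex | Om x} => dparity par (val x)) (fun x => dr (val x))).

Lemma Omega_ygen (x : dindex) :
  Omega0 py x || OmegaP py s x || OmegaN py s x -> (s x.1.1 x.1.2 < x.2)%N.
Proof.
case: x => [[i j] r] /orP[/orP[]|] /andP[/eqP /=].
- by move=> -> /andP[r0 _]; rewrite shift_diag.
- by move=> [-> ->] /andP[].
- by move=> [-> ->] /andP[].
Qed.

Lemma gr_gen_Omega (Om : pred dindex) (x : {x : dindex | Om x}) :
  (forall x, Om x -> (s x.1.1 x.1.2 < x.2)%N) ->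
  gr (dparity par (val x)) (dr (val x)).
Proof. by move=> H; exact: (gr_gen (exist _ (val x) (H _ (valP x)))). Qed.

Lemma free_Omega0 : free_on (Omega0 py).
Proof.
have zW u : subalg_set (subalg_gen (gens (Omega0 py))) (diag_image u).
  by rewrite gens0; apply/Z_image; exists u.
have [phi phiE] := corestrict zW; exists phi; split.
- move=> p y py_; rewrite /sub_grading /= phiE; move: p y py_.
  apply: (even_map_presented (g := fun x : {x : dindex | Omega0 py x} => dr (val x))) => //.
    by move=> x; apply: gr_gen_Omega => y Oy; apply: Omega_ygen; rewrite Oy.
  exact: diag_imageE.
- apply: bij_of_inj_surj => [u v uv|w].
    apply/eqP; rewrite -subr_eq0; apply/eqP/diag_image_inj.
    by rewrite raddfB /= -!phiE uv subrr.
  have := incl_mem w; rewrite [X in subalg_set (subalg_gen X)]gens0 => /Z_image[u uE].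
  by exists u; apply: incl_inj; rewrite phiE.
- by move=> x; rewrite phiE diag_imageE.
Qed.

Lemma gens_range (Om : pred dindex) :
  gens Om = range (fun x : {x : dindex | Om x} => dr (val x)).
Proof.
apply/seteqP; split=> [_ [x Ox <-]|_ [x _ <-]].
  by exists (exist _ x Ox).
by exists (val x) => //; exact: valP.
Qed.

Hypothesis par01 : par 0 != par 1.

Lemma free_OmegaP : free_on (OmegaP py s).
Proof.
have Oi (i : 'I_k) : OmegaP py s (0, 1, (s12 s + i).+1).
  by apply/andP; split=> //=; have := ltn_ord i; lia.
have onto (x : {x : dindex | OmegaP py s x}) :
    exists i, x = exist (fun x => OmegaP py s x) _ (Oi i).
  have := valP x; case xE: (val x) => [ij r] /andP[/eqP /= ijE /andP[/= r0 rl]].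
  have rk : (r - (s12 s).+1 < k)%N by lia.
  exists (Ordinal rk); apply: val_inj; rewrite xE ijE /=; congr (_, _, _); lia.
rewrite gens_range; apply: (@free_odd C A gr _ (fun x : {x : dindex | OmegaP py s x} => dparity par (val x))
  (fun x => dr (val x)) k _ C2 _ onto _ _ _ _ _ (enum 'I_k)) => //.
- move=> x; have /andP[/eqP xE _] := valP x.
  by rewrite /dparity xE /= -[LHS]negbK negb_add; apply: contra_neqN par01 => /eqP.
- move=> x y; have [i ->] := onto x; have [j ->] := onto y.
  by rewrite !dr_e E_anti.
- by move=> x; apply: gr_gen_Omega => y Oy; apply: Omega_ygen; rewrite Oy orbT.
- exact: enum_uniq.
- by move=> i; rewrite mem_enum.
move=> a sum0 S; have H := @triangular_indep_r (fun J => (a J)%:A) _ S.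
have : (a S)%:A = 0 :> Pol.
  apply: H; rewrite -[RHS]sum0; apply: eq_bigr => J _.
  rewrite linearZ /= rmorph1 -scalerAl mul1r; congr (_ *: _).
  by apply: eq_bigr => i _; rewrite /= dr_e.
by move/eqP; rewrite scaler_eq0 oner_eq0 orbF => /eqP.
Qed.

Lemma free_OmegaN : free_on (OmegaN py s).
Proof.
have Oi (i : 'I_k) : OmegaN py s (1, 0, (s21 s + i).+1).
  by apply/andP; split=> //=; have := ltn_ord i; lia.
have onto (x : {x : dindex | OmegaN py s x}) :
    exists i, x = exist (fun x => OmegaN py s x) _ (Oi i).
  have := valP x; case xE: (val x) => [ij r] /andP[/eqP /= ijE /andP[/= r0 rl]].
  have rk : (r - (s21 s).+1 < k)%N by lia.
  exists (Ordinal rk); apply: val_inj; rewrite xE ijE /=; congr (_, _, _); lia.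
rewrite gens_range; apply: (@free_odd C A gr _ (fun x : {x : dindex | OmegaN py s x} => dparity par (val x))
  (fun x => dr (val x)) k _ C2 _ onto _ _ _ _ _ (rev (enum 'I_k))) => //.
- move=> x; have /andP[/eqP xE _] := valP x.
  by rewrite /dparity xE /= -[LHS]negbK negb_add; apply: contra_neqN par01 => /eqP.
- move=> x y; have [i ->] := onto x; have [j ->] := onto y.
  by rewrite !dr_f F_anti.
- by move=> x; apply: gr_gen_Omega => y Oy; apply: Omega_ygen; rewrite Oy !orbT.
- by rewrite rev_uniq enum_uniq.
- by move=> i; rewrite mem_rev mem_enum.
move=> a sum0 S; have H := @triangular_indep_l (fun J => (a J)%:A) _ S.
have : (a S)%:A = 0 :> Pol.
  apply: H; rewrite -[RHS]sum0; apply: eq_bigr => J _.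
  rewrite linearZ /= rmorph1 -scalerAr mulr1; congr (_ *: _).
  by apply: eq_bigr => i _; rewrite /= dr_f.
by move/eqP; rewrite scaler_eq0 oner_eq0 orbF => /eqP.
Qed.

(** ** Triangular decompositions *)

Local Notation SH := (gen (SD `|` SE)).
Local Notation FL := (gen (SF `|` SD)).
Local Notation WN_ := (subalg_gen (gens (OmegaN py s))).
Local Notation W0_ := (subalg_gen (gens (Omega0 py))).
Local Notation WP_ := (subalg_gen (gens (OmegaP py s))).
Local Notation Wsharp_ := (subalg_gen (gens (predU (Omega0 py) (OmegaP py s)))).
Local Notation Wflat_ := (subalg_gen (gens (predU (OmegaN py s) (Omega0 py)))).

Lemma sharpE : subalg_set Wsharp_ = SH.
Proof. by rewrite gensU gens0 gensP. Qed.
Lemma flatE : subalg_set Wflat_ = FL.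
Proof. by rewrite gensU gens0 gensN. Qed.
Lemma W0E : subalg_set W0_ = gen SD. Proof. by rewrite gens0. Qed.
Lemma W0_iff z : subalg_set W0_ z <-> gen SD z. Proof. by rewrite W0E. Qed.
Lemma WPE : subalg_set WP_ = gen SE. Proof. by rewrite gensP. Qed.
Lemma WNE : subalg_set WN_ = gen SF. Proof. by rewrite gensN. Qed.

Lemma ygen_cases (x : ygen s) :
  [\/ exists r, dr (val x) = D0 r, exists r, dr (val x) = D1 r,
      exists j, dr (val x) = E j | exists j, dr (val x) = F j].
Proof.
have := valP x; case: (val x) => [[i j] r] /= sr.
have [i0|/ord2 i1] := eqVneq i 0; have [j0|/ord2 j1] := eqVneq j 0; subst i j.
- by apply: Or41; exists r; rewrite dr_d // -(shift_diag shift 0).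
- by apply: Or43; exists (r - (s12 s).+1)%N; rewrite -dr_e -addSn subnKC.
- by apply: Or44; exists (r - (s21 s).+1)%N; rewrite -dr_f -addSn subnKC.
- by apply: Or42; exists r; rewrite dr_d // -(shift_diag shift 1).
Qed.

Lemma W_triang x : subalg_set W x -> mulspan (gen SF) SH x.
Proof.
case/WPhi => y <-; have [dt Y] := image_family.
apply: (triangular_span eps0 Y (S := range (fun x : ygen s => dr (val x)))).
  move=> _ [z _ <-]; exact: ygen_cases.
move: y; apply: presented_ind => [|z]; first exact: (subalg_preimage Phi (subalg_setP _)).
by rewrite /= PhiE; apply: sub_subalg_gen; exists z.
Qed.

Lemma gen_sub_W (S : set A) : (forall x, S x -> exists y, Phi y = x) ->
  forall x, gen S x -> subalg_set W x.
Proof. by move=> H; apply: subalg_gen_sub => [|x /H/WPhi//]; exact: subalg_setP. Qed.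

Lemma SD_W x : gen SD x -> subalg_set W x.
Proof. by case/Z_image => u <-; apply/WPhi; exists (diag_map par py s u); rewrite diag_image_def. Qed.
Lemma SE_W x : gen SE x -> subalg_set W x.
Proof. by apply: gen_sub_W => _ [i _ <-]; exists (pres_e par s k i). Qed.
Lemma SF_W x : gen SF x -> subalg_set W x.
Proof. by apply: gen_sub_W => _ [i _ <-]; exists (pres_f par s k i). Qed.

Lemma em_mem J : subalg_set WP_ (em J).
Proof. by rewrite WPE; apply: gen_prod => i; exists i. Qed.
Lemma fm_mem S : subalg_set WN_ (fm S).
Proof. by rewrite WNE; apply: gen_prod => i; exists i. Qed.
Definition em_sub J : WP_ := mkincl (em_mem J).
Definition fm_sub S : WN_ := mkincl (fm_mem S).

Lemma em_subE J : incl (em_sub J) = em J. Proof. exact: mkinclK. Qed.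
Lemma fm_subE S : incl (fm_sub S) = fm S. Proof. exact: mkinclK. Qed.

Lemma em_sub_span (w : WP_) : exists a, w = \sum_J a J *: em_sub J.
Proof.
have := incl_mem w; rewrite [X in X _]WPE => /em_span[a aE]; exists a; apply: incl_inj.
rewrite aE raddf_sum; apply: eq_bigr => J _.
by rewrite /= linearZ /= em_subE.
Qed.
Lemma fm_sub_span (w : WN_) : exists a, w = \sum_S a S *: fm_sub S.
Proof.
have := incl_mem w; rewrite [X in X _]WNE => /fm_span[a aE]; exists a; apply: incl_inj.
rewrite aE raddf_sum; apply: eq_bigr => J _.
by rewrite /= linearZ /= fm_subE.
Qed.

Lemma zero_W0 (z : W0_) u : diag_image u = incl z -> u = 0 -> z = 0.
Proof. by move=> uz u0; apply: incl_inj; rewrite -uz u0 !raddf0. Qed.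

Lemma W0_lift (I : Type) (z : I -> W0_) : exists u, forall i, diag_image (u i) = incl (z i).
Proof.
have H i : exists u, diag_image u = incl (z i).
  by have := incl_mem (z i); rewrite [X in X _]W0E => /Z_image.
by have [u uE] := choice H; exists u.
Qed.

Lemma iso_sharp : @mult_iso C A W0_ WP_ Wsharp_ (@incl C A W0_).
Proof.
have [dt Y] := image_family.
apply: mult_iso_of => [z e|x|mu muE t].
- rewrite [X in X _]sharpE; apply: (subalgM (subalg_setP _)).
    have := incl_mem z; rewrite [X in X _]W0E; apply: gen_mono => y; by left.
  have := incl_mem e; rewrite [X in X _]WPE; apply: gen_mono => y; by right.
- rewrite [X in X _]sharpE => /(sharp_span eps0 Y).
  apply: mulspan_sub => [|z e Zz Pe]; first exact: lspan_submod.
  rewrite -[X in X _]W0E in Zz; rewrite -[X in X _]WPE in Pe.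
  by apply: sub_lspan; exists (mkincl Zz) => //; exists (mkincl Pe); rewrite ?mkinclK.
have [z ->] := tensor_expand_r em_sub_span t; have [u uE] := W0_lift z.
move=> mu0; apply: big1 => J _.
suff u0 : u J = 0 by rewrite (zero_W0 (uE J) u0) tens0l.
move: J; apply: triangular_indep_r; have := congr1 (@incl C A Wsharp_) mu0.
rewrite raddf0 raddf_sum /= raddf_sum => sum0; rewrite -[RHS]sum0.
by apply: eq_bigr => J _; rewrite /= muE /= uE em_subE.
Qed.

Lemma iso_flat : @mult_iso C A WN_ W0_ Wflat_ (@incl C A WN_).
Proof.
have [dt Y] := image_family.
apply: mult_iso_of => [f z|x|mu muE t].
- rewrite [X in X _]flatE; apply: (subalgM (subalg_setP _)).
    have := incl_mem f; rewrite [X in X _]WNE; apply: gen_mono => y; by left.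
  have := incl_mem z; rewrite [X in X _]W0E; apply: gen_mono => y; by right.
- rewrite [X in X _]flatE => /(flat_span eps0 Y).
  apply: mulspan_sub => [|f z Nf Zz]; first exact: lspan_submod.
  rewrite -[X in X _]W0E in Zz; rewrite -[X in X _]WNE in Nf.
  by apply: sub_lspan; exists (mkincl Nf) => //; exists (mkincl Zz); rewrite ?mkinclK.
have [z ->] := tensor_expand_l fm_sub_span t; have [u uE] := W0_lift z.
move=> mu0; apply: big1 => S _.
suff u0 : u S = 0 by rewrite (zero_W0 (uE S) u0) tens0r.
move: S; apply: triangular_indep_l; have := congr1 (@incl C A Wflat_) mu0.
rewrite raddf0 raddf_sum /= raddf_sum => sum0; rewrite -[RHS]sum0.
by apply: eq_bigr => S _; rewrite /= muE /= uE fm_subE.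
Qed.

(** The left tensor factor is mapped to the algebra through its own multiplication
    isomorphism; all coefficients are then diagonal and independence applies. *)
Lemma iso_triangular :
  exists2 mu : {linear tensor (tensor WN_ W0_) WP_ -> W}, bijective mu &
    forall a b d, incl (mu (tens (tens a b) d)) = incl a * incl b * incl d.
Proof.
have [dt Y] := image_family; have [mf mf_bij mfE] := iso_flat.
pose j : {linear tensor WN_ W0_ -> A} := @incl C A Wflat_ \o mf.
have jE a b : j (tens a b) = incl a * incl b by exact: mfE.
suff [mu mu_bij muE] : @mult_iso C A (tensor WN_ W0_) WP_ W j.
  by exists mu => // a b d; rewrite muE jE.
have WA := subalg_setP W.
apply: mult_iso_of => [t e|x Wx|mu muE t].
- apply: (subalgM WA); last first.
    by have := incl_mem e; rewrite [X in X _]WPE => /SE_W.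
  move: t; apply: tensor_ind => [|a b].
    have [w0 wD] := subalg_submod WA.
    split=> [|c u v Wu Wv] /=; first by rewrite /= raddf0.
    by rewrite linearP; exact: wD.
  suff : subalg_set W (j (tens a b)) by [].
  rewrite jE; apply: (subalgM WA).
    by have := incl_mem a; rewrite [X in X _]WNE => /SF_W.
  by have := incl_mem b; rewrite [X in X _]W0E => /SD_W.
- set L := lspan _; have HL : is_submod L by exact: lspan_submod.
  move: x Wx => x /W_triang; move: x; apply: (mulspan_sub HL) => f y Nf /(sharp_span eps0 Y).
  move: y; apply: (mulspan_sub (submod_mull f HL)) => z e Zz Pe /=.
  rewrite -[X in X _]W0E in Zz; rewrite -[X in X _]WPE in Pe; rewrite -[X in X _]WNE in Nf.
  apply: sub_lspan; exists (tens (mkincl Nf) (mkincl Zz)) => //.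
  by exists (mkincl Pe) => //; rewrite jE !mkinclK mulrA.
have [v ->] := tensor_expand_r em_sub_span t.
have [z zE] : exists z, forall J, v J = \sum_S tens (fm_sub S) (z J S).
  by have [z zE] := choice (fun J => tensor_expand_l fm_sub_span (v J)); exists z.
have [u uE] := W0_lift (fun JS : {set 'I_k} * {set 'I_k} => z JS.1 JS.2).
move=> mu0; apply: big1 => J _; rewrite zE.
suff u0 S : u (J, S) = 0.
  rewrite (big1 _ xpredT) ?tens0l // => S _.
  by rewrite (zero_W0 (uE (J, S)) (u0 S)) tens0r.
move: S J; apply: (triangular_indep (u := fun S J => u (J, S))).
have := congr1 (@incl C A W) mu0; rewrite raddf0 raddf_sum /= raddf_sum => sum0.
rewrite exchange_big -[RHS]sum0; apply: eq_bigr => J _; rewrite /= muE zE raddf_sum mulr_suml.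
by apply: eq_bigr => S _; rewrite /= mfE /= uE fm_subE em_subE.
Qed.

(** ** Projections *)

(** The monomial obtained is never empty, which is why the diagonal subalgebra
    avoids the ideals of the projections. *)
Lemma ordmon_mul_left (y : 'I_k -> A) r (i : 'I_k) :
  (forall i j, y i * y j + y j * y i = 0) -> uniq r -> (forall i, i \in r) ->
  forall S, exists (T : {set 'I_k}) c, y i * ordmon y r S = c *: ordmon y r T /\ T != finset.set0.
Proof.
move=> yC ur rI S; have [c cE] := ordmon_mul C2 yC S ur (rI i).
exists (i |: S), c; split=> //; apply/set0Pn; exists i; exact: finset.setU11.
Qed.

Lemma th_W0 x : gen SD x -> th x = x.
Proof.
apply: (subalg_gen_sub (P := [set x | th x = idfun x])) => [|y].
  exact: equalizer_subalg.
rewrite -gens0 => -[z Oz <-] /=.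
have sz : (s z.1.1 z.1.2 < z.2)%N by apply: Omega_ygen; rewrite [Omega0 _ _]Oz.
rewrite (thE (gr_gen (exist _ z sz))) /= /dparity.
by have /andP[/eqP -> _] : Omega0 py z := Oz; rewrite addbb expr0 scale1r.
Qed.

Lemma gr_W0 x : gen SD x -> gr false x.
Proof.
have G : is_subalg (gr false) by split=> // u v gu gv; exact: (gr_alg gu gv).
move: x; apply: (subalg_gen_sub G) => y.
rewrite -gens0 => -[z Oz <-] /=.
have sz : (s z.1.1 z.1.2 < z.2)%N by apply: Omega_ygen; rewrite [Omega0 _ _]Oz.
have := gr_gen (exist _ z sz); rewrite /= /dparity.
by have /andP[/eqP -> _] : Omega0 py z := Oz; rewrite addbb.
Qed.

Lemma par_sum : par 0 (+) par 1 = true.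
Proof. by move: par01; case: (par 0); case: (par 1). Qed.

Lemma th_E j : th (E j) = - E j.
Proof.
have sj : (s 0%R 1%R < (s12 s + j).+1)%N by rewrite ltnS leq_addr.
have := thE (gr_gen (exist (fun x : dindex => is_true (s x.1.1 x.1.2 < x.2)%N) ((0 : 'I_2), (1 : 'I_2), (s12 s + j).+1) sj)).
by rewrite /= /dparity /= dr_e par_sum expr1 scaleN1r.
Qed.

Lemma th_F j : th (F j) = - F j.
Proof.
have sj : (s 1%R 0%R < (s21 s + j).+1)%N by rewrite ltnS leq_addr.
have := thE (gr_gen (exist (fun x : dindex => is_true (s x.1.1 x.1.2 < x.2)%N) ((1 : 'I_2), (0 : 'I_2), (s21 s + j).+1) sj)).
by rewrite /= /dparity /= dr_f addbC par_sum expr1 scaleN1r.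
Qed.

(** A retraction along an ideal stable under the parity automorphism is even,
    since its values are. *)
Lemma retraction_even (V : subalgebra A) (K : set A) (phi : {lrmorphism V -> W0_}) :
  is_submod K -> (forall y, K y -> K (th y)) ->
  (forall x z, phi x = z <-> K (incl x - incl z)) ->
  even_map (sub_grading gr V) (sub_grading gr W0_) phi.
Proof.
move=> HK Kth phiK p x; rewrite /sub_grading /= => gx.
have z_even (z : W0_) : gr false (incl z) by apply: gr_W0; rewrite -W0E; exact: incl_mem.
case: p gx => // gx; suff -> : phi x = 0 by rewrite raddf0; case: (gr_sub true).
(* If [x] is odd then [x] and [- x] have the same image. *)
have thz (z : W0_) : th (incl z) = incl z by apply: th_W0; rewrite -W0E; exact: incl_mem.
have Kx : K (incl x - incl (phi x)) by apply/phiK.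
have := Kth _ Kx; rewrite raddfB /= thz (thE gx) expr1 scaleN1r => KNx.
have phiN : phi (- x) = phi x by apply/phiK; rewrite raddfN.
have /eqP : phi x + phi x = 0 by rewrite -{1}phiN raddfN addNr.
rewrite -mulr2n -scaler_nat scaler_eq0 (negPf C2) /=.
by move/eqP.
Qed.

Definition retraction (V : subalgebra A) (i j : 'I_2) (phi : V -> W0_) : Prop :=
  [/\ even_map (sub_grading gr V) (sub_grading gr W0_) phi,
      forall y, exists x, phi x = y,
      forall r, (s i j < r)%N ->
        exists2 x : V, incl x = dr (i, j, r) & phi x = 0
    & forall (x : V) (y : W0_), incl x = incl y -> phi x = y].

(** Uniqueness holds because the conditions determine the values on generators;
    existence is [projection_of] for the ideal [K]. *)
Lemma retraction_exists (V : subalgebra A) (K : set A) (i j : 'I_2) :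
  is_submod K -> (forall y, K y -> K (th y)) ->
  (forall P : set A, is_subalg P -> SD `<=` P ->
     (forall r, (s i j < r)%N -> P (dr (i, j, r))) -> subalg_set V `<=` P) ->
  SD `<=` subalg_set V -> K `<=` subalg_set V ->
  (forall r, (s i j < r)%N -> K (dr (i, j, r))) ->
  (forall x y, subalg_set V x -> K y -> K (x * y)) ->
  (forall x y, subalg_set V x -> K y -> K (y * x)) ->
  (forall z, gen SD z -> K z -> z = 0) ->
  exists2 phi : {lrmorphism V -> W0_}, retraction i j phi &
    forall psi : {lrmorphism V -> W0_}, retraction i j psi -> psi =1 phi.
Proof.
move=> HK Kth Vind DV KV Kdr Kl Kr ZK.
have ZV z : gen SD z -> subalg_set V z.
  by move: z; apply: subalg_gen_sub => //; exact: subalg_setP.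
have VZ x : subalg_set V x -> exists2 z, gen SD z & K (x - z).
  pose Q := [set x | subalg_set V x /\ exists2 z, gen SD z & K (x - z)].
  suff VQ : subalg_set V `<=` Q by move=> /VQ[].
  have [K0 KD] := HK; have [[v0 vD] v1 vM] := subalg_setP V.
  have [[z0 zD] z1 zM] := subalg_setP (subalg_gen SD).
  apply: Vind => [|y Dy|r sr].
  - split=> [||y w [Vy [z Zz Kz]] [Vw [z' Zz' Kz']]].
    + split=> [|a y w [Vy [z Zz Kz]] [Vw [z' Zz' Kz']]].
        by split=> //; exists 0 => //; rewrite subrr.
      split; first exact: vD.
      exists (a *: z + z'); first exact: zD.
      by rewrite opprD addrACA -scalerBr; apply: KD.
    + by split=> //; exists 1 => //; rewrite subrr.
    split; first exact: vM.
    exists (z * z'); first exact: zM.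
    rewrite (_ : _ - _ = y * (w - z') + (y - z) * z').
      by apply: (submodD HK); [exact: Kl | apply: Kr => //; exact: ZV].
    by rewrite mulrBr mulrBl addrA subrK.
  - split; first exact: DV.
    by exists y; [exact: sub_subalg_gen | rewrite subrr].
  - split; first exact/KV/Kdr.
    by exists 0 => //; rewrite subr0; exact: Kdr.
have VZ' x : subalg_set V x -> exists2 z, subalg_set W0_ z & K (x - z).
  by move=> /VZ[z /W0_iff]; exists z.
have ZV' z : subalg_set W0_ z -> subalg_set V z by move=> /W0_iff; exact: ZV.
have ZK' z : subalg_set W0_ z -> K z -> z = 0 by move=> /W0_iff; exact: ZK.
have [phi phiK] := projection_of HK VZ' Kl Kr ZV' ZK'.
have phi0 (x : V) : K (incl x) -> phi x = 0.
  by move=> Kx; apply/phiK; rewrite (raddf0 (@incl C A W0_)) subr0.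
have phiid (x : V) (y : W0_) : incl x = incl y -> phi x = y.
  by move=> xy; apply/phiK; rewrite xy subrr; case: HK.
exists phi.
  split=> [|y|r sr|x y]; last exact: phiid.
  - exact: retraction_even phiK.
  - by exists (mkincl (ZV' _ (incl_mem y))); apply: phiid; rewrite mkinclK.
  - exists (mkincl (KV _ (Kdr _ sr))); first by rewrite mkinclK.
    by apply: phi0; rewrite mkinclK; exact: Kdr.
move=> psi [_ _ psi0 psiid] x.
pose Q := [set u | exists2 v : V, incl v = u & psi v = phi v].
suff [v /incl_inj <-] : Q (incl x) by [].
move: (incl x) (incl_mem x); apply: Vind => [|y Dy|r sr].
- split=> [||_ _ [v <- pv] [w <- pw]].
  + split=> [|a _ _ [v <- pv] [w <- pw]].
      by exists 0; rewrite !raddf0.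
    exists (a *: v + w); first exact: linearP.
    by rewrite !linearP /= pv pw.
  + by exists 1; rewrite !rmorph1.
  + exists (v * w); first exact: rmorphM.
    by rewrite !rmorphM /= pv pw.
- have Zy : subalg_set W0_ y by apply/W0_iff; exact: sub_subalg_gen.
  exists (mkincl (DV _ Dy)); first by rewrite mkinclK.
  by rewrite (psiid _ (mkincl Zy)) ?(phiid _ (mkincl Zy)) ?mkinclK.
- have [v vE v0] := psi0 r sr; exists v => //; rewrite v0 phi0 // vE; exact: Kdr.
Qed.

Lemma th_gen (S : set A) : (forall x, S x -> gen S (th x)) ->
  forall x, gen S x -> gen S (th x).
Proof.
move=> Sth; apply: (subalg_gen_sub (P := [set x | gen S (th x)])) => //.
exact: (subalg_preimage th (subalg_setP _)).
Qed.

Lemma th_SDSE x : SH x -> SH (th x).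
Proof.
apply: th_gen => y [Dy|[i _ <-]].
  by rewrite th_W0; [apply: sub_subalg_gen; left | exact: sub_subalg_gen].
rewrite th_E; apply: (submodN (subalg_submod (subalg_setP _))).
by apply: sub_subalg_gen; right; exists i.
Qed.

Lemma th_SFSD x : FL x -> FL (th x).
Proof.
apply: th_gen => y [[i _ <-]|Dy]; last first.
  by rewrite th_W0; [apply: sub_subalg_gen; right | exact: sub_subalg_gen].
rewrite th_F; apply: (submodN (subalg_submod (subalg_setP _))).
by apply: sub_subalg_gen; left; exists i.
Qed.

Lemma submod_preimage (V1 V2 : lmodType C) (h : {linear V1 -> V2}) (P : set V2) :
  is_submod P -> is_submod [set x | P (h x)].
Proof. by move=> [P0 PD]; split=> [|a u v Pu Pv] /=; rewrite ?raddf0 // linearP; exact: PD. Qed.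

Lemma dr_raise r : (s 0%R 1%R < r)%N -> dr (0, 1, r) = E (r - (s12 s).+1).
Proof. by move=> sr; rewrite -dr_e -addSn subnKC. Qed.
Lemma dr_lower r : (s 1%R 0%R < r)%N -> dr (1, 0, r) = F (r - (s21 s).+1).
Proof. by move=> sr; rewrite -dr_f -addSn subnKC. Qed.

(** The ideal is spanned by the products containing an [E].  In triangular order
    these are the products with a nonempty monomial in the [E], so that the ideal
    meets the diagonal subalgebra trivially. *)
Lemma sharp_retraction :
  exists2 phi : {lrmorphism Wsharp_ -> W0_}, retraction 0 1 phi &
    forall psi : {lrmorphism Wsharp_ -> W0_}, retraction 0 1 psi -> psi =1 phi.
Proof.
have [dt Y] := image_family.
pose ZE := mulspan (gen SD) SE; pose K := mulspan ZE SH.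
have HK : is_submod K by exact: lspan_submod.
have HZE : is_submod ZE by exact: lspan_submod.
have SHA : is_subalg SH by exact: subalg_setP.
have SDA : is_subalg (gen SD) by exact: subalg_setP.
have SDSH z : gen SD z -> SH z by apply: gen_mono => y; left.
have SESH z : SE z -> SH z by move=> ez; apply: sub_subalg_gen; right.
have ZESH y : ZE y -> SH y.
  move: y; apply: (mulspan_sub (subalg_submod SHA)) => z e Zz Ee.
  by apply: (subalgM SHA); [exact: SDSH | exact: SESH].
have ZEK y : ZE y -> K y.
  by move=> ZEy; rewrite -[y]mulr1; apply: mem_mulspan => //; exact: subalg1.
have Kr x y : SH x -> K y -> K (y * x).
  move=> SHx; apply: (mulspan_mulr HK) => z w ZEz SHw; apply: mem_mulspan => //.
  exact: (subalgM SHA).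
have Kl x y : SH x -> K y -> K (x * y).
  move=> SHx; move: x SHx y; apply: subalg_gen_sub; first exact: left_stabilizer_subalg.
  move=> x [Dx|[i _ <-]] y; apply: (mulspan_mull HK) => {}y w ZEy SHw.
    apply: mem_mulspan => //; move: y ZEy.
    apply: (mulspan_mull HZE) => z e Zz Ee; apply: mem_mulspan => //.
    by apply: (subalgM SDA) => //; exact: sub_subalg_gen.
  move: y ZEy; apply: (mulspan_sub (submod_mull (E i) (submod_mulr w HK))) => z e Zz Ee /=.
  rewrite mulrA -mulrA; apply: mem_mulspan.
    apply: (window_E_Z eps0 Y) => //; rewrite -[E i]mul1r; apply: mem_mulspan.
      exact: subalg1.
    by exists i.
  by apply: (subalgM SHA) => //; exact: SESH.
have EK r : (s 0%R 1%R < r)%N -> K (dr (0, 1, r)).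
  by move=> sr; rewrite dr_raise //; apply: ZEK; exact: (E_window eps0 Y).
have KSH : K `<=` SH.
  by apply: (mulspan_sub (subalg_submod SHA)) => y w /ZESH; exact: (subalgM SHA).
apply: (@retraction_exists _ K) => //; rewrite ?sharpE //.
- apply: (mulspan_sub (submod_preimage th HK)) => y w ZEy SHw /=.
  rewrite rmorphM; apply: mem_mulspan; last exact: th_SDSE.
  move: y ZEy; apply: (mulspan_sub (submod_preimage th HZE)) => z _ Zz [i _ <-] /=.
  rewrite rmorphM /= (th_W0 Zz) th_E mulrN; apply: (submodN HZE).
  by apply: mem_mulspan => //; exists i.
- move=> P HP DP EP; apply: subalg_gen_sub => // y [/DP//|[i _ <-]].
  by rewrite -dr_e; apply: EP; rewrite ltnS leq_addr.
- by move=> y Dy; apply: sub_subalg_gen; left.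
pose Q := [set y | exists u : {set 'I_k} -> Pol,
  u finset.set0 = 0 /\ y = \sum_J diag_image (u J) * em J].
have HQ : is_submod Q.
  split=> [|a _ _ [u [u0 ->]] [v [v0 ->]]].
    by exists (fun=> 0); split=> //; rewrite big1 // => J _; rewrite raddf0 mul0r.
  exists (fun J => a *: u J + v J); rewrite u0 v0 scaler0 addr0; split=> //.
  rewrite scaler_sumr -big_split; apply: eq_bigr => J _.
  by rewrite linearP mulrDl -scalerAl.
have KQ : K `<=` Q.
  apply: (mulspan_sub HQ) => y w ZEy SHw; move: y ZEy.
  apply: (mulspan_sub (submod_mulr w HQ)) => z e Zz Ee /=.
  move: w SHw => w /(sharp_span eps0 Y); move: w.
  apply: (mulspan_sub (submod_mull (z * e) HQ)) => z' p Zz' Pp /=.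
  rewrite mulrA -[z * e * z']mulrA.
  have : ZE (e * z').
    apply: (window_E_Z eps0 Y) => //; rewrite -[e]mul1r; apply: mem_mulspan => //.
    exact: subalg1.
  move: (e * z'); apply: (mulspan_sub (submod_mull z (submod_mulr p HQ))) => z2 _ Zz2 [i _ <-] /=.
  have [a ->] := em_span Pp; rewrite !mulr_sumr; apply: (submod_sum _ HQ) => J _.
  have [i'|T [c [cE T0]]] := ordmon_mul_left i (fun i j : 'I_k => E_anti i j) (enum_uniq 'I_k) _ J.
    by rewrite mem_enum.
  rewrite -scalerAr; apply: (submodZ _ HQ); have -> : z * (z2 * E i) * em J = z * z2 * (E i * em J) by rewrite !mulrA.
  rewrite [E i * em J]cE -scalerAr.
  apply: (submodZ _ HQ).
  have /Z_image[u uE] : gen SD (z * z2) by exact: (subalgM SDA).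
  exists (fun J => if J == T then u else 0); rewrite eq_sym (negPf T0); split=> //.
  rewrite (bigD1 T) //= eqxx uE big1 ?addr0 // => J' /negPf ->.
  by rewrite raddf0 mul0r.
move=> z /Z_image[u0 <-] /KQ[u [u00 uE]].
have H : forall J, (if J == finset.set0 then u0 else 0) - u J = 0.
  apply: triangular_indep_r; under eq_bigr do rewrite raddfB mulrBl.
  rewrite sumrB -uE (bigD1 finset.set0) //= eqxx em0 mulr1 big1 ?addr0 ?subrr // => J /negPf ->.
  by rewrite raddf0 mul0r.
by have := H finset.set0; rewrite eqxx u00 subr0 => ->; rewrite raddf0.
Qed.

(** As in the other case; the factor [F] can be taken to be the leftmost one. *)
Lemma flat_retraction :
  exists2 phi : {lrmorphism Wflat_ -> W0_}, retraction 1 0 phi &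
    forall psi : {lrmorphism Wflat_ -> W0_}, retraction 1 0 psi -> psi =1 phi.
Proof.
have [dt Y] := image_family.
pose FZ := mulspan SF (gen SD); pose K := mulspan SF FL.
have HK : is_submod K by exact: lspan_submod.
have FLA : is_subalg FL by exact: subalg_setP.
have SDA : is_subalg (gen SD) by exact: subalg_setP.
have SDFL z : gen SD z -> FL z by apply: gen_mono => y; right.
have SFFL z : SF z -> FL z by move=> fz; apply: sub_subalg_gen; left.
have FZK y w : FZ y -> FL w -> K (y * w).
  move=> + FLw; move: y; apply: (mulspan_mulr HK) => f z Ff Zz; apply: mem_mulspan => //.
  by apply: (subalgM FLA) => //; exact: SDFL.
have KFL : K `<=` FL.
  by apply: (mulspan_sub (subalg_submod FLA)) => y w /SFFL; exact: (subalgM FLA).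
have Kr x y : FL x -> K y -> K (y * x).
  move=> FLx; apply: (mulspan_mulr HK) => f w Ff FLw; apply: mem_mulspan => //.
  exact: (subalgM FLA).
have Kl x y : FL x -> K y -> K (x * y).
  move=> FLx; move: x FLx y; apply: subalg_gen_sub; first exact: left_stabilizer_subalg.
  move=> x [Fx|Dx] y Ky; first by apply: mem_mulspan => //; exact: KFL.
  move: y Ky; apply: (mulspan_mull HK) => f w Ff FLw; apply: FZK => //.
  apply: (window_Z_F eps0 Y); last exact: sub_subalg_gen.
  by rewrite -[f]mulr1; apply: mem_mulspan => //; exact: subalg1.
have FK r : (s 1%R 0%R < r)%N -> K (dr (1, 0, r)).
  move=> sr; rewrite dr_lower // -[F _]mulr1; apply: FZK; last exact: subalg1.
  exact: (F_window eps0 Y).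
apply: (@retraction_exists _ K) => //; rewrite ?flatE //.
- apply: (mulspan_sub (submod_preimage th HK)) => _ w [i _ <-] FLw /=.
  rewrite rmorphM /= th_F mulNr; apply: (submodN HK).
  by apply: mem_mulspan; [exists i | exact: th_SFSD].
- move=> P HP DP FP; apply: subalg_gen_sub => // y [[i _ <-]|/DP//].
  by rewrite -dr_f; apply: FP; rewrite ltnS leq_addr.
- by move=> y Dy; apply: sub_subalg_gen; right.
pose Q := [set y | exists u : {set 'I_k} -> Pol,
  u finset.set0 = 0 /\ y = \sum_S fm S * diag_image (u S)].
have HQ : is_submod Q.
  split=> [|a _ _ [u [u0 ->]] [v [v0 ->]]].
    by exists (fun=> 0); split=> //; rewrite big1 // => S _; rewrite (raddf0 diag_image) mulr0.
  exists (fun S => a *: u S + v S); rewrite u0 v0 scaler0 addr0; split=> //.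
  rewrite scaler_sumr -big_split; apply: eq_bigr => S _.
  by rewrite linearP mulrDr -scalerAr.
have KQ : K `<=` Q.
  apply: (mulspan_sub HQ) => _ w [i _ <-] /(flat_span eps0 Y); move: w.
  apply: (mulspan_sub (submod_mull (F i) HQ)) => n z Nn /Z_image[u uE] /=.
  have [a ->] := fm_span Nn; rewrite mulr_suml mulr_sumr.
  apply: (submod_sum _ HQ) => S _.
  have [||T [c [cE T0]]] := ordmon_mul_left (r := rev (enum 'I_k)) i
      (fun i j : 'I_k => F_anti i j) _ _ S.
  - by rewrite rev_uniq enum_uniq.
  - by move=> i'; rewrite mem_rev mem_enum.
  rewrite -scalerAl -scalerAr; apply: (submodZ _ HQ).
  rewrite mulrA [F i * fm S]cE -scalerAl; apply: (submodZ _ HQ).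
  exists (fun J => if J == T then u else 0); rewrite eq_sym (negPf T0); split=> //.
  rewrite (bigD1 T) //= eqxx uE big1 ?addr0 // => J' /negPf ->.
  by rewrite (raddf0 diag_image) mulr0.
move=> z /Z_image[u0 <-] /KQ[u [u00 uE]].
have H : forall S, (if S == finset.set0 then u0 else 0) - u S = 0.
  apply: triangular_indep_l; under eq_bigr do rewrite raddfB mulrBr.
  rewrite sumrB -uE (bigD1 finset.set0) //= eqxx fm0 mul1r big1 ?addr0 ?subrr // => S /negPf ->.
  by rewrite (raddf0 diag_image) mulr0.
by have := H finset.set0; rewrite eqxx u00 subr0 => ->; rewrite raddf0.
Qed.

End Assembly.

(** * The principal W-algebra *)

Lemma embedding_of_presentation (C : fieldType) (A : algType C) (gr : bool -> set A)
    (W : subalgebra A) (X : choiceType) (par : X -> bool) (R : relations C X) (g : X -> A) :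
  presented_by gr W par R g ->
  exists Phi : {lrmorphism presented R -> A},
    [/\ forall y, Phi y = 0 -> y = 0, forall x, Phi (pgen R x) = g x,
        forall x, subalg_set W x <-> exists y, Phi y = x
      & forall x, gr (par x) (g x)].
Proof.
case=> phi [phi_even [psi phiK psiK] phiE].
have [Phi PhiE] : exists Phi : {lrmorphism presented R -> A},
    forall y, Phi y = incl (phi y) by exists (@incl C A W \o phi).
exists Phi; split.
- move=> y; rewrite PhiE => y0; apply: (can_inj phiK); apply: incl_inj.
  by rewrite y0 !raddf0.
- by move=> x; rewrite PhiE phiE.
- move=> x; split=> [Wx|[y <-]]; last by rewrite PhiE; exact: incl_mem.
  by exists (psi (mkincl Wx)); rewrite PhiE psiK mkinclK.
move=> x; rewrite -phiE; apply: phi_even; apply: gen_grading_gen.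
by exists x.
Qed.

(** Stated over any algebraically closed field with a norm: the proof splits
    polynomials into linear factors and divides by integers. *)
Theorem shifted_yangian_triangular (C : numClosedFieldType) (par : 'I_2 -> bool) (py : pyramid)
    (s : 'M[nat]_2) :
  par 0 != par 1 ->
  is_shift_matrix s ->
  compatible s py ->
  W_is_shifted_yangian C par py s ->
  let W := Wpi C par py in
  let W0 := W0 C par py in
  let Wplus := WP C par py s in
  let Wminus := WN C par py s in
  let Wsharp := Wsharp C par py s in
  let Wflat := Wflat C par py s in
  [/\ [/\ free_supercommutative_on_Omega C par py (Omega0 py),
          free_supercommutative_on_Omega C par py (OmegaP py s)
        & free_supercommutative_on_Omega C par py (OmegaN py s)],
      [/\ mul_iso3 Wminus W0 Wplus W,
          mul_iso2 W0 Wplus Wsharp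
        & mul_iso2 Wminus W0 Wflat],
      unique_projection s Wsharp 0 1
    & unique_projection s Wflat 1 0].
Proof.
move=> par01 shift compat /embedding_of_presentation[Phi [Phi_inj PhiE WPhi gr_gen]].
move=> W W0 Wplus Wminus Wsharp Wflat.
pose gr := @Ugl_grading C _ (@bpar par py).
have gr_alg p q x y : gr p x -> gr q y -> gr (p (+) q) (x * y) by exact: gen_gradingM.
have gr_sub p : is_submod (gr p) by exact: lspan_submod.
have gr1 : gr false 1 by exact: gen_grading1.
have [th thE] := @parity_automorphism C _ (@bpar par py).
split; [split|split|..].
- exact: (free_Omega0 shift compat Phi_inj PhiE gr_alg gr_sub gr1 gr_gen).
- exact: (free_OmegaP shift compat Phi_inj PhiE gr_alg gr_sub gr1 gr_gen par01).
- exact: (free_OmegaN shift compat Phi_inj PhiE gr_alg gr_sub gr1 gr_gen par01).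
- exact: (iso_triangular shift compat Phi_inj PhiE WPhi).
- exact: (iso_sharp shift compat Phi_inj PhiE).
- exact: (iso_flat shift compat Phi_inj PhiE).
- exact: (sharp_retraction shift compat Phi_inj PhiE gr_alg gr_sub gr1 gr_gen thE par01).
- exact: (flat_retraction shift compat Phi_inj PhiE gr_alg gr_sub gr1 gr_gen thE par01).
Qed.

Theorem theorem6p1 (R : realType) (par : 'I_2 -> bool) (py : pyramid)
    (s : 'M[nat]_2) :
  par 0 != par 1 ->
  is_shift_matrix s ->
  compatible s py ->
  W_is_shifted_yangian R[i] par py s ->
  let W := Wpi R[i] par py in
  let W0 := W0 R[i] par py in
  let Wplus := WP R[i] par py s in
  let Wminus := WN R[i] par py s in
  let Wsharp := Wsharp R[i] par py s in
  let Wflat := Wflat R[i] par py s in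
  [/\ [/\ free_supercommutative_on_Omega R[i] par py (Omega0 py),
          free_supercommutative_on_Omega R[i] par py (OmegaP py s)
        & free_supercommutative_on_Omega R[i] par py (OmegaN py s)],
      [/\ mul_iso3 Wminus W0 Wplus W,
          mul_iso2 W0 Wplus Wsharp
        & mul_iso2 Wminus W0 Wflat],
      unique_projection s Wsharp 0 1
    & unique_projection s Wflat 1 0].
Proof. exact: shifted_yangian_triangular. Qed.
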